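(* Let $q\ge 3$, let $\mathbb S$ be an exterior splash in $\mathrm{PG}(6,q)$, let $\mathbb X$ be one cover of $\mathbb S$, and let $[\mathcal N]$ be an $\mathbb X$-special twisted cubic, with $\mathcal N$ the corresponding set of points of $\mathrm{PG}(2,q^3)$. Then in $\mathrm{PG}(2,q^3)$ there is a unique exterior order-$q$-subplane $\pi$ that contains $\mathcal N$. Further, $\pi$ has exterior splash $\mathbb S$ and conic cover $\mathbb X$, and $\mathcal N$ is a $(\pi,\ell_\infty)$-special conic of $\pi$.
   Context: Bruck-Bose representation. $q$ is a prime power. $\Sigma_\infty\cong\mathrm{PG}(5,q)$ is a hyperplane of $\mathrm{PG}(6,q)$ and $\mathcal S$ is a regular $2$-spread of $\Sigma_\infty$: a set of $q^3+1$ planes partitioning the points of $\Sigma_\infty$ and containing the $2$-regulus through any three of its planes. (A $2$-regulus is a set of $q+1$ mutually disjoint planes such that any line meeting three of them meets all.) The points of $\mathrm{PG}(6,q)\setminus\Sigma_\infty$, together with the $3$-spaces not in $\Sigma_\infty$ that contain a plane of $\mathcal S$ as lines, form an affine plane whose projective completion $\mathcal P(\mathcal S)$ is $\mathrm{PG}(2,q^3)$; points of the line at infinity $\ell_\infty$ correspond to planes of $\mathcal S$. For a set $X$ of points of $\mathrm{PG}(2,q^3)$, $[X]$ is the corresponding set in $\mathrm{PG}(6,q)$. A twisted cubic is a normal rational curve of order 3 in a 3-space; curves defined over $\mathbb F_q$ are extended to $\mathbb F_{q^3}$ by the same parametrisation. Subplanes and splashes. An order-$q$-subplane of $\mathrm{PG}(2,q^3)$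 is an image of $\mathrm{PG}(2,q)$ under $\mathrm{PGL}(3,q^3)$; it is exterior if it has no point on $\ell_\infty$. The exterior splash $\mathbb S$ of an exterior order-$q$-subplane $\pi$ is the set of $q^2+q+1$ points of $\ell_\infty$ lying on extended lines of $\pi$; it is identified with the corresponding set of $q^2+q+1$ planes of $\mathcal S$. An exterior splash is any set arising in this way. Special conics. Let $m,n$ be the two conjugates of $\ell_\infty$ with respect to $\pi$ (if $\pi=\phi(\mathrm{PG}(2,q))$, conjugation is $\phi\circ\mathrm{Frob}_q\circ\phi^{-1}$) and $E_1=\ell_\infty\cap m$, $E_2=\ell_\infty\cap n$, $E_3=m\cap n$. A $(\pi,\ell_\infty)$-special conic is a conic of $\pi$ (given by a quadratic equation over $\mathbb F_q$ in coordinates in which $\pi=\mathrm{PG}(2,q)$) whose extension to $\mathrm{PG}(2,q^3)$ (same equation) contains $E_1,E_2,E_3$. Covers. $\mathbb S$ has exactly two covers: sets of $q^2+q+1$ mutually disjoint planes of $\Sigma_\infty$ covering the same points as the planes of $\mathbb S$ and each meeting every plane of $\mathbb S$ in exactly one point. Planes from different covers meet in exactly one point. Each cover $\mathbb X$ has exactly three transversal lines: lines $g,g^q,g^{q^2}$ of the cubic extension $\mathrm{PG}(5,q^3)$ of $\Sigma_\infty$, conjugate under the $q$-Frobenius map and disjoint from $\Sigma_\infty$, that meet the extension of every plane of $\mathbb X$. Tangent and conic cover. For a line $\ell$ of $\pi$, $[\ell]$ (the $q+1$ points of $\pi$ on $\ell$) is a twisted cubic. For $P\in\pi$, the $q+1$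 tangent lines at $P$ to the twisted cubics $[\ell]$, $\ell$ a line of $\pi$ through $P$, lie in a plane $\mathcal T_P$, and the line $\mathcal T_P\cap\Sigma_\infty$ lies in a plane of one of the two covers, the same cover for every $P\in\pi$. This cover is the tangent cover $\mathbb T$ of $\pi$; the other one is the conic cover $\mathbb C$ of $\pi$. Special twisted cubics. For a cover $\mathbb X$ of an exterior splash, an $\mathbb X$-special twisted cubic is a twisted cubic $\mathcal N$ in a $3$-space of $\mathrm{PG}(6,q)$, not contained in $\Sigma_\infty$, through a plane of $\mathbb X$, such that the extension of $\mathcal N$ to $\mathrm{PG}(6,q^3)$ meets the three transversal lines of $\mathbb X$. (Such a curve has no $\mathbb F_q$-rational points in $\Sigma_\infty$.) *)

(* Defs.v *)
From HB Require Import structures.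
From mathcomp Require Import all_boot all_order all_algebra all_field.
From mathcomp Require Import boolp classical_sets functions cardinality.

Set Implicit Arguments.
Unset Strict Implicit.
Unset Printing Implicit Defensive.

Import GRing.Theory.

Local Open Scope classical_set_scope.
Local Open Scope card_scope.
Local Open Scope ring_scope.

(* Projective subspaces are vector subspaces: a d-dimensional projective
   subspace has vector dimension d + 1, and disjoint means meeting in 0. *)
Section Projective.
Variables (K : fieldType) (V : vectType K).

Definition flats (d : nat) : set {vspace V} := [set U | \dim U = d.+1].

Definition disjoint_flats (X : set {vspace V}) : Prop :=
  forall U W, X U -> X W -> U <> W -> (U :&: W = 0)%VS.

Definition planes_in (H : {vspace V}) (X : set {vspace V}) : Prop :=
  forall U, X U -> flats 2 U /\ (U <= H)%VS.

Definition covered (X : set {vspace V}) : set {vspace V} :=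
  [set P | flats 0 P /\ exists2 U, X U & (P <= U)%VS].

(* A line meeting three planes of R is required to meet all of them. *)
Definition regulus2 (q : nat) (H : {vspace V}) (R : set {vspace V}) : Prop :=
  [/\ R #= `I_q.+1, planes_in H R, disjoint_flats R &
      forall g A B C, flats 1 g -> R A -> R B -> R C ->
        A <> B -> A <> C -> B <> C ->
        (g :&: A != 0)%VS -> (g :&: B != 0)%VS -> (g :&: C != 0)%VS ->
        forall D, R D -> (g :&: D != 0)%VS].

Definition regular_spread (q : nat) (H : {vspace V}) (Sp : set {vspace V}) :
    Prop :=
  [/\ Sp #= `I_((q ^ 3).+1)%N, planes_in H Sp, disjoint_flats Sp,
      covered Sp = [set P | flats 0 P /\ (P <= H)%VS] &
      forall A B C, Sp A -> Sp B -> Sp C -> A <> B -> A <> C -> B <> C ->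
        exists R, [/\ regulus2 q H R, R A, R B, R C & R `<=` Sp]].

(* The cover conditions relative to the planes SS of an exterior splash. *)
Definition is_cover (q : nat) (H : {vspace V}) (SS X : set {vspace V}) :
    Prop :=
  [/\ X #= `I_(q ^ 2 + q + 1)%N, planes_in H X, disjoint_flats X,
      covered X = covered SS &
      forall U W, X U -> SS W -> flats 0 (U :&: W)%VS].

(* Points and lines of the projective completion of P(Sp).  A point is either
   an affine point or a plane of Sp; a line is either a 3-space or H itself
   (the line at infinity).  In all four cases incidence is inclusion. *)
Definition affine_point (H : {vspace V}) : set {vspace V} :=
  [set P | flats 0 P /\ ~~ (P <= H)%VS].

Definition bb_point (H : {vspace V}) (Sp : set {vspace V}) : set {vspace V} :=
  affine_point H `|` Sp.

Definition bb_line (H : {vspace V}) (Sp : set {vspace V}) : set {vspace V} :=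
  [set M | M = H \/
     [/\ flats 3 M, ~~ (M <= H)%VS & exists2 U, Sp U & (U <= M)%VS]].

End Projective.

(* beta identifies P(Sp) with the projective plane of V', H with linf. *)
Definition bruck_bose (K K' : fieldType) (V : vectType K) (V' : vectType K')
    (H : {vspace V}) (Sp : set {vspace V}) (linf : {vspace V'})
    (beta : {vspace V} -> {vspace V'}) : Prop :=
  set_bij (bb_point H Sp) (@flats K' V' 0) beta /\
  exists gamma : {vspace V} -> {vspace V'},
    [/\ set_bij (bb_line H Sp) (@flats K' V' 1) gamma, gamma H = linf &
        forall P M, bb_point H Sp P -> bb_line H Sp M ->
          (P <= M)%VS = (beta P <= gamma M)%VS].

Section Cubic.
Variable (R : nzRingType).

Definition cubic_row (s t : R) : 'rV[R]_4 :=
  \row_(i < 4) (s ^+ (3 - i) * t ^+ i).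

Definition cubic_ds (s t : R) : 'rV[R]_4 :=
  \row_(i < 4) ((s ^+ (3 - i).-1 * t ^+ i) *+ (3 - i)).

Definition cubic_dt (s t : R) : 'rV[R]_4 :=
  \row_(i < 4) ((s ^+ (3 - i) * t ^+ i.-1) *+ i).

Definition qform n (A : 'M[R]_n) (v : 'rV[R]_n) : R :=
  (v *m A *m v^T) 0 0.

End Cubic.

Section CubicExtension.
Variables (F : finFieldType) (L : fieldExtType F).

Local Notation q := #|F|.
Local Notation emb := (map_mx (in_alg L)).

Definition extend n (U : {vspace 'rV[F]_n}) : {vspace 'rV[L]_n} :=
  <<[seq emb v | v <- vbasis U]>>%VS.

Definition frob_row n (v : 'rV[L]_n) : 'rV[L]_n :=
  map_mx (fun x => x ^+ q) v.

(* Subplanes: M is the matrix of phi, acting on row vectors on the right. *)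

Definition subplane_of (M : 'M[L]_3) : set {vspace 'rV[L]_3} :=
  [set P | exists2 v : 'rV[F]_3, v != 0 & P = <[emb v *m M]>%VS].

Definition subplane (pi : set {vspace 'rV[L]_3}) : Prop :=
  exists2 M, M \in unitmx & pi = subplane_of M.

Definition exterior_subplane (linf : {vspace 'rV[L]_3})
    (pi : set {vspace 'rV[L]_3}) : Prop :=
  subplane pi /\ forall P, pi P -> ~~ (P <= linf)%VS.

(* The extended lines of pi. *)
Definition subplane_line (pi : set {vspace 'rV[L]_3}) :
    set {vspace 'rV[L]_3} :=
  [set l | flats 1 l /\
     exists P Q, [/\ pi P, pi Q, P <> Q, (P <= l)%VS & (Q <= l)%VS]].

Definition splash (linf : {vspace 'rV[L]_3}) (pi : set {vspace 'rV[L]_3}) :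
    set {vspace 'rV[L]_3} :=
  [set P | [/\ flats 0 P, (P <= linf)%VS &
     exists2 l, subplane_line pi l & (P <= l)%VS]].

(* phi o Frob_q o phi^-1, on subspaces *)
Definition conj_flat (M : 'M[L]_3) (U : {vspace 'rV[L]_3}) :
    {vspace 'rV[L]_3} :=
  <<[seq frob_row (v *m invmx M) *m M | v <- vbasis U]>>%VS.

(* The form v |-> v A v^T has no singular point: A + A^T is the matrix of its
   polar form.  As F is perfect, a singular ternary form has a singular point
   with coordinates in F, so this is irreducibility over the closure of F. *)
Definition nonsingular_form (A : 'M[F]_3) : Prop :=
  forall v : 'rV[F]_3, v != 0 -> qform A v = 0 -> v *m (A + A^T) != 0.

Definition conic_of (M : 'M[L]_3) (A : 'M[F]_3) : set {vspace 'rV[L]_3} :=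
  [set P | exists v : 'rV[F]_3,
     [/\ v != 0, qform A v = 0 & P = <[emb v *m M]>%VS]].

Definition extended_conic_of (M : 'M[L]_3) (A : 'M[F]_3) :
    set {vspace 'rV[L]_3} :=
  [set P | exists v : 'rV[L]_3,
     [/\ v != 0, qform (emb A) v = 0 & P = <[v *m M]>%VS]].

Definition special_conic (linf : {vspace 'rV[L]_3})
    (pi N : set {vspace 'rV[L]_3}) : Prop :=
  exists (M : 'M[L]_3) (A : 'M[F]_3),
    [/\ M \in unitmx, pi = subplane_of M, nonsingular_form A,
        N = conic_of M A &
        let m := conj_flat M linf in let n := conj_flat M m in
        [/\ extended_conic_of M A (linf :&: m)%VS,
            extended_conic_of M A (linf :&: n)%VS &
            extended_conic_of M A (m :&: n)%VS]].

(* The rows of A : 'M_(4, 7), when independent, parametrise a twisted cubic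
   (s, t) |-> s^3 A_0 + s^2 t A_1 + s t^2 A_2 + t^3 A_3 of PG(6, q). *)

Definition cubic_points (A : 'M[F]_(4, 7)) : set {vspace 'rV[F]_7} :=
  [set P | exists s t : F,
     (s, t) != (0, 0) /\ P = <[cubic_row s t *m A]>%VS].

Definition cubic_solid (A : 'M[F]_(4, 7)) : {vspace 'rV[F]_7} :=
  <<[seq row i A | i <- enum 'I_4]>>%VS.

(* In characteristic 3 the two partial derivatives alone need not span the
   tangent line. *)
Definition cubic_tangent (A : 'M[F]_(4, 7)) (s t : F) : {vspace 'rV[F]_7} :=
  (<[cubic_row s t *m A]> + <[cubic_ds s t *m A]> + <[cubic_dt s t *m A]>)%VS.

(* The lines of PG(5, q^3) without F-rational points that meet the extension
   of every plane of X: for X a cover, or a regular 2-spread, these are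
   exactly three lines, conjugate under Frobenius. *)
Definition transversal_line (H : {vspace 'rV[F]_7}) (X : set {vspace 'rV[F]_7}) :
    set {vspace 'rV[L]_7} :=
  [set g | [/\ flats 1 g, (g <= extend H)%VS,
     forall v : 'rV[F]_7, emb v \in g -> v = 0 &
     forall U, X U -> (g :&: extend U != 0)%VS]].

Definition special_twisted_cubic (H : {vspace 'rV[F]_7})
    (X : set {vspace 'rV[F]_7}) (A : 'M[F]_(4, 7)) : Prop :=
  [/\ row_free A, ~~ (cubic_solid A <= H)%VS,
      exists2 U, X U & (U <= cubic_solid A)%VS &
      forall g, transversal_line H X g -> exists s t : L,
        (s, t) != (0, 0) /\ cubic_row s t *m emb A \in g].

Section Representation.
Variables (H : {vspace 'rV[F]_7}) (Sp : set {vspace 'rV[F]_7}).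
Variables (linf : {vspace 'rV[L]_3}).
Variables (beta : {vspace 'rV[F]_7} -> {vspace 'rV[L]_3}).

Definition splash_planes (pi : set {vspace 'rV[L]_3}) :
    set {vspace 'rV[F]_7} :=
  [set U | Sp U /\ splash linf pi (beta U)].

Definition exterior_splash (SS : set {vspace 'rV[F]_7}) : Prop :=
  exists2 pi, exterior_subplane linf pi & SS = splash_planes pi.

(* [l]: the affine points of PG(6, q) corresponding to the points of pi on l *)
Definition bracket_line (pi : set {vspace 'rV[L]_3}) (l : {vspace 'rV[L]_3}) :
    set {vspace 'rV[F]_7} :=
  [set P | [/\ affine_point H P, pi (beta P) & (beta P <= l)%VS]].

(* For #|F| <= 4 the q + 1 points of [l] lie on several twisted cubics; the
   curve meant is the one whose extension meets the transversals of Sp.  For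
   #|F| > 4 the curve is determined by its points and this is automatic. *)
Definition tangent_cover (pi : set {vspace 'rV[L]_3})
    (T : set {vspace 'rV[F]_7}) : Prop :=
  is_cover q H (splash_planes pi) T /\
  forall P, affine_point H P -> pi (beta P) ->
    exists TP : {vspace 'rV[F]_7},
      [/\ flats 2 TP,
          forall l, subplane_line pi l -> (beta P <= l)%VS ->
            exists (A : 'M[F]_(4, 7)) (s t : F),
              [/\ special_twisted_cubic H Sp A,
                  cubic_points A = bracket_line pi l,
                  (s, t) != (0, 0), P = <[cubic_row s t *m A]>%VS &
                  (cubic_tangent A s t <= TP)%VS],
          flats 1 (TP :&: H)%VS &
          exists2 U, T U & (TP :&: H <= U)%VS].

Definition conic_cover (pi : set {vspace 'rV[L]_3})
    (C : set {vspace 'rV[F]_7}) : Prop :=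
  is_cover q H (splash_planes pi) C /\ exists2 T, tangent_cover pi T & T <> C.

End Representation.
End CubicExtension.

(* Main.v *)
(* Write N for the norm of L over F and q for the order of F.

   The fundamental theorem of affine geometry makes the Bruck-Bose bijection the restriction of
   an F-semilinear map from F^7 to L^3 whose companion automorphism of F extends to L.  In
   coordinates given by a basis of L and its conjugates, an exterior subplane is the set of points
   (t, t^q, t^(q^2)), l_oo is the line x0 = 0, and the splash consists of the points (0, a, b)
   with N(b) = -N(a).  Thus F^7 gets coordinates (e, y1, y2) in F * L * L for which Sigma_oo is
   e = 0 and the splash is the set of planes y2 = c y1 with N(c) = -1.

   A plane of a cover is the graph of an F-linear map multiplying the norm by -1.  For q >= 3,
   comparing characteristic polynomials shows that such a map is y2 = c y1^(q^i) with i < 3 and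
   N(c) = -1, so the two covers are the cases i = 1 and i = 2, which are exchanged by swapping y1
   and y2.  Assume that X is the case i = 1.

   Meeting the transversals of X forces an X-special twisted cubic to be
   (K N(r), al r^2 r^(q^2) + be N(r), al' r^2 r^q + be' N(r)) with r = t - s z and
   N(al) = N(al').  With r = 1 / w this is, up to a scalar, the point
   (K w, al w^q + be w, al' w^(q^2) + be' w), and letting w run through all nonzero elements of L
   gives a subplane containing the cubic.  It has the same splash because N(al) = N(al').  Inside
   it the cubic is a set Tr(b / w) = 0, that is Tr(b w^q w^(q^2)) = 0, a conic whose extension
   contains the points E_i, which are the coordinate points.  The subplane is the only one because
   q + 1 >= 4 points of the cubic include a frame.  Finally, the tangent plane at each of its
   points meets Sigma_oo inside a plane y2 = c y1^(q^2), so X is its conic cover. *)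

Require Import Defs.
From HB Require Import structures.
From mathcomp Require Import all_boot all_order all_algebra all_fingroup all_solvable all_field.
From mathcomp Require Import boolp classical_sets functions cardinality.
From mathcomp Require Import ring.

Set Implicit Arguments.
Unset Strict Implicit.
Unset Printing Implicit Defensive.

Import GRing.Theory.

Local Open Scope classical_set_scope.
Local Open Scope ring_scope.

(** Extending scalars to [L] splits an [L]-valued coordinate into three conjugate functionals, so e,
    y1, y2 give seven coordinates E, Y_j, Z_j of PG(6, q^3), with j mod 3. The extension of the
    plane y2 = c y1^(q^i) of Sigma_oo is E = 0, Z_j = c^(q^j) Y_(i+j). Hence the lines joining the
    coordinate points of Y_(i+j) and Z_j are transversals of the family of exponent q^i: the spread
    is i = 0, the covers are i = 1, 2. Meeting a transversal only says that some coordinate cubic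
    forms vanish at a parameter z, and conjugating these equations turns z into roots, hence
    factors, of the forms. No points are counted, so small q needs no separate case.

    The companion automorphism does no harm, as it commutes with Frobenius and so respects norms and
    traces.

    The bound q >= 3 supplies an element of F other than 0 and 1. It is used twice: for covering L
    by three subspaces, and for the fourth point of a frame.

    The tangent cover needs curves to be constructed: each line of the subplane must carry a cubic
    meeting the transversals of the spread. Writing its coordinates as products of conjugate linear
    forms makes the parameters on the transversals visible. *)

Lemma quadratic_roots3 (K : fieldType) (a b c x0 x1 x2 : K) : x0 != x1 -> x0 != x2 -> x1 != x2 ->
  a + b * x0 + c * x0 ^+ 2 = 0 -> a + b * x1 + c * x1 ^+ 2 = 0 ->
  a + b * x2 + c * x2 ^+ 2 = 0 -> [/\ a = 0, b = 0 & c = 0].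
Proof.
move=> n01 n02 n12 e0 e1 e2.
have k (x y : K) : x != y -> a + b * x + c * x ^+ 2 = 0 ->
    a + b * y + c * y ^+ 2 = 0 -> b + c * (x + y) = 0.
  move=> nxy ex ey; apply/eqP; rewrite -(mulrI_eq0 _ (@lregP _ (x - y) _)).
    by apply/eqP; rewrite -[RHS](subr0 0) -{1}ex -ey; ring.
  by rewrite subr_eq0.
have k1 := k _ _ n01 e0 e1; have k2 := k _ _ n02 e0 e2.
have c0 : c = 0.
  apply/eqP; rewrite -(mulrI_eq0 _ (@lregP _ (x1 - x2) _)).
    by apply/eqP; rewrite -[RHS](subr0 0) -{1}k1 -k2; ring.
  by rewrite subr_eq0.
have b0 : b = 0 by move: k1; rewrite c0 mul0r addr0.
by move: e0; rewrite c0 b0 !mul0r !addr0.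
Qed.

(** * The cubic extension *)

Section Frobenius.
Variables (F : finFieldType) (L : fieldExtType F).

(* Locked, so that rewriting does not see the power through [fr]. *)
Definition fr (x : L) : L := locked (x ^+ #|F|).

Lemma fr_def x : fr x = x ^+ #|F|.
Proof. by rewrite /fr -lock. Qed.

Lemma fr_is_zmod_morphism : zmod_morphism fr.
Proof.
have [p p_pr pF] := finPcharP F.
have pL : p \in [pchar L] by rewrite pchar_lalg.
have q_p : [pchar L].-nat #|F|.
  rewrite (eq_pnat _ (pcharf_eq pL)).
  have -> : #|F| = (p ^ logn p #|F|)%N := card_pprimeChar pF.
  by rewrite pnatX pnat_id.
move=> x y; rewrite !fr_def exprDn_pchar // exprNn_pchar //.
Qed.

HB.instance Definition _ := GRing.isZmodMorphism.Build L L fr fr_is_zmod_morphism.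

Lemma fr_is_monoid_morphism : monoid_morphism fr.
Proof. by split=> [|x y]; rewrite !fr_def ?expr1n ?exprMn. Qed.

HB.instance Definition _ := GRing.isMonoidMorphism.Build L L fr fr_is_monoid_morphism.

Lemma fr_is_scalable : scalable fr.
Proof. by move=> a x; rewrite !fr_def exprZn expf_card. Qed.

HB.instance Definition _ := GRing.isScalable.Build F L L *:%R fr fr_is_scalable.

Lemma fr_alg a : fr a%:A = a%:A.
Proof. by rewrite linearZ /= rmorph1. Qed.

Lemma frD x y : fr (x + y) = fr x + fr y. Proof. exact: rmorphD. Qed.
Lemma frN x : fr (- x) = - fr x. Proof. exact: rmorphN. Qed.
Lemma frM x y : fr (x * y) = fr x * fr y. Proof. exact: rmorphM. Qed.
Lemma frX x n : fr (x ^+ n) = fr x ^+ n. Proof. exact: rmorphXn. Qed.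
Lemma frV x : fr x^-1 = (fr x)^-1. Proof. exact: fmorphV. Qed.
Lemma frZ a x : fr (a *: x) = a *: fr x. Proof. exact: linearZ. Qed.
Lemma fr0 : fr 0 = 0. Proof. exact: rmorph0. Qed.
Lemma fr1 : fr 1 = 1. Proof. exact: rmorph1. Qed.
Lemma fr_nat n : fr n%:R = n%:R. Proof. exact: rmorph_nat. Qed.
Lemma fr_eq0 x : (fr x == 0) = (x == 0). Proof. exact: fmorph_eq0. Qed.

Definition frE := (frX, frD, frN, frV, frM, fr_alg, frZ, fr0, fr1, fr_nat).

Lemma alg_eq0 (a : F) : (a%:A == 0 :> L) = (a == 0).
Proof. by rewrite scaler_eq0 oner_eq0 orbF. Qed.

Lemma fr_fixed x : fr x = x -> exists a : F, x = a%:A.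
Proof.
move=> frx; apply/vlineP.
by rewrite (Fermat's_little_theorem 1%AS) dimv1 expn1 -fr_def; apply/eqP.
Qed.

Lemma fr_inj : injective fr.
Proof. exact: fmorph_inj. Qed.

(** For the cubic extension these are the norm and the trace to [F], kept with values in [L] so that
    computations with conjugates are identities for [ring] and [field]. *)
Definition nrm (x : L) : L := x * fr x * fr (fr x).
Definition trc (x : L) : L := x + fr x + fr (fr x).

Lemma nrmM x y : nrm (x * y) = nrm x * nrm y.
Proof. by rewrite /nrm !rmorphM /=; ring. Qed.

Lemma nrmV x : nrm x^-1 = (nrm x)^-1.
Proof. by rewrite /nrm !fmorphV !invfM. Qed.

Lemma nrm1 : nrm 1 = 1.
Proof. by rewrite /nrm !rmorph1 !mulr1. Qed.

Lemma nrm0 : nrm 0 = 0.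
Proof. by rewrite /nrm !mul0r. Qed.

Lemma nrmN x : nrm (- x) = - nrm x.
Proof. by rewrite /nrm !rmorphN /=; ring. Qed.

Lemma nrm_eq0 x : (nrm x == 0) = (x == 0).
Proof. by rewrite /nrm !mulf_eq0 !fmorph_eq0 !orbb. Qed.

Hypothesis dimL : \dim {:L} = 3%N.

Lemma fr3 x : fr (fr (fr x)) = x.
Proof.
have /eqP := Fermat's_little_theorem {:L}%AS x.
rewrite memvf dimL eq_sym => /eqP /eqP xE.
by rewrite !fr_def -!exprM -[RHS]xE; congr (_ ^+ _); rewrite !expnS muln1 mulnA.
Qed.

Lemma fr_nrm x : fr (nrm x) = nrm x.
Proof. by rewrite /nrm !rmorphM /= fr3; ring. Qed.

Lemma nrm_fr x : nrm (fr x) = nrm x.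
Proof. by rewrite /nrm fr3; ring. Qed.

Lemma nrm_in_F x : exists a : F, nrm x = a%:A.
Proof. exact/fr_fixed/fr_nrm. Qed.

Lemma trc_in_F x : exists a : F, trc x = a%:A.
Proof. by apply/fr_fixed; rewrite /trc !rmorphD /= fr3; ring. Qed.


Lemma fr_nontrivial : exists z, fr z != z.
Proof.
apply: contrapT => /forallNP frid; suff: \dim {:L} = 1%N by rewrite dimL.
rewrite -[RHS](dimv1 L); congr (\dim _); apply/vspaceP=> x; rewrite memvf.
have [|a ->] := @fr_fixed x; last by rewrite memvZ ?mem1v.
by apply/eqP/negPn/negP/frid.
Qed.

Lemma fr2_neq z : fr z != z -> fr (fr z) != z.
Proof. by apply: contra_neq => zE; rewrite -{1}zE fr3. Qed.

(** The relations pair the weights with 1, X and X^2; pairing them with (X - x1)(X - x2) leaves only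
    the term at x0. *)
Lemma vandermonde3 (x0 x1 x2 c0 c1 c2 : L) : x0 != x1 -> x0 != x2 ->
  c0 + c1 + c2 = 0 -> c0 * x0 + c1 * x1 + c2 * x2 = 0 ->
  c0 * x0 ^+ 2 + c1 * x1 ^+ 2 + c2 * x2 ^+ 2 = 0 -> c0 = 0.
Proof.
move=> n01 n02 e0 e1 e2.
have : c0 * ((x0 - x1) * (x0 - x2)) = 0.
  transitivity (c0 * x0 ^+ 2 + c1 * x1 ^+ 2 + c2 * x2 ^+ 2 -
    (x1 + x2) * (c0 * x0 + c1 * x1 + c2 * x2) + x1 * x2 * (c0 + c1 + c2)).
    by ring.
  by rewrite e0 e1 e2; ring.
move/eqP; rewrite !mulf_eq0 !subr_eq0 (negPf n01) (negPf n02) !orbF.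
by move/eqP.
Qed.

(** Dedekind independence: tested on 1, z, z^2 with z outside [F], a relation becomes a Vandermonde
    system in the distinct conjugates of z. *)
Lemma fr_independent (c0 c1 c2 : L) :
  (forall x, c0 * x + c1 * fr x + c2 * fr (fr x) = 0) ->
  [/\ c0 = 0, c1 = 0 & c2 = 0].
Proof.
move=> H; have [z nz] := fr_nontrivial; have nz2 := fr2_neq nz.
have nz3 : fr z != fr (fr z) by rewrite (inj_eq fr_inj) eq_sym.
have e0 : c0 + c1 + c2 = 0 by rewrite -(H 1) !rmorph1 !mulr1.
have e1 := H z.
have e2 : c0 * z ^+ 2 + c1 * fr z ^+ 2 + c2 * fr (fr z) ^+ 2 = 0.
  by rewrite -(H (z ^+ 2)) !frE.
split.
- by apply: (@vandermonde3 z (fr z) (fr (fr z)) c0 c1 c2) => //; rewrite eq_sym.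
- apply: (@vandermonde3 (fr z) z (fr (fr z)) c1 c0 c2 nz nz3).
  + by rewrite -[RHS]e0; ring.
  + by rewrite -[RHS]e1; ring.
  + by rewrite -[RHS]e2; ring.
- apply: (@vandermonde3 (fr (fr z)) z (fr z) c2 c0 c1 nz2); first by rewrite eq_sym.
  + by rewrite -[RHS]e0; ring.
  + by rewrite -[RHS]e1; ring.
  + by rewrite -[RHS]e2; ring.
Qed.

Lemma quadratic_free (z : L) (a b c : F) : fr z != z ->
  a%:A + b%:A * z + c%:A * z ^+ 2 = 0 -> [/\ a = 0, b = 0 & c = 0].
Proof.
move=> nz e0; have nz2 := fr2_neq nz.
have nz3 : fr z != fr (fr z) by rewrite (inj_eq fr_inj) eq_sym.
have e1 : a%:A + b%:A * fr z + c%:A * fr z ^+ 2 = 0.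
  by rewrite -[RHS]fr0 -e0 !frE.
have e2 : a%:A + b%:A * fr (fr z) + c%:A * fr (fr z) ^+ 2 = 0.
  by rewrite -[RHS]fr0 -e1 !frE.
have zn : z != fr z by rewrite eq_sym.
have zn2 : z != fr (fr z) by rewrite eq_sym.
have [a0 b0 c0] := quadratic_roots3 zn zn2 nz3 e0 e1 e2.
by split; apply/eqP; rewrite -alg_eq0 ?a0 ?b0 ?c0.
Qed.

Lemma hilbert90 x : nrm x = 1 -> exists2 y, y != 0 & fr y = x * y.
Proof.
move=> x1; have x0 : x != 0 by rewrite -nrm_eq0 x1 oner_neq0.
have fx0 : fr x != 0 by rewrite fmorph_eq0.
have x2 : fr (fr x) = (x * fr x)^-1.
  by apply: (mulfI (mulf_neq0 x0 fx0)); rewrite divff ?mulf_neq0 // -x1.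
(* The Lagrange resolvent of t. It satisfies fr y = x y because x has norm 1, and independence of
   the conjugates gives a t where it is not zero. *)
pose y t := 1 * t + x^-1 * fr t + (x * fr x)^-1 * fr (fr t).
apply: contrapT => /forall2NP no.
suff /fr_independent [/eqP] : forall t, y t = 0 by rewrite oner_eq0.
move=> t; have [/negP/negPn/eqP //|[]] := no (y t).
rewrite /y !frE x2 fr3.
by field; rewrite oner_eq0 x0 andbT; exact: fx0.
Qed.

End Frobenius.

Lemma exists_neq01 (F : finFieldType) :
  (3 <= #|F|)%N -> exists2 l : F, l != 0 & l != 1.
Proof.
rewrite leqNgt => /negP F3; apply: contrapT => /forall2NP no; apply: F3.
apply: leq_trans (card_size [:: 0; 1 : F]); apply: subset_leq_card.
apply/fintype.subsetP => l _; rewrite !inE.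
by have [/negP/negPn ->|/negP/negPn ->] := no l; rewrite ?orbT.
Qed.

(** * Coverings of a vector space by subspaces *)

Section LinearUnion.
Variables (F : finFieldType) (V : lmodType F).

Definition submodule (P : V -> Prop) :=
  P 0 /\ forall a x y, P x -> P y -> P (a *: x + y).

Lemma submodule_secant (P : V -> Prop) (x y : V) (a b : F) : submodule P ->
  a != b -> P (y + a *: x) -> P (y + b *: x) -> P x.
Proof.
move=> [P0 Plin] nab Pa Pb; have nab' : b - a != 0 by rewrite subr_eq0 eq_sym.
have Pabx : P ((b - a) *: x).
  have -> : (b - a) *: x = (-1) *: (y + a *: x) + (y + b *: x).
    by rewrite scalerBl scaleN1r opprD addrACA addNr add0r addrC.
  exact: Plin.
by have := Plin (b - a)^-1 _ _ Pabx P0; rewrite addr0 scalerK.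
Qed.

Lemma submodule_cover2 (P Q : V -> Prop) : submodule P -> submodule Q ->
  (forall x, P x \/ Q x) -> (forall x, P x) \/ (forall x, Q x).
Proof.
move=> sP sQ PQ; apply: contrapT => /not_orP[/existsNP[x nPx] /existsNP[y nQy]].
have [Py|//] := PQ y; have [//|Qx] := PQ x.
have := PQ (y + 1 *: x); case=> [Pxy|Qxy].
- by apply/nPx/(submodule_secant sP (oner_neq0 F) Pxy); rewrite scale0r addr0.
- have [Q0 Qlin] := sQ; apply: nQy.
  have -> : y = (-1) *: x + (y + 1 *: x).
    by rewrite scale1r scaleN1r addrC addrK.
  exact: Qlin.
Qed.

(** Take x in P outside Q and R, and y outside P. No y + a x lies in P, so among a = 0, 1, l two
    values land in the same of Q and R, which then contains x. Over two elements the third value is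
    missing, and a space of dimension 2 is the union of its three lines. *)
Lemma submodule_cover3 (P Q R : V -> Prop) : (3 <= #|F|)%N ->
  submodule P -> submodule Q -> submodule R ->
  (forall x, [\/ P x, Q x | R x]) ->
  [\/ forall x, P x, forall x, Q x | forall x, R x].
Proof.
move=> F3 sP sQ sR PQR.
have [l l0 l1] := exists_neq01 F3.
have [aP|/existsNP[y nPy]] := pselect (forall x, P x); first by constructor 1.
have [[x Px nQRx]|none] := pselect (exists2 x, P x & ~ (Q x \/ R x)); last first.
  have QR x : Q x \/ R x.
    have [Px|Qx|Rx] := PQR x; [|by left|by right].
    by apply: contrapT => nQR; apply: none; exists x.
  by have [aQ|aR] := submodule_cover2 sQ sR QR; [constructor 2|constructor 3].
exfalso; have QR a : Q (y + a *: x) \/ R (y + a *: x).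
  have [Pa|Qa|Ra] := PQR (y + a *: x); [|by left|by right].
  case: nPy; have [_ Plin] := sP.
  have -> : y = (- a) *: x + (y + a *: x) by rewrite scaleNr addrC addrK.
  exact: Plin.
have n01 : 0 != 1 :> F by rewrite eq_sym oner_neq0.
have n0l : 0 != l by rewrite eq_sym.
have n1l : 1 != l by rewrite eq_sym.
apply: nQRx; have [Q0|R0] := QR 0; have [Q1|R1] := QR 1; have [Ql|Rl] := QR l;
  first [ left; first [ exact: submodule_secant sQ n01 Q0 Q1
                      | exact: submodule_secant sQ n0l Q0 Ql
                      | exact: submodule_secant sQ n1l Q1 Ql ]
        | right; first [ exact: submodule_secant sR n01 R0 R1
                       | exact: submodule_secant sR n0l R0 Rl
                       | exact: submodule_secant sR n1l R1 Rl ] ].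
Qed.
End LinearUnion.

(** * Linear maps that multiply the norm by a constant *)

Section NormPreserving.
Variables (F : finFieldType) (L : fieldExtType F).
Hypothesis F3 : (3 <= #|F|)%N.

(** Each f x is a root of the characteristic polynomial of x, hence a conjugate of x. Which
    conjugate may depend on x, but each choice holds on an [F]-subspace, so [submodule_cover3] makes
    it uniform. *)
Lemma nrm_preserving_fixes1 (f : {linear L -> L}) :
  (forall x, nrm (f x) = nrm x) -> f 1 = 1 ->
  [\/ forall x, f x = x, forall x, f x = fr x | forall x, f x = fr (fr x)].
Proof.
move=> fN f1.
have [l l0 l1] := exists_neq01 F3.
apply: submodule_cover3 => //.
- by split=> [|a x y fx fy]; rewrite ?linear0 // linearP /= fx fy.
- by split=> [|a x y fx fy]; rewrite ?linear0 ?fr0 // linearP /= fx fy !frE.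
- by split=> [|a x y fx fy]; rewrite ?linear0 ?fr0 // linearP /= fx fy !frE.
(* f preserves N(a - x) for all a in F, hence the characteristic polynomial of x. *)
move=> x; pose y := f x.
pose e1 (t : L) := t + fr t + fr (fr t).
pose e2 (t : L) := t * fr t + t * fr (fr t) + fr t * fr (fr t).
have charE (a : F) t : nrm (a%:A - t) = a%:A ^+ 3 - a%:A ^+ 2 * e1 t + a%:A * e2 t - nrm t.
  by rewrite /nrm /e1 /e2 !frE; ring.
(* With D1 and D2 the differences of the symmetric functions, this is a^2 D1 = a D2. The value a = 1
   gives D1 = D2, and a = l then makes both vanish. *)
have diff (a : F) : a%:A ^+ 2 * (e1 y - e1 x) = a%:A * (e2 y - e2 x).
  have := fN (a%:A - x); rewrite linearB linearZ /= f1 -/y !charE => h.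
  have yN : nrm y = nrm x := fN x.
  apply/eqP; rewrite -subr_eq0; apply/eqP.
  have := subrr (a%:A ^+ 3 - a%:A ^+ 2 * e1 y + a%:A * e2 y - nrm y).
  by rewrite {1}h yN => <-; ring.
have e2E : e2 y - e2 x = e1 y - e1 x.
  by have := diff 1; rewrite scale1r expr1n !mul1r => ->.
have l1' : l%:A - 1 != 0 :> L.
  by rewrite -[X in _ - X](scale1r (1 : L)) -scalerBl alg_eq0 subr_eq0.
have e1E : e1 y = e1 x.
  have /eqP := diff l; rewrite e2E -subr_eq0 -mulrBl mulf_eq0.
  rewrite expr2 -[X in _ - X]mulr1 -mulrBr mulf_eq0 alg_eq0 (negPf l0).
  by rewrite (negPf l1') /= subr_eq0 => /eqP.
have e2E' : e2 y = e2 x by apply/eqP; rewrite -subr_eq0 e2E e1E subrr.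
have : (y - x) * (y - fr x) * (y - fr (fr x)) = 0.
  transitivity (y ^+ 3 - e1 x * y ^+ 2 + e2 x * y - nrm x).
    by rewrite /e1 /e2 /nrm; ring.
  by rewrite -e1E -e2E' -fN -/y /e1 /e2 /nrm; ring.
move/eqP; rewrite !mulf_eq0 !subr_eq0 => /orP[/orP[]|] /eqP;
  by [constructor 1|constructor 2|constructor 3].
Qed.

Lemma nrm_preserving (f : {linear L -> L}) (d : L) : d != 0 ->
  (forall x, nrm (f x) = d * nrm x) ->
  exists2 c, nrm c = d &
  [\/ forall x, f x = c * x, forall x, f x = c * fr x
    | forall x, f x = c * fr (fr x)].
Proof.
move=> d0 fN; have f1N : nrm (f 1) = d by rewrite fN nrm1 mulr1.
have f10 : f 1 != 0 by rewrite -nrm_eq0 f1N.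
pose g := ((f 1)^-1 \*o f : {linear L -> L}).
have gE x : f x = f 1 * g x by rewrite /= mulVKf.
exists (f 1) => //.
have gN x : nrm (g x) = nrm x.
  by rewrite /= nrmM nrmV f1N fN mulKf.
have g1 : g 1 = 1 by rewrite /= mulVf.
have [h|h|h] := nrm_preserving_fixes1 gN g1;
  [constructor 1|constructor 2|constructor 3] => x; by rewrite gE h.
Qed.
End NormPreserving.

(** * Automorphisms of a finite field and their extension to [L] *)

Section FiniteFieldEndomorphisms.
Variable F : finFieldType.

Lemma horner_fin_inj (p r : {poly F}) : (size p <= #|F|)%N ->
  (size r <= #|F|)%N -> (forall x, p.[x] = r.[x]) -> p = r.
Proof.
move=> sp sr pr; apply/eqP; rewrite -subr_eq0; apply: contraT => nz.
have := max_poly_roots nz (rs := enum F); rewrite enum_uniq -cardE.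
have -> : all (root (p - r)) (enum F).
  by apply/allP=> x _; rewrite rootE !hornerE pr subrr.
move=> /(_ isT isT); rewrite ltnNge => /negP[].
by rewrite (leq_trans (size_polyD _ _)) // size_polyN geq_max sp.
Qed.

(* Comparing the derivatives of (1 + X)^j and 1 + X^j shows that p divides j unless j = 1. *)
Lemma additive_exponent (p j : nat) : p \in [pchar F] ->
  (0 < j < #|F|)%N -> (forall x : F, (x + 1) ^+ j = x ^+ j + 1) ->
  exists k, j = (p ^ k)%N.
Proof.
move=> pF; have [n] := ubnP j; elim: n j => // n IHn j jn /andP[j0 jF] jadd.
have [pj|npj] := boolP (p %| j)%N.
  have [m jE] := dvdnP pj.
  have p1 : (1 < p)%N by rewrite prime_gt1 // (pcharf_prime pF).
  have m0 : (0 < m)%N by move: j0; rewrite jE muln_gt0 => /andP[].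
  have mj : (m < j)%N by rewrite jE ltn_Pmulr.
  have [||x|k mE] := IHn m; last by exists k.+1; rewrite jE mE expnSr.
  - exact: leq_trans mj _.
  - by rewrite m0 (ltn_trans mj).
  - apply: (fmorph_inj (pFrobenius_aut pF)).
    by rewrite rmorphD rmorph1 /= !pFrobenius_autE -!exprM -jE jadd.
have : ('X + 1) ^+ j = 'X^j + 1 :> {poly F}.
  apply: horner_fin_inj => [||x].
  - by rewrite -polyC1 -[1%:P]opprK -polyCN size_exp_XsubC.
  - by rewrite -polyC1 size_XnaddC.
  - by rewrite !hornerE jadd.
move/(congr1 (fun r => (r^`()).[0])).
rewrite deriv_exp !derivE addr0 mul1r.
rewrite addr0 !hornerMn !hornerE ?add0r ?expr1n.
case: j {jn jadd} j0 jF npj => [|[|j]] // _ _ npj; first by exists 0%N.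
rewrite expr0n /= mul0rn => /eqP; rewrite -(dvdn_pcharf pF) => pj.
by rewrite pj in npj.
Qed.

(** The unit group is cyclic, so a multiplicative map is x -> x^j, and additivity then restricts
    j. *)
Lemma rmorphism_pFrobenius (tau : {rmorphism F -> F}) (p : nat) :
  p \in [pchar F] -> exists k, forall x, tau x = x ^+ (p ^ k).
Proof.
move=> pF.
have [g gP] : exists g : {unit F}, forall u, u \in <[g]>%g.
  have /cyclicP[g gE] := field_unit_group_cyclic [set: {unit F}]%G.
  by exists g => u; rewrite -gE inE.
have g0 : val g != 0 by rewrite -unitfE (valP g).
have tg : tau (val g) \is a GRing.unit by rewrite unitfE fmorph_eq0.
have [i gi] : exists i, tau (val g) = val g ^+ i.
  have /cycleP[i /(congr1 val) /= gi] := gP (FinRing.unit F tg).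
  by exists i; rewrite gi FinRing.val_unitX.
pose n := #|F|.-1; have n0 : (0 < n)%N.
  by rewrite -ltnS prednK ?finNzRing_gt1 // ltnW ?finNzRing_gt1.
have gn (x : F) : x != 0 -> x ^+ n = 1.
  move=> x0; apply: (mulfI x0); rewrite -exprS prednK ?expf_card ?mulr1 //.
  by rewrite ltnW ?finNzRing_gt1.
(* The exponent is reduced into 1, ..., #|F| - 1 instead of 0, ..., #|F| - 2: it must be positive
   for [additive_exponent] and for 0 to be mapped to 0. *)
pose j := if (i %% n == 0)%N then n else (i %% n)%N.
have j0 : (0 < j)%N by rewrite /j; case: ifP => // /negbT; rewrite lt0n.
have jn : (j < #|F|)%N.
  have nF : (n < #|F|)%N by rewrite prednK ?leqnn // ltnW ?finNzRing_gt1.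
  by rewrite /j; case: ifP => // _; apply: ltn_trans nF; rewrite ltn_mod.
have tj x : tau x = x ^+ j.
  have [->|x0] := eqVneq x 0; first by rewrite rmorph0 expr0n gtn_eqF.
  have xU : x \is a GRing.unit by rewrite unitfE.
  have /cycleP[m /(congr1 val) /= xE] := gP (FinRing.unit F xU).
  have -> : x = val g ^+ m by rewrite xE FinRing.val_unitX.
  have gj : val g ^+ i = val g ^+ j.
    rewrite -(expr_mod i (gn _ g0)) /j; case: eqP => [->|//].
    by rewrite gn.
  by rewrite rmorphXn /= gi gj -!exprM mulnC.
have [|x|k jE] := additive_exponent pF (j := j); first by rewrite j0.
  by rewrite -!tj rmorphD rmorph1.
by exists k => x; rewrite tj jE.
Qed.

(** A power of Frobenius is given by a formula that makes sense on [L]. This lets the companion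
    automorphism act on [L]-valued coordinates. *)
Lemma rmorphism_extension (L : fieldExtType F) (tau : {rmorphism F -> F}) :
  exists s : {rmorphism L -> L}, bijective s /\ forall a, s a%:A = (tau a)%:A.
Proof.
have [p p_pr pF] := finPcharP F; have pL : p \in [pchar L] by rewrite pchar_lalg.
have [k tauE] := rmorphism_pFrobenius tau pF.
have [s sE] : exists s : {rmorphism L -> L}, forall x, s x = x ^+ (p ^ k).
  elim: (k) => [|n [s sE]]; first by exists idfun => x; rewrite expr1.
  exists (pFrobenius_aut pL \o s : {rmorphism L -> L}) => x.
  by rewrite /= pFrobenius_autE sE -exprM -expnSr.
exists s; split; last by move=> a; rewrite sE exprZn expr1n tauE.
exact: (@injF_bij (finvect_type L) s (@fmorph_inj _ _ s)).
Qed.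

End FiniteFieldEndomorphisms.

(** * Lines and hyperplanes of a vector space *)

Section VectorSpaces.
Variables (K : fieldType) (V : vectType K).
Implicit Types (U W : {vspace V}) (u v w : V).

Lemma dimv1_line U : \dim U = 1%N -> exists2 v, v != 0 & U = <[v]>%VS.
Proof.
move=> dU; have U0 : U != 0%VS by rewrite -dimv_eq0 dU.
exists (vpick U); first by rewrite vpick0.
by apply/esym/eqP; rewrite eqEdim -memvE memv_pick dU dim_vline vpick0 U0.
Qed.

Lemma vlineZ c v : c != 0 -> <[c *: v]>%VS = <[v]>%VS.
Proof.
move=> c0; apply/eqP; rewrite eqEsubv -!memvE memvZ ?memv_line //=.
by rewrite -[v in v \in _](scalerK c0) memvZ // memv_line.
Qed.

Lemma vline_eqP u v : u != 0 ->
  <[u]>%VS = <[v]>%VS <-> exists2 c, c != 0 & u = c *: v.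
Proof.
move=> u0; split=> [uv|[c c0 ->]]; last exact: vlineZ.
have /vlineP[c uE] : u \in <[v]>%VS by rewrite -uv memv_line.
by exists c => //; apply: contraNneq u0 => c0; rewrite uE c0 scale0r.
Qed.

Lemma dim_lker_functional (f : 'Hom(V, K^o)) : f != 0 ->
  (\dim (lker f)).+1 = \dim {:V}.
Proof.
move=> f0; rewrite -(limg_ker_dim f fullv) capfv -addn1; congr addn.
apply/esym/eqP; rewrite eqn_leq; apply/andP; split.
  by rewrite (leq_trans (dimvS (subvf _))) // dimvf.
rewrite lt0n dimv_eq0; apply: contra f0 => /eqP fV0.
apply/eqP/lfunP=> v; rewrite lfunE /=; apply/eqP.
by rewrite -memv0 -fV0 memv_img // memvf.
Qed.

Lemma hyperplane_functional U : (\dim U).+1 = \dim {:V} ->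
  exists (f : 'Hom(V, K^o)) v, lker f = U /\ f v = 1.
Proof.
move=> dU; have dC : \dim (U^C)%VS = 1%N.
  by rewrite dimv_compl -dU subSnn.
have [w w0 CE] := dimv1_line dC.
have fw : free [tuple w] by rewrite /= seq1_free.
pose f := (linfun (coord [tuple w] ord0 : V -> K^o) \o daddv_pi (U^C) U)%VF.
have UC0 : (U^C :&: U)%VS = 0%VS by rewrite capvC capv_compl.
have fU : lker f = U.
  apply/vspaceP=> v; rewrite memv_ker /f comp_lfunE lfunE /=.
  have Cv : v \in (U^C + U)%VS by rewrite addvC addv_complf memvf.
  have pC : daddv_pi (U^C) U v \in <[w]>%VS by rewrite -CE memv_pi.
  have /vlineP[c cE] := pC.
  have -> : coord [tuple w] ord0 (daddv_pi (U^C) U v) = c.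
    rewrite cE linearZ /= -[w in coord _ _ w]/([tuple w]`_(@ord0 0)).
    by rewrite (coord_free _ _ fw) eqxx mulr1.
  have vE := daddv_pi_add UC0 Cv.
  apply/eqP/idP=> [c0|vU].
    by rewrite -vE cE c0 scale0r add0r memv_pi.
  have : daddv_pi (U^C) U v \in (U^C :&: U)%VS.
    rewrite memv_cap memv_pi /=.
    have -> : daddv_pi (U^C) U v = v - daddv_pi U (U^C) v by apply/eqP; rewrite eq_sym subr_eq vE.
    by rewrite memvB // memv_pi.
  rewrite UC0 memv0 cE scaler_eq0 (negPf w0) orbF => /eqP //.
suff [v fv] : exists v, f v != 0.
  by exists f, ((f v)^-1 *: v); split; rewrite // linearZ /= -[_ *: _]/(_ * _) mulVf.
apply: contrapT => /forallNP f0; suff : (fullv <= U)%VS by move/dimvS; rewrite -dU ltnn.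
by apply/subvP=> v _; rewrite -fU memv_ker; apply/negPn/negP.
Qed.

Lemma dim_add_lines (P Q : {vspace V}) : \dim P = 1%N -> \dim Q = 1%N ->
  P <> Q -> \dim (P + Q) = 2%N.
Proof.
move=> dP dQ PQ; rewrite dimv_disjoint_sum ?dP ?dQ //.
apply/eqP; rewrite -dimv_eq0; apply: contra_notT PQ; rewrite -lt0n => PQ0.
have /eqP <- : (P :&: Q == P)%VS by rewrite eqEdim capvSl dP.
by apply/eqP; rewrite eqEdim capvSr dQ.
Qed.

Lemma line_through (P Q l l' : {vspace V}) : \dim P = 1%N -> \dim Q = 1%N ->
  P <> Q -> \dim l = 2%N -> \dim l' = 2%N ->
  (P <= l)%VS -> (Q <= l)%VS -> (P <= l')%VS -> (Q <= l')%VS -> l = l'.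
Proof.
move=> dP dQ PQ dl dl' Pl Ql Pl' Ql'; have dPQ := dim_add_lines dP dQ PQ.
have e k : \dim k = 2%N -> (P <= k)%VS -> (Q <= k)%VS -> (P + Q)%VS = k.
  by move=> dk Pk Qk; apply/eqP; rewrite eqEdim subv_add Pk Qk dk dPQ.
by rewrite -(e l) // (e l').
Qed.

End VectorSpaces.

Section Row3.
Variable R : comNzRingType.
Definition row3 (a b c : R) : 'rV[R]_3 := \row_(j < 3) [:: a; b; c]`_j.

Lemma row3E a b c : ((row3 a b c 0 0 = a) * (row3 a b c 0 1 = b) *
  (row3 a b c 0 2 = c))%type.
Proof. by rewrite !mxE. Qed.

Lemma ord3 (j : 'I_3) : [\/ j = 0, j = 1 | j = 2].
Proof.
by case: j => [[|[|[|//]]] ltj];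
  [constructor 1|constructor 2|constructor 3]; apply: val_inj.
Qed.

Lemma row3P (v w : 'rV[R]_3) :
  v 0 0 = w 0 0 -> v 0 1 = w 0 1 -> v 0 2 = w 0 2 -> v = w.
Proof. by move=> e0 e1 e2; apply/rowP=> j; case: (ord3 j) => ->. Qed.

Lemma row3_eta (v : 'rV[R]_3) : v = row3 (v 0 0) (v 0 1) (v 0 2).
Proof. by apply: row3P; rewrite row3E. Qed.

Lemma sum3 (M : nmodType) (f : 'I_3 -> M) : \sum_j f j = f 0 + f 1 + f 2.
Proof.
rewrite !big_ord_recl big_ord0 addr0 addrA.
by congr (f _ + f _ + f _); apply: val_inj.
Qed.

End Row3.

(** * Subplanes in conjugate coordinates *)

Section Moore.
Variables (F : finFieldType) (L : fieldExtType F).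
Hypothesis dimL : \dim {:L} = 3%N.

Local Notation emb := (map_mx (in_alg L)).

(** The embedding of [L] into L tensor L = L^3. In these coordinates conjugation with respect to the
    subplane applies [fr] and shifts the entries cyclically. *)
Definition frow (t : L) : 'rV[L]_3 := row3 t (fr t) (fr (fr t)).

Definition theta (u : 'cV[L]_3) (v : 'rV[F]_3) : L := \sum_j v 0 j *: u j 0.

Definition moore (u : 'cV[L]_3) : 'M[L]_3 := \matrix_(j < 3, i < 3) frow (u j 0) 0 i.

Lemma theta_linear u : linear (theta u).
Proof.
move=> a x y; rewrite /theta scaler_sumr -big_split; apply: eq_bigr => j _ /=.
by rewrite !mxE scalerDl scalerA.
Qed.

HB.instance Definition _ u := GRing.isLinear.Build F 'rV[F]_3 L *:%R (theta u) (theta_linear u).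

Lemma emb_moore u v : emb v *m moore u = frow (theta u v).
Proof.
by apply: row3P; rewrite !mxE /= /theta !sum3 !mxE /= ?frE !mulr_algl.
Qed.

Lemma mulmx_moore u (x : 'rV[L]_3) :
  x *m moore u = row3 (\sum_j x 0 j * u j 0) (\sum_j x 0 j * fr (u j 0))
    (\sum_j x 0 j * fr (fr (u j 0))).
Proof. by apply: row3P; rewrite !mxE; apply: eq_bigr => j _; rewrite !mxE. Qed.

Definition rational_free u := forall v, theta u v = 0 -> v = 0.

Lemma theta_surj u : rational_free u -> forall x, exists v, theta u v = x.
Proof.
move=> ufree x; pose f := linfun (theta u).
have k0 : lker f = 0%VS.
  apply/vspaceP => v; rewrite memv_ker memv0 lfunE /=.
  by apply/eqP/eqP=> [/ufree ->|->] //; rewrite linear0.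
have := limg_ker_dim f fullv; rewrite k0 capv0 dimv0 add0n dimvf /dim /= mul1n.
move=> d3; have : limg f = fullv by apply/eqP; rewrite eqEdim subvf d3 dimL.
move/vspaceP/(_ x); rewrite memvf => /memv_imgP[v _ xE].
by exists v; rewrite xE lfunE.
Qed.

(** A kernel vector of the transpose is a relation between x, x^q and x^(q^2) valid on a basis,
    hence on [L], against [fr_independent]. *)
Lemma moore_unit u : rational_free u -> moore u \in unitmx.
Proof.
move=> ufree; rewrite -unitmx_tr -row_free_unit; apply: inj_row_free => c c0.
have [|c00 c01 c02] := @fr_independent _ _ dimL (c 0 0) (c 0 1) (c 0 2); last first.
  by apply: row3P; rewrite ?c00 ?c01 ?c02 mxE.
move=> x; have [v <-] := theta_surj ufree x.
have : emb v *m (c *m (moore u)^T)^T = 0 by rewrite c0 trmx0 mulmx0.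
rewrite trmx_mul trmxK mulmxA emb_moore => /matrixP/(_ 0 0).
rewrite !mxE sum3 !mxE /= => e0.
by rewrite -[RHS]e0; ring.
Qed.

Lemma rational_free_powers z : fr z != z ->
  rational_free (\col_j (z ^+ j)).
Proof.
move=> nz v; rewrite /theta sum3 !mxE expr0 expr1 -[_ *: z]mulr_algl -[_ *: z ^+ 2]mulr_algl.
move/(quadratic_free dimL nz) => [e0 e1 e2].
by apply: row3P; rewrite mxE.
Qed.

Definition fr_subplane (M : 'M[L]_3) : set {vspace 'rV[L]_3} :=
  [set P | exists2 t, t != 0 & P = <[frow t *m M]>%VS].

Lemma subplane_of_moore u M : rational_free u ->
  subplane_of (moore u *m M) = fr_subplane M.
Proof.
move=> ufree; apply/seteqP; split=> P /=.
- move=> [v v0 ->]; rewrite mulmxA emb_moore; exists (theta u v) => //.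
  by apply: contraNneq v0 => /ufree ->.
- move=> [t t0 ->]; have [v tE] := theta_surj ufree t.
  exists v; last by rewrite mulmxA emb_moore tE.
  by apply: contraNneq t0 => v0; rewrite -tE v0 linear0.
Qed.

Lemma fr_subplane_subplane M : M \in unitmx -> subplane (fr_subplane M).
Proof.
move=> MU; have [z nz] := fr_nontrivial dimL.
have ufree := rational_free_powers nz.
exists (moore (\col_j (z ^+ j)) *m M); last by rewrite subplane_of_moore.
by rewrite unitmx_mul moore_unit.
Qed.

Definition line_at_infinity (linf : {vspace 'rV[L]_3}) (M : 'M[L]_3) :=
  forall x : 'rV[L]_3, (x *m M \in linf) = (x 0 0 == 0).

(** Let u_j be the values at the rows of M of a form defining l_oo. Exteriority says that no
    nontrivial rational combination of the u_j vanishes, so their Moore matrix is invertible. Its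
    first column is u, so in the new coordinates the form is the first coordinate. *)
Lemma exterior_subplane_normal_form (linf : {vspace 'rV[L]_3}) pi :
  flats 1 linf -> exterior_subplane linf pi ->
  exists M, [/\ M \in unitmx, line_at_infinity linf M & pi = fr_subplane M].
Proof.
move=> dl [[M MU piE] ext].
have [|f [_ [fE _]]] := @hyperplane_functional _ _ linf; first by rewrite dl dimvf /dim /= mul1n.
pose u : 'cV[L]_3 := \col_j f (row j M).
have fM x : f (x *m M) = \sum_j x 0 j * u j 0.
  rewrite [x *m M]mulmx_sum_row linear_sum; apply: eq_bigr => j _.
  by rewrite linearZ mxE.
have lE w : (w \in linf) = (f w == 0) by rewrite -fE memv_ker.
have ufree : rational_free u.
  move=> v v0; apply/eqP; apply: contraT => vn0.
  have /negP[] : ~~ (<[emb v *m M]> <= linf)%VS.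
    by apply: ext; rewrite piE; exists v.
  rewrite -memvE lE fM -[X in _ == X]v0; apply/eqP; apply: eq_bigr => j _.
  by rewrite mxE mulr_algl.
have mU := moore_unit ufree.
exists (invmx (moore u) *m M); split.
- by rewrite unitmx_mul unitmx_inv mU.
- move=> x; rewrite mulmxA lE fM -[in RHS](mulmxKV mU x).
  by rewrite (mulmx_moore u) row3E.
- by rewrite -(subplane_of_moore _ ufree) mulKVmx.
Qed.

(** At the point of parameter t this is Tr(a t), an element of [F]: these forms are the equations of
    the extended lines of the subplane. *)
Definition tform (a : L) (x : 'rV[L]_3) : L :=
  a * x 0 0 + fr a * x 0 1 + fr (fr a) * x 0 2.

Definition fr_line (a : L) (M : 'M[L]_3) : {vspace 'rV[L]_3} :=
  lker (linfun (fun w => tform a (w *m invmx M) : L^o)).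

Lemma tform_linear a M : linear (fun w : 'rV_3 => tform a (w *m M) : L^o).
Proof.
move=> c x y; rewrite /tform mulmxDl -scalemxAl !mxE /=.
by rewrite -[c *: _]/(c * _); ring.
Qed.

Lemma mem_fr_line a M w : M \in unitmx ->
  (w *m M \in fr_line a M) = (tform a w == 0).
Proof.
move=> MU; pose f := GRing.isLinear.Build L 'rV[L]_3 L^o *:%R _ (tform_linear a (invmx M)).
pose g : {linear 'rV[L]_3 -> L^o} := HB.pack (fun w => tform a (w *m invmx M) : L^o) f.
by rewrite memv_ker -[linfun _]/(linfun g) lfunE /= mulmxK.
Qed.

Lemma dim_fr_line a M : a != 0 -> M \in unitmx -> \dim (fr_line a M) = 2%N.
Proof.
move=> a0 MU; apply/eqP; rewrite -eqSS dim_lker_functional; last first.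
  apply: contraNneq a0 => f0.
  have := mem_fr_line a (row3 1 0 0) MU; rewrite memv_ker f0 lfunE eqxx /tform.
  by rewrite !row3E mulr1 !mulr0 !addr0 => /esym.
by rewrite dimvf /dim /= mul1n.
Qed.

Lemma tform_frow a t : tform a (frow t) = trc (a * t).
Proof. by rewrite /tform !row3E /trc !frE. Qed.

Lemma frowZ (c : F) t : frow (c *: t) = c%:A *: frow t.
Proof. by apply: row3P; rewrite !mxE /= ?frE mulr_algl. Qed.

Lemma frow_eq0 t : (frow t == 0) = (t == 0).
Proof.
apply/eqP/eqP=> [/matrixP/(_ 0 0)|->]; first by rewrite !mxE.
by apply: row3P; rewrite !mxE /= ?frE.
Qed.

Lemma mulmx_unit_eq0 (M : 'M[L]_3) (x : 'rV_3) : M \in unitmx ->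
  (x *m M == 0) = (x == 0).
Proof. by move=> MU; apply/eqP/eqP=> [x0|->]; rewrite ?mul0mx // -(mulmxK MU x) x0 mul0mx. Qed.

Lemma frow_vline (M : 'M[L]_3) s t : M \in unitmx -> s != 0 -> t != 0 ->
  <[frow s *m M]>%VS = <[frow t *m M]>%VS <-> exists c : F, s = c *: t.
Proof.
move=> MU s0 t0.
have n0 r : r != 0 -> frow r *m M != 0 by move=> r0; rewrite mulmx_unit_eq0 // frow_eq0.
split=> [|[c sE]].
- move/(vline_eqP _ (n0 _ s0)) => [c c0]; rewrite scalemxAl => /(can_inj (mulmxK MU)).
  move=> /matrixP E; have := E 0 0; have := E 0 1; rewrite !mxE /= => e1 e0.
  have [d cE] : exists d : F, c = d%:A.
    apply: fr_fixed; apply: (@mulIf _ (fr t)); first by rewrite fr_eq0.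
    by rewrite -e1 -frM -e0.
  by exists d; rewrite e0 cE mulr_algl.
- apply/(vline_eqP _ (n0 _ s0)); exists c%:A; last by rewrite sE frowZ scalemxAl.
  by rewrite alg_eq0; apply: contraNneq s0 => c0; rewrite sE c0 scale0r.
Qed.

Lemma trc_linear : linear (@trc F L).
Proof. by move=> a x y; rewrite /trc !frE !scalerDr [RHS]addrACA [X in _ = X + _]addrACA. Qed.

HB.instance Definition _ := GRing.isLinear.Build F L L *:%R (@trc F L) trc_linear.

Lemma trace_kernel_basis a : a != 0 -> exists s t : L,
  (forall x y : F, x *: s + y *: t = 0 -> x = 0 /\ y = 0) /\
  (forall r, trc (a * r) = 0 <-> exists x y : F, r = x *: s + y *: t).
Proof.
move=> a0; have [z nz] := fr_nontrivial dimL.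
pose s := (fr z - z) / a; pose t := (fr (z ^+ 2) - z ^+ 2) / a.
have indep (b c : F) : b *: s + c *: t = 0 -> b = 0 /\ c = 0.
  rewrite /s /t !scalerAl -mulrDl => /eqP; rewrite mulf_eq0 invr_eq0 (negPf a0) orbF.
  rewrite !scalerBr addrACA -opprD -!frZ -frD subr_eq0 => /eqP /fr_fixed [d dE].
  have [] // := @quadratic_free _ _ dimL z (- d) b c nz.
  by rewrite !mulr_algl -addrA dE scaleNr addNr.
have trs : trc (a * s) = 0.
  by rewrite /s mulrCA divff // mulr1 /trc !frE fr3 //; ring.
have trt : trc (a * t) = 0.
  by rewrite /t mulrCA divff // mulr1 /trc !frE !fr3 //; ring.
have [r trr] : exists r, trc (a * r) != 0.
  apply: contrapT => /forallNP tr0.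
  have [x|/eqP + _ _] := @fr_independent _ _ dimL a (fr a) (fr (fr a)).
    have /negP/negPn/eqP := tr0 x; by rewrite /trc !frE.
  by rewrite (negPf a0).
have trD (x y w : F) : trc (a * (x *: s + y *: t + w *: r)) = w *: trc (a * r).
  rewrite !mulrDr -!scalerAr !(linearD (@trc F L)) /= !(linearZ_LR (@trc F L)) /=.
  by rewrite trs trt !scaler0 !add0r.
exists s, t; split=> // v; split=> [tv|[x [y ->]]]; last first.
  by have := trD x y 0; rewrite !scale0r addr0.
pose u : 'cV[L]_3 := \col_j [:: s; t; r]`_j.
have thetaE w : theta u w = w 0 0 *: s + w 0 1 *: t + w 0 2 *: r by rewrite /theta sum3 !mxE.
have w2 (w : 'rV[F]_3) : trc (a * theta u w) = 0 -> w 0 2 = 0.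
  by rewrite thetaE trD => /eqP; rewrite scaler_eq0 (negPf trr) orbF => /eqP.
have ufree : rational_free u.
  move=> w w0; have w20 : w 0 2 = 0 by apply: w2; rewrite w0 mulr0 linear0.
  move: w0; rewrite thetaE w20 scale0r addr0 => /indep[w00 w10].
  by apply: row3P; rewrite ?w00 ?w10 ?w20 mxE.
have [w wE] := theta_surj ufree v; exists (w 0 0), (w 0 1).
by rewrite -wE thetaE w2 ?wE // scale0r addr0.
Qed.

Lemma subplane_line_fr M l : M \in unitmx ->
  subplane_line (fr_subplane M) l <-> exists2 a, a != 0 & l = fr_line a M.
Proof.
move=> MU.
have d1 r : r != 0 -> \dim <[frow r *m M]>%VS = 1%N.
  by move=> r0; rewrite dim_vline mulmx_unit_eq0 // frow_eq0 r0.
split=> [[dl [P [Q [[s s0 PE] [t t0 QE] PQ Pl Ql]]]]|[a a0 ->]].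
(* The first entry of the cross product of the conjugate rows of s and t; the other two entries are
   its conjugates. *)
- pose a := fr s * fr (fr t) - fr (fr s) * fr t.
  have a0 : a != 0.
    apply: contra_not_neq PQ => a0; rewrite PE QE; apply/frow_vline => //.
    have [c cE] : exists c : F, s / t = c%:A.
      apply: fr_fixed; apply: (@fr_inj _ L); rewrite !frE.
      apply/eqP; rewrite eqr_div ?fr_eq0 // -subr_eq0 -oppr_eq0 -a0.
      by apply/eqP; rewrite /a; ring.
    by exists c; rewrite -[RHS]mulr_algl -cE divfK.
  exists a => //; rewrite PE QE in PQ Pl Ql.
  apply: line_through (d1 _ s0) (d1 _ t0) PQ dl (dim_fr_line a0 MU) Pl Ql _ _;
    rewrite -memvE mem_fr_line // tform_frow; apply/eqP;
    by rewrite /trc /a !frE !fr3 //; ring.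
- split; first exact: dim_fr_line.
  have [s [t [indep trst]]] := trace_kernel_basis a0.
  have s0 : s != 0.
    apply/eqP => s0; have [] := indep 1 0; first by rewrite s0 scaler0 scale0r addr0.
    by move/eqP; rewrite oner_eq0.
  have t0 : t != 0.
    apply/eqP => t0; have [] := indep 0 1; first by rewrite t0 scaler0 scale0r addr0.
    by move=> _ /eqP; rewrite oner_eq0.
  exists <[frow s *m M]>%VS, <[frow t *m M]>%VS; split; try by [exists s|exists t].
  + move/(frow_vline MU s0 t0) => [c sE].
    have [] := indep 1 (- c); first by rewrite scale1r scaleNr -sE subrr.
    by move/eqP; rewrite oner_eq0.
  + rewrite -memvE mem_fr_line // tform_frow; apply/eqP/trst.
    by exists 1, 0; rewrite scale1r scale0r addr0.
  + rewrite -memvE mem_fr_line // tform_frow; apply/eqP/trst.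
    by exists 0, 1; rewrite scale1r scale0r add0r.
Qed.

(** The line of parameter c meets x0 = 0 where c^q a = - c^(q^2) b, and conjugates have equal norms.
    Conversely, Hilbert 90 solves this equation for c. *)
Lemma splash_fr_subplane linf M P : M \in unitmx -> line_at_infinity linf M ->
  splash linf (fr_subplane M) P <->
  exists a b, [/\ a != 0, nrm b = - nrm a & P = <[row3 0 a b *m M]>%VS].
Proof.
move=> MU lM; split.
- move=> [dP Pl [l /(subplane_line_fr _ MU) [c c0 ->] Pc]].
  have [p p0 PE] := dimv1_line dP; rewrite PE in Pl Pc; rewrite -memvE in Pl.
  rewrite -(mulmxKV MU p) in Pl Pc; set x := p *m invmx M in Pl Pc.
  rewrite -memvE mem_fr_line // in Pc; rewrite lM in Pl.
  exists (x 0 1), (x 0 2).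
  have e : fr c * x 0 1 = - (fr (fr c) * x 0 2).
    by move: Pc; rewrite /tform (eqP Pl) mulr0 add0r addr_eq0 => /eqP.
  have x1 : x 0 1 != 0.
    apply: contraNneq p0 => x1.
    have : fr (fr c) * x 0 2 = 0 by apply/eqP; rewrite -oppr_eq0 -e x1 mulr0.
    move/eqP; rewrite mulf_eq0 !fr_eq0 (negPf c0) /= => /eqP x2.
    rewrite -(mulmxKV MU p) -/x (row3_eta x) (eqP Pl) x1 x2 mulmx_unit_eq0 //.
    by apply/eqP/row3P; rewrite !mxE.
  split=> //.
    have := congr1 (@nrm F L) e; rewrite nrmN !nrmM !nrm_fr // -mulrN.
    by move/mulfI => -> //; rewrite ?opprK // nrm_eq0.
  by rewrite PE -{1}(mulmxKV MU p) -/x {1}(row3_eta x) (eqP Pl).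
- move=> [a [b [a0 bN ->]]].
  have b0 : b != 0 by rewrite -nrm_eq0 bN oppr_eq0 nrm_eq0.
  have r0 : row3 0 a b *m M != 0.
    rewrite mulmx_unit_eq0 //; apply: contraNneq a0 => /matrixP/(_ 0 1).
    by rewrite !mxE /= => ->.
  have [|y y0 fry] := @hilbert90 _ _ dimL (- (a / b)).
    by rewrite nrmN nrmM nrmV bN invrN mulrN opprK divff // nrm_eq0.
  split; first by rewrite /flats /= dim_vline r0.
    by rewrite -memvE lM row3E.
  exists (fr_line (fr (fr y)) M).
    by apply/subplane_line_fr => //; exists (fr (fr y)); rewrite ?fr_eq0.
  rewrite -memvE mem_fr_line // /tform !row3E !fr3 // mulr0 add0r fry.
  by apply/eqP; field; exact: b0.
Qed.

Lemma fr_subplane_exterior linf M : M \in unitmx -> line_at_infinity linf M ->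
  exterior_subplane linf (fr_subplane M).
Proof.
move=> MU lM; split; first exact: fr_subplane_subplane.
by move=> P [t t0 ->]; rewrite -memvE lM row3E.
Qed.

End Moore.

(** With affine points normalised by [k], lying on a join with a subspace at infinity becomes
    membership of a difference. It is applied on both sides of [beta], over [F] and over [L]. *)
Lemma add_line_mem (K : fieldType) (W : vectType K) (k : 'Hom(W, K^o)) (p x y : W)
    (U : {vspace W}) : k p = 1 -> k x = 0 -> k y = 0 -> (forall u, u \in U -> k u = 0) ->
  (p + y \in (<[(p + x)%R]> + U)%VS) = (y - x \in U).
Proof.
move=> kp kx ky kU; apply/idP/idP => [/memv_addP[_ /vlineP[a ->] [u uU E]]|yxU].
  have a1 : a = 1.
    move/(congr1 k): E; rewrite !linearD /= !linearZ /= kp kx ky (kU u) // scaler0 !addr0.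
    by rewrite -[_ *: _]/(_ * _) mulr1.
  by move: E; rewrite a1 scale1r -addrA => /addrI ->; rewrite addrAC subrr add0r.
by rewrite -[y](subrK x) addrCA addrC memv_add ?memv_line.
Qed.

(** * The Bruck-Bose bijection is semilinear *)

Section Coordinatisation.
Variables (F : finFieldType) (L : fieldExtType F).
Variables (V : vectType F) (V' : vectType L).
Variables (H : {vspace V}) (Sp : set {vspace V}) (linf : {vspace V'}).
Variable beta : {vspace V} -> {vspace V'}.
Hypotheses (dV : \dim {:V} = 7%N) (dV' : \dim {:V'} = 3%N).
Hypotheses (dH : flats 5 H) (dlinf : flats 1 linf).
Hypotheses (planesSp : planes_in H Sp) (disjSp : disjoint_flats Sp).
Hypothesis covSp : covered Sp = [set P | flats 0 P /\ (P <= H)%VS].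
Hypothesis betaP : bruck_bose H Sp linf beta.

Lemma spread_cover h : h \in H -> h != 0 -> exists2 U, Sp U & h \in U.
Proof.
move=> hH h0; have : covered Sp <[h]>%VS.
  by rewrite covSp /= /flats /= dim_vline h0 -memvE.
by move=> [_ [U SU]]; rewrite -memvE => hU; exists U.
Qed.

Lemma hyperplane_nonzero : exists2 h, h \in H & h != 0.
Proof.
have H0 : H != 0%VS by rewrite -dimv_eq0 dH.
by exists (vpick H); rewrite ?memv_pick ?vpick0.
Qed.

Lemma spread_sub U u : Sp U -> u \in U -> u \in H.
Proof. by move=> /planesSp[_ /subvP UH] /UH. Qed.

Lemma spread_unique U W h : Sp U -> Sp W -> h \in U -> h \in W -> h != 0 -> U = W.
Proof.
move=> SU SW hU hW; apply: contra_neqP => UW.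
by apply/eqP; rewrite -memv0 -(disjSp SU SW UW) memv_cap hU.
Qed.

Lemma spread_avoid U : Sp U -> exists2 h, h \in H & h \notin U.
Proof.
move=> SU; have [dU UH] := planesSp SU; apply: contrapT => /forall2NP no.
have : (H <= U)%VS.
  by apply/subvP=> h hH; have [//|/negP/negPn] := no h.
by move/dimvS; rewrite dH dU.
Qed.

Lemma beta_bij : set_bij (bb_point H Sp) (@flats _ V' 0) beta.
Proof. by case: betaP. Qed.

Lemma beta_flat P : bb_point H Sp P -> \dim (beta P) = 1%N.
Proof. by case: beta_bij => + _ _ => /[apply]. Qed.

Lemma beta_inj P Q : bb_point H Sp P -> bb_point H Sp Q -> beta P = beta Q -> P = Q.
Proof. by case: beta_bij => _ inj _ bP bQ; apply: inj; rewrite inE. Qed.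

Lemma beta_infinity P : bb_point H Sp P -> (beta P <= linf)%VS = (P <= H)%VS.
Proof.
case: betaP => _ [g [_ gH gP]] bP; rewrite -gH gP //; by left.
Qed.

Lemma affine_bb v : v \notin H -> bb_point H Sp <[v]>%VS.
Proof.
move=> vH; left; split; last by rewrite -memvE.
by rewrite /flats /= dim_vline; case: eqVneq vH => // ->; rewrite mem0v.
Qed.

Lemma beta_collinear U v w : Sp U -> v \notin H -> w \notin H ->
  (w \in <[v]> + U)%VS = (beta <[w]> <= beta <[v]> + beta U)%VS.
Proof.
move=> SU vH wH; have [dU UH] := planesSp SU.
pose M := (<[v]> + U)%VS.
have v0 : v != 0 by apply: contraNneq vH => ->; rewrite mem0v.
have dM : \dim M = 4%N.
  rewrite dimv_disjoint_sum ?dim_vline ?v0 ?dU //.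
  apply/eqP; rewrite -subv0; apply/subvP=> x; rewrite memv_cap => /andP[/vlineP[a ->] avU].
  have [->|a0] := eqVneq a 0; first by rewrite scale0r mem0v.
  case/negP: vH; rewrite -(scalerK a0 v) memvZ //.
  exact: (subvP UH).
have [_ [g [[gfl _ _] gH gP]]] := betaP.
have bM : bb_line H Sp M.
  right; split=> //; last by exists U => //; exact: addvSr.
  by apply: contra vH => /subvP; apply; rewrite (subvP (addvSl _ _)) ?memv_line.
have bU : bb_point H Sp U by right.
have -> : (beta <[v]> + beta U)%VS = g M.
  apply/eqP; rewrite eqEdim subv_add -!gP //; [|exact: affine_bb].
  rewrite addvSl addvSr /= (gfl _ bM) dim_add_lines ?beta_flat //.
    exact: affine_bb.
  move/(beta_inj (affine_bb vH) bU) => E; case/negP: vH; apply: (subvP UH).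
  by rewrite -E memv_line.
by rewrite -gP ?memvE //; exact: affine_bb.
Qed.

(** Representatives on which [f] and [g] equal 1, together with an origin, reduce [beta] on affine
    points to a map [psi] between the translation spaces H and l_oo. *)
Lemma affine_coordinates : exists (f : 'Hom(V, F^o)) (g : 'Hom(V', L^o)) v0 w0 psi,
  [/\ lker f = H /\ f v0 = 1, lker g = linf /\ g w0 = 1,
   forall h, h \in H -> psi h \in linf,
   forall h, h \in H -> beta <[v0 + h]> = <[w0 + psi h]>%VS &
   psi 0 = 0].
Proof.
have [f [v0 [fH fv0]]] := @hyperplane_functional _ _ H (etrans (congr1 S dH) (esym dV)).
have [g [_ [gl _]]] :=
  @hyperplane_functional _ _ linf (etrans (congr1 S dlinf) (esym dV')).
have hv0 h : h \in H -> v0 + h \notin H.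
  by rewrite -fH !memv_ker linearD /= fv0 => /eqP ->; rewrite addr0 oner_neq0.
have norm h : h \in H -> exists2 w, g w = 1 & beta <[v0 + h]> = <[w]>%VS.
  move=> hH; have bp := affine_bb (hv0 h hH).
  have [w w0 wE] := dimv1_line (beta_flat bp).
  have gw : g w != 0.
    by rewrite -memv_ker gl memvE -wE beta_infinity // -memvE hv0.
  exists ((g w)^-1 *: w); first by rewrite linearZ /= -[_ *: _]/(_ * _) mulVf.
  by rewrite wE; apply/vline_eqP => //; exists (g w); rewrite // scalerKV.
have [w0 gw0 w0E] := norm 0 (mem0v H).
have /choice [psi psiP] : forall h, exists l, h \in H ->
    l \in linf /\ beta <[v0 + h]> = <[w0 + l]>%VS.
  move=> h; have [hH|hH] := boolP (h \in H); last by exists 0.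
  have [w gw wE] := norm h hH; exists (w - w0) => _.
  split; first by rewrite -gl memv_ker linearB /= gw gw0 subrr.
  by rewrite wE addrC subrK.
exists f, g, v0, w0, psi; split=> // [h /psiP[]//|h /psiP[]//|].
have [p0l] := psiP 0 (mem0v H); rewrite w0E.
have w0n : w0 != 0 by apply: contra_eq_neq gw0 => ->; rewrite linear0 eq_sym oner_neq0.
move/(vline_eqP _ w0n) => [c c0 E].
have c1 : c = 1.
  move/(congr1 g): E; rewrite linearZ linearD /=.
  move: p0l; rewrite -gl memv_ker => /eqP ->; rewrite addr0 gw0.
  by rewrite -[_ *: _]/(_ * _) mulr1.
by move: E; rewrite c1 scale1r => E; apply: (addrI w0); rewrite addr0 -E.
Qed.

Section Affine.
Variables (f : 'Hom(V, F^o)) (g : 'Hom(V', L^o)) (v0 : V) (w0 : V') (psi : V -> V').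
Hypotheses (fH : lker f = H) (fv0 : f v0 = 1) (gl : lker g = linf) (gw0 : g w0 = 1).
Hypothesis psil : forall h, h \in H -> psi h \in linf.
Hypothesis psiE : forall h, h \in H -> beta <[v0 + h]> = <[w0 + psi h]>%VS.
Hypothesis psi0 : psi 0 = 0.

Lemma affine_notin h : h \in H -> v0 + h \notin H.
Proof.
by rewrite -fH !memv_ker linearD /= fv0 => /eqP ->; rewrite addr0 oner_neq0.
Qed.

Lemma psi_parallel U h k : Sp U -> h \in H -> k \in H ->
  (k - h \in U) = (psi k - psi h \in beta U).
Proof.
move=> SU hH kH.
have f0 x : x \in H -> f x = 0 by rewrite -fH memv_ker => /eqP.
have g0 x : x \in linf -> g x = 0 by rewrite -gl memv_ker => /eqP.
rewrite -(add_line_mem fv0 (f0 _ hH) (f0 _ kH)); last first.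
  by move=> u uU; apply/f0/(spread_sub SU).
rewrite (beta_collinear SU) ?affine_notin // !psiE // -memvE.
apply: (add_line_mem gw0); rewrite ?g0 ?psil // => u uU; apply: g0.
have bU : bb_point H Sp U by right.
by apply: (subvP _ _ uU); rewrite beta_infinity //; case: (planesSp SU).
Qed.

Lemma psi_in U h : Sp U -> h \in H -> (h \in U) = (psi h \in beta U).
Proof. by move=> SU hH; have := psi_parallel SU (mem0v H) hH; rewrite psi0 !subr0. Qed.

Lemma beta_disjoint U W x : Sp U -> Sp W -> U <> W -> x \in beta U -> x \in beta W -> x = 0.
Proof.
move=> SU SW UW xU xW; apply: contra_notP UW => x0.
have bU : bb_point H Sp U by right.
have bW : bb_point H Sp W by right.
apply: beta_inj => //.
have e X : bb_point H Sp X -> x \in beta X -> <[x]>%VS = beta X.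
  move=> bX xX; apply/eqP; rewrite eqEdim -memvE xX beta_flat // dim_vline.
  by case: eqP.
by rewrite -(e U) // (e W).
Qed.

Lemma psi_eq0 h : h \in H -> psi h = 0 -> h = 0.
Proof.
move=> hH ph; apply: contraPP ph => /eqP h0.
have [U SU hU] := spread_cover hH h0.
have [k kH kU] := spread_avoid SU.
have k0 : k != 0 by apply: contraNneq kU => ->; rewrite mem0v.
have [W SW kW] := spread_cover kH k0.
move=> ph0; have hW : h \in W by rewrite psi_in // ph0 mem0v.
by rewrite (spread_unique SU SW hU hW h0) kW in kU.
Qed.

(** Parallelogram rule: psi(h + k) - psi h - psi k lies in both directions [beta U] and [beta W],
    which are distinct points. *)
Lemma psi_add_distinct U W h k : Sp U -> Sp W -> U <> W -> h \in U -> k \in W ->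
  psi (h + k) = psi h + psi k.
Proof.
move=> SU SW UW hU kW; have hH := spread_sub SU hU; have kH := spread_sub SW kW.
have hkH : h + k \in H by rewrite memvD.
apply/eqP; rewrite -subr_eq0; apply/eqP; apply: (beta_disjoint SU SW UW).
- rewrite opprD addrA addrAC memvB //; last by rewrite -psi_in.
  by rewrite -psi_parallel // addrK.
- rewrite opprD addrA memvB //; last by rewrite -psi_in.
  by rewrite -psi_parallel // addrC addKr.
Qed.

Lemma psi_add h k : h \in H -> k \in H -> psi (h + k) = psi h + psi k.
Proof.
move=> hH kH.
have [->|h0] := eqVneq h 0; first by rewrite psi0 !add0r.
have [->|k0] := eqVneq k 0; first by rewrite psi0 !addr0.
have [U SU hU] := spread_cover hH h0; have [W SW kW] := spread_cover kH k0.
have [UW|UW] := pselect (U = W); last exact: (psi_add_distinct SU SW UW).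
rewrite -UW {W SW UW} in kW.
(* Here h and k lie in one plane U; a vector x outside U reduces the claim to sums across distinct
   planes. *)
have [x xH xU] := spread_avoid SU.
have x0 : x != 0 by apply: contraNneq xU => ->; rewrite mem0v.
have [W SW xW] := spread_cover xH x0.
have UW : U <> W by move=> UW; rewrite UW xW in xU.
have kxH : k + x \in H by rewrite memvD.
have kxU : k + x \notin U by rewrite rpredDl.
have kx0 : k + x != 0 by apply: contraNneq kxU => ->; rewrite mem0v.
have [X SX kxX] := spread_cover kxH kx0.
have UX : U <> X by move=> UX; rewrite UX kxX in kxU.
have hkU : h + k \in U by rewrite memvD.
apply: (addIr (psi x)); rewrite -(psi_add_distinct SU SW UW hkU xW) -addrA.
by rewrite (psi_add_distinct SU SX UX) // (psi_add_distinct SU SW UW) // addrA.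
Qed.

Lemma psi_line U h k : Sp U -> h \in U -> h != 0 -> k \in U -> exists c, psi k = c *: psi h.
Proof.
move=> SU hU h0 kU; have hH := spread_sub SU hU; have kH := spread_sub SU kU.
have bU : bb_point H Sp U by right.
have [p p0 pE] := dimv1_line (beta_flat bU).
have : psi h \in <[p]>%VS by rewrite -pE -psi_in.
have : psi k \in <[p]>%VS by rewrite -pE -psi_in.
move=> /vlineP[b ->] /vlineP[a aE].
have a0 : a != 0.
  by apply: contraNneq h0 => a0; apply/eqP/psi_eq0; rewrite // aE a0 scale0r.
by exists (b / a); rewrite aE scalerA divfK.
Qed.

(** A priori the factor depends on h. For h and k in distinct planes, comparing the factors of h, k
    and h + k along the independent vectors psi h and psi k shows that they agree; vectors of one
    plane are compared through another plane. *)
Lemma psi_scale (a : F) : exists c : L, forall h, h \in H -> psi (a *: h) = c *: psi h.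
Proof.
have sH h : h \in H -> a *: h \in H by apply: memvZ.
have agree U W h k c d : Sp U -> Sp W -> U <> W -> h \in U -> k \in W ->
    h != 0 -> k != 0 -> psi (a *: h) = c *: psi h -> psi (a *: k) = d *: psi k -> c = d.
  move=> SU SW UW hU kW h0 k0 hc kd.
  have hH := spread_sub SU hU; have kH := spread_sub SW kW.
  have hkH : h + k \in H by rewrite memvD.
  have hk0 : h + k != 0.
    apply/eqP => hk0; apply: UW; apply: (spread_unique (h := h)) => //.
    by rewrite -[h](addrK k) hk0 sub0r memvN.
  have [X SX hkX] := spread_cover hkH hk0.
  have [e eE] := psi_line SX hkX hk0 (memvZ a hkX).
  have : (e - c) *: psi h = (d - e) *: psi k.
    apply/eqP; rewrite !scalerBl subr_eq addrAC eq_sym subr_eq eq_sym -scalerDr.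
    by rewrite -psi_add // -eE scalerDr psi_add ?sH // hc kd addrC.
  move=> E; have E0 : (e - c) *: psi h = 0.
    apply: (beta_disjoint SU SW UW); first by rewrite memvZ // -psi_in.
    by rewrite E memvZ // -psi_in.
  have ph0 : psi h != 0 by apply: contraNneq h0 => /psi_eq0 ->.
  have pk0 : psi k != 0 by apply: contraNneq k0 => /psi_eq0 ->.
  have /eqP := E0; rewrite scaler_eq0 (negPf ph0) orbF subr_eq0 => /eqP <-.
  have /eqP := esym (etrans (esym E0) E).
  by rewrite scaler_eq0 (negPf pk0) orbF subr_eq0 => /eqP.
have [h hH h0] := hyperplane_nonzero.
have [U SU hU] := spread_cover hH h0.
have [c cE] := psi_line SU hU h0 (memvZ a hU).
exists c => k kH.
have [->|k0] := eqVneq k 0; first by rewrite scaler0 psi0 scaler0.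
have [W SW kW] := spread_cover kH k0.
have [d dE] := psi_line SW kW k0 (memvZ a kW).
have [UW|UW] := pselect (U = W); last by rewrite (agree U W h k c d).
have [x xH xU] := spread_avoid SU.
have x0 : x != 0 by apply: contraNneq xU => ->; rewrite mem0v.
have [X SX xX] := spread_cover xH x0.
have UX : U <> X by move=> UX; rewrite UX xX in xU.
have WX : W <> X by rewrite -UW.
have [b bE] := psi_line SX xX x0 (memvZ a xX).
by rewrite dE (agree _ _ _ _ _ _ SW SX WX kW xX k0 x0 dE bE)
   (agree _ _ _ _ _ _ SU SX UX hU xX h0 x0 cE bE).
Qed.

End Affine.

Lemma semilinear_coordinates :
  exists (s : {rmorphism L -> L}) (Psi : V -> V'), bijective s /\
  [/\ forall a u v, Psi (a *: u + v) = s a%:A *: Psi u + Psi v,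
      forall v, (Psi v \in linf) = (v \in H),
      forall v, Psi v = 0 -> v = 0,
      forall v, v \notin H -> beta <[v]> = <[Psi v]>%VS &
      forall U, Sp U -> forall u, u \in U -> u != 0 -> beta U = <[Psi u]>%VS].
Proof.
have [f [g [v0 [w0 [psi [[fH fv0] [gl gw0] psil psiE psi0]]]]]] := affine_coordinates.
have psiD := psi_add fH fv0 gl gw0 psil psiE psi0.
have psi_inj := psi_eq0 fH fv0 gl gw0 psil psiE psi0.
have /choice [mu muE] := psi_scale fH fv0 gl gw0 psil psiE psi0.
have [h hH h0] := hyperplane_nonzero.
have ph0 : psi h != 0 by apply: contraNneq h0 => /psi_inj ->.
have cancel_ph c d : c *: psi h = d *: psi h -> c = d.
  move/eqP; rewrite -subr_eq0 -scalerBl scaler_eq0 (negPf ph0) orbF subr_eq0.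
  by move/eqP.
have muD : {morph mu : a b / a + b}.
  by move=> a b; apply: cancel_ph; rewrite -muE // scalerDl psiD ?memvZ // !muE // scalerDl.
have muM : {morph mu : a b / a * b}.
  by move=> a b; apply: cancel_ph; rewrite -muE // -scalerA !muE ?memvZ // scalerA.
have mu1 : mu 1 = 1 by apply: cancel_ph; rewrite -muE // !scale1r.
have muX a n : mu (a ^+ n) = mu a ^+ n.
  by elim: n => [|n IHn]; rewrite ?expr0 ?mu1 // !exprS muM IHn.
(* The multiplicative [mu] inherits a^q = a from [F], which puts its values back into [F]. *)
have /choice [tau tauE] : forall a, exists b : F, mu a = b%:A.
  by move=> a; apply: fr_fixed; rewrite fr_def -muX expf_card.
have alg_inj (a b : F) : a%:A = b%:A :> L -> a = b.
  by move/eqP; rewrite -subr_eq0 -scalerBl alg_eq0 subr_eq0 => /eqP.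
have tauD : {morph tau : a b / a + b}.
  by move=> a b; apply: alg_inj; rewrite scalerDl -!tauE muD.
have tau0 : tau 0 = 0 by apply: (addrI (tau 0)); rewrite -tauD !addr0.
have tauB : zmod_morphism tau.
  move=> a b; apply: (addIr (tau b)); rewrite -tauD !subrK //.
have tauM : monoid_morphism tau.
  split; first by apply: alg_inj; rewrite -tauE mu1 scale1r.
  by move=> a b; apply: alg_inj; rewrite -tauE muM !tauE mulr_algl scalerA.
pose tau' : {rmorphism F -> F} := HB.pack tau (GRing.isZmodMorphism.Build F F tau tauB)
   (GRing.isMonoidMorphism.Build F F tau tauM).
have [s [sbij sE]] := rmorphism_extension L tau'.
have smu a : s a%:A = mu a by rewrite sE tauE.
pose r v := v - f v *: v0.
have rH v : r v \in H by rewrite -fH memv_ker linearB linearZ /= fv0 -[_ *: 1]/(_ * 1) mulr1 subrr.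
have vE v : v = f v *: v0 + r v by rewrite addrC subrK.
have so1 (c : L) : c *: (1 : L^o) = c := mulr1 c.
have f0 v : (f v == 0) = (v \in H) by rewrite -fH memv_ker.
have rD a u v : r (a *: u + v) = a *: r u + r v.
  by rewrite /r linearP /= scalerBr scalerA scalerDl opprD addrACA.
exists s, (fun v => s (f v)%:A *: w0 + psi (r v)); split=> //; split.
- move=> a u v; rewrite rD psiD ?memvZ // muE // linearP /=.
  have -> : (a *: f u + f v)%:A = a%:A * (f u)%:A + (f v)%:A :> L.
    by rewrite mulr_algl scalerA -scalerDl.
  by rewrite rmorphD rmorphM /= smu scalerDl scalerDr scalerA addrACA.
- move=> v; rewrite -gl memv_ker linearD linearZ /= gw0.
  have := psil _ (rH v); rewrite -gl memv_ker => /eqP ->; rewrite addr0.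
  by rewrite so1 fmorph_eq0 alg_eq0 f0.
- move=> v pv0; have := congr1 g pv0; rewrite linear0 linearD linearZ /= gw0.
  have /psil := rH v; rewrite -gl memv_ker => /eqP gr0.
  rewrite gr0 addr0 so1 => /eqP; rewrite fmorph_eq0 alg_eq0 => /eqP fv.
  have := pv0; rewrite fv scale0r rmorph0 scale0r add0r => /(psi_inj _ (rH v)) rv0.
  by rewrite (vE v) fv scale0r rv0 addr0.
- move=> v; rewrite -f0 => fv.
  have fr0 : (f v)^-1 *: r v \in H by rewrite memvZ.
  have -> : <[v]>%VS = <[v0 + (f v)^-1 *: r v]>%VS.
    apply/vline_eqP; first by apply: contraNneq fv => ->; rewrite linear0.
    by exists (f v) => //; rewrite scalerDr scalerKV // -vE.
  rewrite psiE // muE //; symmetry.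
  have sf0 : s (f v)%:A != 0 by rewrite fmorph_eq0 alg_eq0.
  have -> : s (f v)%:A *: w0 + psi (r v) = s (f v)%:A *: (w0 + mu (f v)^-1 *: psi (r v)).
    rewrite scalerDr scalerA -smu -rmorphM mulr_algl scalerA divff //.
    by rewrite scale1r rmorph1 scale1r.
  apply/vline_eqP; last by exists (s (f v)%:A).
  rewrite scaler_eq0 (negPf sf0) /= -muE //; apply/eqP => /(congr1 g).
  rewrite linearD /= gw0 linear0; have := psil _ fr0; rewrite -gl memv_ker => /eqP ->.
  by rewrite addr0 => /eqP; rewrite oner_eq0.
- move=> U SU u uU u0; have uH := spread_sub SU uU.
  have ru : r u = u by move: uH; rewrite -f0 /r => /eqP ->; rewrite scale0r subr0.
  have fu : f u = 0 by apply/eqP; rewrite f0.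
  rewrite ru fu scale0r rmorph0 scale0r add0r; apply/esym/eqP.
  have bU : bb_point H Sp U by right.
  rewrite eqEdim -memvE -(psi_in fH fv0 gl gw0 psil psiE psi0) // uU beta_flat // dim_vline.
  by case: eqP => // /psi_inj u00; rewrite u00 ?eqxx in u0.
Qed.

End Coordinatisation.

(** * Covers *)

Section Graphs.
Variables (F : finFieldType) (L : fieldExtType F) (V : vectType F).
Hypothesis dimL : \dim {:L} = 3%N.
Variables (e : {linear V -> F^o}) (y1 y2 : {linear V -> L}).
Variable iota : F -> L -> L -> V.
Hypothesis iotaK : forall x a b,
  [/\ e (iota x a b) = x, y1 (iota x a b) = a & y2 (iota x a b) = b].
Hypothesis iotaE : forall v, iota (e v) (y1 v) (y2 v) = v.

Lemma e_iota x a b : e (iota x a b) = x. Proof. by case: (iotaK x a b). Qed.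
Lemma y1_iota x a b : y1 (iota x a b) = a. Proof. by case: (iotaK x a b). Qed.
Lemma y2_iota x a b : y2 (iota x a b) = b. Proof. by case: (iotaK x a b). Qed.

Lemma coord_inj u v : e u = e v -> y1 u = y1 v -> y2 u = y2 v -> u = v.
Proof. by move=> eE y1E y2E; rewrite -(iotaE u) eE y1E y2E iotaE. Qed.

Lemma coord_eq0 v : e v = 0 -> y1 v = 0 -> y2 v = 0 -> v = 0.
Proof. by move=> *; apply: coord_inj; rewrite linear0. Qed.

Lemma iota_linear k x a b x' a' b' :
  iota (k * x + x') (k *: a + a') (k *: b + b') = k *: iota x a b + iota x' a' b'.
Proof. by apply: coord_inj; rewrite linearP ?(e_iota, y1_iota, y2_iota). Qed.

Lemma iota0 : iota 0 0 0 = 0.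
Proof. by rewrite -[RHS]iotaE !linear0. Qed.

Definition graph (g : L -> L) : {vspace V} := limg (linfun (fun x => iota 0 x (g x))).

Lemma mem_graph (g : {linear L -> L}) v :
  (v \in graph g) = (e v == 0) && (y2 v == g (y1 v)).
Proof.
have lin : linear (fun x => iota 0 x (g x)).
  by move=> k x y; rewrite -iota_linear mulr0 addr0 linearP.
pose h : {linear L -> V} := HB.pack (fun x => iota 0 x (g x))
  (GRing.isLinear.Build F L V *:%R _ lin).
have hE x : linfun (fun x => iota 0 x (g x)) x = iota 0 x (g x).
  by rewrite -[linfun _]/(linfun h) lfunE.
apply/memv_imgP/andP => [[x _ ->]|[/eqP ev /eqP y2v]].
  by rewrite hE e_iota y1_iota y2_iota.
by exists (y1 v); rewrite ?memvf // hE -[LHS]iotaE ev y2v.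
Qed.

Lemma graph_iota (g : {linear L -> L}) x : iota 0 x (g x) \in graph g.
Proof. by rewrite mem_graph e_iota y1_iota y2_iota !eqxx. Qed.

Lemma iota_neq0 x y : x != 0 -> iota 0 x y != 0.
Proof. by apply: contraNneq => E; rewrite -(y1_iota 0 x y) E linear0. Qed.

Lemma dim_graph (g : {linear L -> L}) : \dim (graph g) = 3%N.
Proof.
rewrite -dimL; have lin : linear (fun x => iota 0 x (g x)).
  by move=> k x y; rewrite -iota_linear mulr0 addr0 linearP.
pose h : {linear L -> V} := HB.pack (fun x => iota 0 x (g x))
  (GRing.isLinear.Build F L V *:%R _ lin).
rewrite /graph -[linfun _]/(linfun h) limg_dim_eq //.
apply/eqP; rewrite -subv0; apply/subvP => x; rewrite memv_cap memv_ker lfunE /= => /andP[_ /eqP x0].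
by rewrite memv0 -(y1_iota 0 x (g x)) x0 linear0.
Qed.

Lemma eq_graph (g h : {linear L -> L}) : graph g = graph h -> g =1 h.
Proof.
move=> gh x; have := graph_iota g x.
by rewrite gh mem_graph e_iota y1_iota y2_iota eqxx => /eqP.
Qed.

Definition id_graph c := graph (c \*o (idfun : {linear L -> L})).
Definition fr_graph c := graph (c \*o (@fr F L : {linear L -> L})).
Definition fr2_graph c := graph (c \*o ((@fr F L \o @fr F L) : {linear L -> L})).

Definition fr_family : set {vspace V} := [set U | exists2 c, nrm c = -1 & U = fr_graph c].
Definition fr2_family : set {vspace V} := [set U | exists2 c, nrm c = -1 & U = fr2_graph c].

Lemma mem_id_graph c v : (v \in id_graph c) = (e v == 0) && (y2 v == c * y1 v).
Proof. exact: mem_graph. Qed.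
Lemma mem_fr_graph c v : (v \in fr_graph c) = (e v == 0) && (y2 v == c * fr (y1 v)).
Proof. exact: mem_graph. Qed.
Lemma mem_fr2_graph c v : (v \in fr2_graph c) = (e v == 0) && (y2 v == c * fr (fr (y1 v))).
Proof. exact: mem_graph. Qed.

Lemma nrm_neq0 (c : L) : nrm c = -1 -> c != 0.
Proof. by move=> c1; rewrite -nrm_eq0 c1 oppr_eq0 oner_eq0. Qed.

(* Hilbert 90 gives a common point. *)
Lemma fr_fr2_graph_meet c d : nrm c = -1 -> nrm d = -1 ->
  exists v, [/\ v != 0, v \in fr_graph c & v \in fr2_graph d].
Proof.
move=> c1 d1; have d0 := nrm_neq0 d1.
have [|y y0 yE] := @hilbert90 _ _ dimL (c / d).
  by rewrite nrmM nrmV c1 d1 divff // oppr_eq0 oner_eq0.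
exists (iota 0 (fr (fr y)) (c * y)).
rewrite iota_neq0 ?fr_eq0 // mem_fr_graph mem_fr2_graph e_iota y1_iota y2_iota.
by rewrite fr3 // yE mulrA mulrCA divff // mulr1 !eqxx.
Qed.

Lemma fr_fr2_graph_neq c d : nrm c = -1 -> fr_graph c <> fr2_graph d.
Proof.
move=> c1 /eq_graph E; have [x|_ /eqP + _] := @fr_independent _ _ dimL 0 c (- d).
  by have := E x; rewrite /= => ->; rewrite mul0r add0r mulNr subrr.
by rewrite (negPf (nrm_neq0 c1)).
Qed.

Variables (H : {vspace V}) (SS X : set {vspace V}).
Hypothesis F3 : (3 <= #|F|)%N.
Hypothesis eH : forall v, (v \in H) = (e v == 0).
Hypothesis SSE : forall U, SS U <-> exists2 c, nrm c = -1 & U = id_graph c.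
Hypothesis coverX : is_cover #|F| H SS X.

Lemma cover_norm U u : X U -> u \in U -> e u = 0 /\ nrm (y2 u) = - nrm (y1 u).
Proof.
move=> XU uU; have [_ /(_ U XU)[_ /subvP UH] _ cov _] := coverX.
have := UH _ uU; rewrite eH => /eqP eu; split=> //.
have [->|u0] := eqVneq u 0; first by rewrite !linear0 nrm0 oppr0.
have : covered X <[u]>%VS.
  split; first by rewrite /flats /= dim_vline u0.
  by exists U; rewrite // -memvE.
rewrite cov => -[_ [W /SSE[c c1 ->]]]; rewrite -memvE mem_id_graph => /andP[_ /eqP ->].
by rewrite nrmM c1 mulN1r.
Qed.

(** The points of the splash form the cubic hypersurface N(y2) = -N(y1) of H. On a plane inside it
    y1 = 0 forces y2 = 0, so the plane is the graph of a map multiplying norms by -1, and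
    [nrm_preserving] lists these maps. *)
Lemma cover_graph U : X U -> exists2 c, nrm c = -1 &
  [\/ U = id_graph c, U = fr_graph c | U = fr2_graph c].
Proof.
move=> XU; have [_ /(_ U XU)[dU /subvP UH] _ cov _] := coverX.
have U0 u : u \in U -> y1 u = 0 -> u = 0.
  move=> uU yu; have [eu] := cover_norm XU uU; rewrite yu nrm0 oppr0.
  by move/eqP; rewrite nrm_eq0 => /eqP; apply: coord_eq0.
have Uinj u v : u \in U -> v \in U -> y1 u = y1 v -> u = v.
  move=> uU vU uv; apply/eqP; rewrite -subr_eq0; apply/eqP/U0; first exact: memvB.
  by rewrite linearB /= uv subrr.
have /choice [h hP] : forall a, exists u, u \in U /\ y1 u = a.
  move=> a; have : (linfun y1 @: U = fullv)%VS.
    apply/eqP; rewrite eqEdim subvf dimL limg_dim_eq ?dU //.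
    apply/eqP; rewrite -subv0; apply/subvP=> u; rewrite memv_cap memv_ker lfunE /=.
    by move=> /andP[uU /eqP /(U0 _ uU) ->]; rewrite mem0v.
  move/vspaceP/(_ a); rewrite memvf => /memv_imgP[u uU ->].
  by exists u; rewrite lfunE.
have hU a : h a \in U by case: (hP a).
have y1h a : y1 (h a) = a by case: (hP a).
have hlin : linear (y2 \o h).
  move=> k a b; rewrite /= -linearP; congr (y2 _); apply: Uinj => //.
    by rewrite memvD ?memvZ.
  by rewrite linearP /= !y1h.
pose f : {linear L -> L} := HB.pack (y2 \o h) (GRing.isLinear.Build F L L *:%R _ hlin).
have yf u : u \in U -> y2 u = f (y1 u) by move=> uU; rewrite /f /= (Uinj (h (y1 u)) u).
have [||c c1 fE] := @nrm_preserving _ _ F3 f (-1).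
- by rewrite oppr_eq0 oner_neq0.
- by move=> a; rewrite /f /= (proj2 (cover_norm XU (hU a))) y1h mulN1r.
have UE (g : {linear L -> L}) : (forall x, f x = g x) -> U = graph g.
  move=> fg; apply/eqP; rewrite eqEdim dU dim_graph leqnn andbT.
  apply/subvP=> u uU; rewrite mem_graph (proj1 (cover_norm XU uU)) eqxx /=.
  by rewrite yf // fg.
by exists c => //; case: fE => fE; [constructor 1|constructor 2|constructor 3]; apply: UE.
Qed.

Lemma cover_not_id_graph c : nrm c = -1 -> ~ X (id_graph c).
Proof.
move=> c1 XU; have [_ _ _ _ /(_ _ (id_graph c) XU)] := coverX.
rewrite capvv /flats /= dim_graph => SS31.
by have [] : 3%N = 1%N by apply/SS31/SSE; exists c.
Qed.

(** The point (0, 1, c) with N(c) = -1 belongs to the splash, and within the family only the plane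
    of index c can cover it. So inclusion already gives equality. *)
Lemma cover_eq (T : L -> {vspace V}) :
  (forall c, iota 0 1 c \in T c) ->
  (forall c d, iota 0 1 c \in T d -> c = d) ->
  (forall U, X U -> exists2 c, nrm c = -1 & U = T c) ->
  X = [set U | exists2 c, nrm c = -1 & U = T c].
Proof.
move=> T1 Tinj XT; apply/seteqP; split=> U; first exact: XT.
move=> [c c1 ->]; have [_ _ _ cov _] := coverX.
have : covered SS <[(iota 0 1 c)%R]>%VS.
  split; first by rewrite /flats /= dim_vline iota_neq0 ?oner_neq0.
  exists (id_graph c); first by apply/SSE; exists c.
  by rewrite -memvE mem_id_graph e_iota y1_iota y2_iota mulr1 !eqxx.
rewrite -cov => -[_ [W XW]]; rewrite -memvE; have [d d1 WE] := XT W XW.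
by rewrite WE => /Tinj ->; rewrite -WE.
Qed.

(** Planes of different families meet, while planes of a cover are disjoint, so one plane decides
    the family. Splash planes are excluded because a plane does not meet itself in a point. *)
Lemma cover_classification : X = fr_family \/ X = fr2_family.
Proof.
have Xdisj U W : X U -> X W -> U <> W -> (U :&: W = 0)%VS.
  by case: coverX => _ _ disj _ _; apply: disj.
have [[U XU [c c1 UE]]|nofr] := pselect (exists2 U, X U & exists2 c, nrm c = -1 & U = fr_graph c).
- left; apply: cover_eq => [d|b d|W XW].
  + by rewrite mem_fr_graph e_iota y1_iota y2_iota fr1 mulr1 !eqxx.
  + by rewrite mem_fr_graph e_iota y1_iota y2_iota fr1 mulr1 eqxx => /eqP.
  have [d d1 [WE|WE|WE]] := cover_graph XW.
  + by case: (cover_not_id_graph d1); rewrite -WE.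
  + by exists d.
  have [v [v0 vU vW]] := fr_fr2_graph_meet c1 d1.
  have : v \in (U :&: W)%VS by rewrite memv_cap UE WE vU.
  rewrite Xdisj //; first by rewrite memv0 (negPf v0).
  by rewrite UE WE; apply: fr_fr2_graph_neq.
- right; apply: cover_eq => [d|b d|W XW].
  + by rewrite mem_fr2_graph e_iota y1_iota y2_iota !fr1 mulr1 !eqxx.
  + by rewrite mem_fr2_graph e_iota y1_iota y2_iota !fr1 mulr1 eqxx => /eqP.
  have [d d1 [WE|WE|WE]] := cover_graph XW.
  + by case: (cover_not_id_graph d1); rewrite -WE.
  + by case: nofr; exists W => //; exists d.
  + by exists d.
Qed.

Lemma covered_norm (T : L -> {vspace V}) (g : L -> L) :
  (forall c v, (v \in T c) = (e v == 0) && (y2 v == c * g (y1 v))) ->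
  g 0 = 0 -> (forall x, nrm (g x) = nrm x) ->
  covered [set U | exists2 c, nrm c = -1 & U = T c] =
  [set P | flats 0 P /\ forall v, v \in P -> e v = 0 /\ nrm (y2 v) = - nrm (y1 v)].
Proof.
move=> TE g0 gN; have gn0 x : x != 0 -> g x != 0 by rewrite -(nrm_eq0 (g x)) gN nrm_eq0.
apply/seteqP; split=> P.
- move=> [dP [_ [c c1 ->]] /subvP PT]; split=> // v /PT.
  by rewrite TE => /andP[/eqP ev /eqP ->]; split; rewrite // nrmM gN c1 mulN1r.
- move=> [dP Pv]; split=> //; have [v v0 PE] := dimv1_line dP.
  have [ev vN] : e v = 0 /\ nrm (y2 v) = - nrm (y1 v) by apply: Pv; rewrite PE memv_line.
  have y1v : y1 v != 0.
    apply: contraNneq v0 => y1v; apply/eqP/coord_eq0 => //.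
    by apply/eqP; rewrite -nrm_eq0 vN y1v nrm0 oppr0.
  exists (T (y2 v / g (y1 v))); last by rewrite PE -memvE TE ev eqxx divfK ?gn0 //=.
  exists (y2 v / g (y1 v)) => //.
  by rewrite nrmM nrmV gN vN mulNr divff // nrm_eq0.
Qed.

Lemma id_fr2_graph_meet c d : nrm c = -1 -> nrm d = -1 ->
  flats 0 (fr2_graph c :&: id_graph d)%VS.
Proof.
move=> c1 d1; have c0 := nrm_neq0 c1; have d0 := nrm_neq0 d1.
(* A common vector has c y^(q^2) = d y. From y^q = x y follows y^(q^2) = x^q x y, and x^q x = d / c
   since c / d has norm 1. *)
pose x := fr (c / d).
have x1 : nrm x = 1 by rewrite nrm_fr // nrmM nrmV c1 d1 divff // oppr_eq0 oner_eq0.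
have [y y0 yE] := hilbert90 dimL x1.
have xE : c * (fr x * x) = d.
  have : c / d * (fr x * x) = 1 by rewrite -[RHS]x1 /nrm /x !fr3 //; ring.
  by rewrite mulrAC => /divr1_eq.
pose v := iota 0 y (d * y).
suff -> : (fr2_graph c :&: id_graph d)%VS = <[v]>%VS.
  by rewrite /flats /= dim_vline iota_neq0.
have vU : v \in (fr2_graph c :&: id_graph d)%VS.
  rewrite memv_cap mem_fr2_graph mem_id_graph e_iota y1_iota y2_iota !eqxx /=.
  by rewrite yE frM yE [fr x * _]mulrA [c * _]mulrA xE eqxx.
apply/eqP; rewrite eqEsubv -memvE vU andbT; apply/subvP => w.
rewrite memv_cap mem_fr2_graph mem_id_graph => /andP[/andP[/eqP ew /eqP w1] /andP[_ /eqP w2]].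
have [a aE] : exists a : F, y1 w / y = a%:A.
  apply: fr_fixed; rewrite -[RHS](fr3 dimL); congr fr; symmetry; rewrite !frM !frV.
  have h1 : c * fr (fr (y1 w)) = d * y1 w by rewrite -w1.
  have h2 : c * fr (fr y) = d * y.
    by rewrite yE frM yE [fr x * _]mulrA [c * _]mulrA xE.
  apply/eqP; rewrite eqr_div ?fr_eq0 //; apply/eqP/(mulfI c0).
  by rewrite mulrA h1 mulrCA h2; ring.
apply/vlineP; exists a; apply: coord_inj; rewrite linearZ /= ?e_iota ?y1_iota ?y2_iota.
- by rewrite ew scaler0.
- by rewrite -mulr_algl -aE divfK.
- by rewrite w2 -[RHS]mulr_algl -aE mulrCA divfK.
Qed.

Lemma fr2_family_cover : X = fr_family -> is_cover #|F| H SS fr2_family.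
Proof.
move=> XE; have [cardX _ _ covX _] := coverX; split.
(* The number of planes is transferred from X, since both families are indexed by the elements of
   norm -1. *)
- pose C := [set c : L | nrm c = -1].
  have fam (T : L -> {vspace V}) (E : forall c d, T c = T d -> c = d) :
      ([set U | exists2 c, nrm c = -1 & U = T c] #= C)%card.
    have -> : [set U | exists2 c, nrm c = -1 & U = T c] = T @` C.
      by apply/seteqP; split=> U [c c1 UE]; exists c.
    by apply: inj_card_eq => c d _ _ /E.
  apply: card_eq_trans cardX; rewrite XE.
  apply: card_eq_trans (fam fr2_graph _) _ => [c d /eq_graph/(_ 1)|].
    by rewrite /= !fr1 !mulr1.
  rewrite card_eq_sym; apply: fam => c d /eq_graph/(_ 1).
  by rewrite /= !fr1 !mulr1.
- move=> _ [c c1 ->]; split; first exact: dim_graph.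
  by apply/subvP=> v; rewrite mem_fr2_graph eH => /andP[].
- move=> _ _ [c c1 ->] [d d1 ->] cd; apply/eqP; rewrite -subv0; apply/subvP=> v.
  rewrite memv_cap !mem_fr2_graph memv0 => /andP[/andP[/eqP ev /eqP vc] /andP[_]].
  rewrite vc -subr_eq0 -mulrBl mulf_eq0 subr_eq0 !fr_eq0 => /orP[/eqP cd'|/eqP y10].
    by rewrite cd' in cd.
  by apply/eqP/coord_eq0; rewrite // vc y10 !fr0 mulr0.
- have -> : SS = [set U | exists2 c, nrm c = -1 & U = id_graph c].
    by apply/seteqP; split=> U /SSE.
  rewrite (covered_norm (g := idfun)) //; last exact: mem_id_graph.
  rewrite (covered_norm (T := fr2_graph) (g := @fr F L \o @fr F L)) //=.
  + exact: mem_fr2_graph.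
  + by rewrite !fr0.
  + by move=> x; rewrite !nrm_fr.
- by move=> _ W [c c1 ->] /SSE[d d1 ->]; apply: id_fr2_graph_meet.
Qed.

Lemma fr_fr2_family_neq : fr2_family <> fr_family.
Proof.
move=> E; have N1 : nrm (-1 : L) = -1 by rewrite nrmN nrm1.
have : fr2_family (fr2_graph (-1)) by exists (-1).
by rewrite E => -[c c1] /esym; apply: fr_fr2_graph_neq.
Qed.

End Graphs.

Section RowMatrices.
Variable R : comNzRingType.

Definition mx3 (r0 r1 r2 : 'rV[R]_3) : 'M[R]_3 := \matrix_(i < 3) [:: r0; r1; r2]`_i.

Lemma mulmx_mx3 (x r0 r1 r2 : 'rV[R]_3) :
  x *m mx3 r0 r1 r2 = x 0 0 *: r0 + x 0 1 *: r1 + x 0 2 *: r2.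
Proof. by rewrite mulmx_sum_row sum3 !rowK. Qed.

Lemma row3Z (k a b c : R) : k *: row3 a b c = row3 (k * a) (k * b) (k * c).
Proof. by apply: row3P; rewrite !mxE. Qed.

Lemma row3D (a b c a' b' c' : R) : row3 a b c + row3 a' b' c' = row3 (a + a') (b + b') (c + c').
Proof. by apply: row3P; rewrite !mxE. Qed.

Lemma row3_inj (a b c a' b' c' : R) : row3 a b c = row3 a' b' c' -> [/\ a = a', b = b' & c = c'].
Proof.
move=> /matrixP E; have := E 0 0; have := E 0 1; have := E 0 2.
by rewrite !row3E.
Qed.

End RowMatrices.

Lemma mx3_eq1 (R : comNzRingType) (A : 'M[R]_3) :
  (forall a b c, row3 a b c *m A = row3 a b c) -> A = 1%:M.
Proof.
move=> AE; apply/row_matrixP => i; rewrite rowE -row1 rowE mulmx1.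
by rewrite [delta_mx _ _]row3_eta AE.
Qed.

(** * Coordinates adapted to a splash *)

Section Model.
Variables (F : finFieldType) (L : fieldExtType F) (V : vectType F).
Hypothesis dimL : \dim {:L} = 3%N.
Hypothesis dV : \dim {:V} = 7%N.
Variables (H : {vspace V}) (Sp : set {vspace V}) (linf : {vspace 'rV[L]_3}).
Variable beta : {vspace V} -> {vspace 'rV[L]_3}.
Hypotheses (dH : flats 5 H) (dlinf : flats 1 linf).
Hypotheses (planesSp : planes_in H Sp) (disjSp : disjoint_flats Sp).
Hypothesis covSp : covered Sp = [set P | flats 0 P /\ (P <= H)%VS].
Hypothesis betaP : bruck_bose H Sp linf beta.

Lemma rmorph_fr (s : {rmorphism L -> L}) x : s (fr x) = fr (s x).
Proof. by rewrite !fr_def rmorphXn. Qed.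

Lemma rmorph_nrm (s : {rmorphism L -> L}) x : nrm (s x) = s (nrm x).
Proof. by rewrite /nrm !rmorphM /= !rmorph_fr. Qed.

(** The automorphism [s] appears because [beta] is only semilinear: y1 and y2 are [F]-linear, and
    the image has their values moved by [s] as coordinates. *)
Definition coordinates (M : 'M[L]_3) (s : {rmorphism L -> L}) (e : {linear V -> F^o})
    (y1 y2 : {linear V -> L}) (iota : F -> L -> L -> V) : Prop :=
  [/\ M \in unitmx /\ line_at_infinity linf M,
      bijective s,
      (forall x a b, [/\ e (iota x a b) = x, y1 (iota x a b) = a & y2 (iota x a b) = b]) /\
      (forall v, iota (e v) (y1 v) (y2 v) = v),
      forall v, (v \in H) = (e v == 0) &
      (forall v, v \notin H ->
        beta <[v]> = <[row3 (s (e v : F)%:A) (s (y1 v)) (s (y2 v)) *m M]>%VS) /\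
      (forall U, Sp U -> forall u, u \in U -> u != 0 ->
        beta U = <[row3 0 (s (y1 u)) (s (y2 u)) *m M]>%VS)].

Lemma coordinates_exist (M' : 'M[L]_3) : M' \in unitmx -> line_at_infinity linf M' ->
  exists c, c != 0 /\ exists s e y1 y2 iota, coordinates (c *: M') s e y1 y2 iota.
Proof.
move=> MU lM.
have d3 : \dim {: 'rV[L]_3} = 3%N by rewrite dimvf /dim /= mul1n.
have [s [Psi [sbij [PsiP PsiH Psi0 Psiaff Psiinf]]]] :=
  semilinear_coordinates dV d3 dH dlinf planesSp disjSp covSp betaP.
have [f [v1 [fH fv1]]] := hyperplane_functional (etrans (congr1 S dH) (esym dV)).
have f0 v : (f v == 0) = (v \in H) by rewrite -fH memv_ker.
have [x [xM xP]] : exists x : V -> 'rV[L]_3, (forall v, x v *m M' = Psi v) /\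
    forall a u v, x (a *: u + v) = s a%:A *: x u + x v.
  exists (fun v => Psi v *m invmx M'); split=> [v|a u v]; first by rewrite mulmxKV.
  by rewrite PsiP mulmxDl scalemxAl.
have x0H v : (x v 0 0 == 0) = (v \in H) by rewrite -lM xM PsiH.
(* The first coordinate of the image vanishes exactly on H, so it is s(f v) times a constant;
   scaling M' by this constant absorbs it. *)
set c := x v1 0 0.
have c0 : c != 0 by rewrite x0H -f0 fv1 oner_neq0.
exists c; split=> //.
have [t st ts] := sbij.
have sinj := can_inj st.
have ylin i : linear (fun v => t (c^-1 * x v 0 i)).
  move=> a u v; apply: sinj; rewrite ts xP !mxE -[a *: t _]mulr_algl rmorphD rmorphM /= !ts.
  by ring.
pose y i : {linear V -> L} := HB.pack (fun v => t (c^-1 * x v 0 i))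
  (GRing.isLinear.Build F V L *:%R _ (ylin i)).
have so1 (k : F) : k *: (1 : F^o) = k := mulr1 k.
have y0E v : y 0 v = (f v : F)%:A.
  apply: sinj; rewrite /= ts.
  have := x0H (- f v *: v1 + v); rewrite -f0 linearP /= fv1.
  rewrite so1 addNr eqxx xP !mxE scaleNr rmorphN mulNr addrC subr_eq0.
  by move/eqP => ->; rewrite -/c mulrCA mulVf // mulr1.
pose e : {linear V -> F^o} := f.
have PsiE v : Psi v = row3 (s (e v : F)%:A) (s (y 1 v)) (s (y 2 v)) *m (c *: M').
  rewrite -y0E /= !ts -scalemxAr scalemxAl row3Z !mulrA !divff // !mul1r -row3_eta.
  by rewrite xM.
have inj v : e v = 0 -> y 1 v = 0 -> y 2 v = 0 -> v = 0.
  move=> ev v1' v2'; apply: Psi0; rewrite PsiE ev v1' v2' scale0r !rmorph0.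
  have -> : row3 0 0 0 = 0 :> 'rV[L]_3 by apply: row3P; rewrite !mxE.
  by rewrite mul0mx.
have cM' : c *: M' \in unitmx by rewrite unitmxZ // unitfE.
pose h v : (F^o * L * L)%type := (e v, y 1 v, y 2 v).
have hlin : linear h by move=> a u v; rewrite /h !linearP.
pose h' : {linear V -> (F^o * L * L)%type} := HB.pack h (GRing.isLinear.Build F V _ *:%R _ hlin).
have hsurj : limg (linfun h') = fullv.
  apply/eqP; rewrite eqEdim subvf limg_dim_eq.
    have dL : dim L = 3%N by rewrite -dimvf dimL.
    by rewrite dV dimvf /= -[dim _]/(1 + dim L + dim L)%N dL.
  apply/eqP; rewrite -subv0; apply/subvP => v; rewrite memv_cap memv_ker lfunE /=.
  by move=> /andP[_ /eqP [e0 e1 e2]]; rewrite memv0; apply/eqP/inj.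
have hs x' a b : exists v, [/\ e v = x', y 1 v = a & y 2 v = b].
  have /memv_imgP[v _] : (x', a, b) \in limg (linfun h') by rewrite hsurj memvf.
  by rewrite lfunE /= => -[-> -> ->]; exists v.
have /choice [io ioP] : forall p : F * L * L, exists v,
    [/\ e v = p.1.1, y 1 v = p.1.2 & y 2 v = p.2].
  by move=> [[x' a] b]; apply: hs.
exists s, e, (y 1), (y 2), (fun x' a b => io (x', a, b)); split=> //.
- split=> // x'; rewrite -scalemxAr.
  have -> : (c *: (x' *m M') \in linf) = (x' *m M' \in linf).
    by apply/idP/idP => [|xl]; [rewrite -{2}(scalerK c0 (x' *m M')); apply: memvZ|apply: memvZ].
  exact: lM.
- split=> [x' a b|v]; first exact: (ioP (x', a, b)).
  apply/eqP; rewrite -subr_eq0; apply/eqP; have [/= E0 E1 E2] := ioP (e v, y 1 v, y 2 v).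
  by apply: inj; rewrite linearB /= ?E0 ?E1 ?E2 subrr.
- by move=> v; rewrite -f0.
- split=> [v /Psiaff ->|U SU u uU u0]; first by rewrite PsiE.
  have eu : e u = 0 by apply/eqP; rewrite f0; have [_ /subvP UH] := planesSp SU; exact: UH.
  by rewrite (Psiinf U SU u) // PsiE eu scale0r rmorph0.
Qed.

Lemma fr_subplaneZ (c : L) M : c != 0 -> fr_subplane (c *: M) = fr_subplane M.
Proof.
move=> c0; apply/seteqP; split=> P [t t0 ->]; exists t => //;
  by rewrite -scalemxAr vlineZ.
Qed.

Lemma row3_line_eq (M : 'M[L]_3) (a b a' b' : L) : M \in unitmx -> a != 0 ->
  <[row3 0 a b *m M]>%VS = <[row3 0 a' b' *m M]>%VS ->
  exists2 k, k != 0 & a = k * a' /\ b = k * b'.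
Proof.
move=> MU a0; have r0 : row3 0 a b *m M != 0.
  rewrite mulmx_unit_eq0 //; apply: contraNneq a0 => /matrixP/(_ 0 1).
  by rewrite !mxE /= => ->.
move=> /(vline_eqP _ r0)[k k0]; rewrite scalemxAl => /(can_inj (mulmxK MU)).
by rewrite row3Z => /row3_inj[_ -> ->]; exists k.
Qed.

Lemma splash_coordinates M s e y1 y2 iota pi : coordinates M s e y1 y2 iota ->
  (forall P, splash linf pi P <->
     exists a b, [/\ a != 0, nrm b = - nrm a & P = <[row3 0 a b *m M]>%VS]) ->
  forall U, (Sp U /\ splash linf pi (beta U)) <->
    exists2 c, nrm c = -1 & U = id_graph iota c.
Proof.
move=> [[MU lM] sbij [iotaK iotaE] eH [_ binf]] splE.
have [t st ts] := sbij; have sinj := can_inj st.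
have fwd U u : Sp U -> splash linf pi (beta U) -> u \in U -> u != 0 ->
    y1 u != 0 /\ nrm (y2 u) = - nrm (y1 u).
  move=> SU /splE[a [b [a0 bN E]]] uU u0; move: E; rewrite (binf U SU u uU u0).
  move/esym/(row3_line_eq MU a0) => [k k0 [aE bE]].
  have y10 : y1 u != 0.
    by apply: contraNneq a0 => y10; rewrite aE y10 rmorph0 mulr0.
  split=> //; apply: sinj; rewrite -rmorph_nrm rmorphN -rmorph_nrm.
  apply: (@mulfI _ (nrm k)); first by rewrite nrm_eq0.
  by rewrite mulrN -!nrmM -aE -bE.
have sub U c u : Sp U -> u \in U -> u != 0 -> y1 u != 0 -> y2 u = c * y1 u ->
    U = id_graph iota c.
  move=> SU uU u0 y10 uc; have [dU /subvP UH] := planesSp SU.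
  apply/eqP; rewrite eqEdim dU (dim_graph dimL iotaK iotaE) leqnn andbT; apply/subvP=> v vU.
  have := UH _ vU; rewrite eH (mem_id_graph iotaK iotaE) => ->.
  have [->|v0] := eqVneq v 0; first by rewrite !linear0 mulr0 eqxx.
  have := binf U SU u uU u0; rewrite (binf U SU v vU v0) => /esym.
  have sy1 : s (y1 u) != 0 by rewrite fmorph_eq0.
  move=> /(row3_line_eq MU sy1) [k k0 [E1 E2]] /=.
  apply/eqP/sinj/(mulfI k0); rewrite rmorphM mulrCA -E1 -E2.
  by rewrite uc rmorphM.
move=> U; split=> [[SU sU]|[c c1 ->]].
- have U0 : U != 0%VS by rewrite -dimv_eq0; case: (planesSp SU) => ->.
  have pU := memv_pick U; have p0 : vpick U != 0 by rewrite vpick0.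
  have [y10 N] := fwd U _ SU sU pU p0.
  exists (y2 (vpick U) / y1 (vpick U)).
    by rewrite nrmM nrmV N mulNr divff // nrm_eq0.
  by apply: (sub U _ (vpick U)); rewrite // divfK.
- pose u := iota 0 1 c.
  have [eu yu1 yu2] := iotaK 0 1 c.
  have u0 : u != 0 by apply: (iota_neq0 iotaK); rewrite ?oner_neq0.
  have uH : u \in H by rewrite eH eu.
  have [W SW uW] := spread_cover covSp uH u0.
  have -> : id_graph iota c = W.
    by apply/esym/(sub W c u) => //; rewrite /u ?yu1 ?yu2 ?oner_neq0 ?mulr1.
  split=> //; apply/splE; exists 1, (s c); rewrite oner_neq0; split=> //.
    by rewrite rmorph_nrm c1 rmorphN rmorph1 nrm1.
  by rewrite (binf W SW u uW u0) yu1 yu2 rmorph1.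
Qed.

Definition swap_mx : 'M[L]_3 := mx3 (row3 1 0 0) (row3 0 0 1) (row3 0 1 0).

Lemma mulmx_swap (a b c : L) : row3 a b c *m swap_mx = row3 a c b.
Proof.
rewrite mulmx_mx3 !row3E !row3Z !row3D.
by rewrite !(mulr0, mulr1, addr0, add0r).
Qed.

Lemma swap_mxK : swap_mx *m swap_mx = 1%:M.
Proof. by apply: mx3_eq1 => a b c; rewrite mulmxA !mulmx_swap. Qed.

Lemma coordinates_swap M s e y1 y2 iota : coordinates M s e y1 y2 iota ->
  coordinates (swap_mx *m M) s e y2 y1 (fun x a b => iota x b a).
Proof.
have [swU _] := mulmx1_unit swap_mxK.
move=> [[MU lM] sbij [iotaK iotaE] eH [baff binf]]; split=> //.
- split; first by rewrite unitmx_mul swU.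
  by move=> x; rewrite mulmxA lM (row3_eta x) mulmx_swap !row3E.
- by split=> [x a b|v]; rewrite ?iotaE //; case: (iotaK x b a).
- split=> [v /baff ->|U SU u uU u0]; first by rewrite mulmxA mulmx_swap.
  by rewrite mulmxA mulmx_swap; apply: binf.
Qed.

End Model.

Lemma adapted_coordinates (F : finFieldType) (L : fieldExtType F)
    (H : {vspace 'rV[F]_7}) (Sp SS X : set {vspace 'rV[F]_7})
    (linf : {vspace 'rV[L]_3}) (beta : {vspace 'rV[F]_7} -> {vspace 'rV[L]_3}) :
  (3 <= #|F|)%N -> \dim {:L} = 3%N -> flats 5 H -> flats 1 linf ->
  planes_in H Sp -> disjoint_flats Sp ->
  covered Sp = [set P | flats 0 P /\ (P <= H)%VS] ->
  bruck_bose H Sp linf beta ->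
  exterior_splash Sp linf beta SS -> is_cover #|F| H SS X ->
  exists M s e y1 y2 iota, [/\ coordinates H Sp linf beta M s e y1 y2 iota,
    forall U, SS U <-> exists2 c, nrm c = -1 & U = id_graph iota c &
    X = fr_family iota].
Proof.
move=> F3 dimL dH dlinf planesSp disjSp covSp betaP [pi extpi SSpi] coverX.
have dV : \dim {: 'rV[F]_7} = 7%N by rewrite dimvf /dim /= mul1n.
have [M' [MU' lM' piE]] := exterior_subplane_normal_form dimL dlinf extpi.
have [c [c0 [s [e [y1 [y2 [iota coo]]]]]]] :=
  coordinates_exist dimL dV dH dlinf planesSp disjSp covSp betaP MU' lM'.
have [[MU lM] sbij [iotaK iotaE] eH beta_coo] := coo.
have SSE U : SS U <-> exists2 c, nrm c = -1 & U = id_graph iota c.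
  rewrite SSpi; apply: (splash_coordinates dimL planesSp covSp coo) => P.
  rewrite piE -(fr_subplaneZ M' c0); exact: splash_fr_subplane.
have [XE|XE] := cover_classification dimL iotaK iotaE F3 eH SSE coverX.
  by exists (c *: M'), s, e, y1, y2, iota.
have coo' := coordinates_swap coo; have [_ _ [iotaK' iotaE'] _ _] := coo'.
exists (swap_mx L *m (c *: M')), s, e, y2, y1, (fun x a b => iota x b a); split=> //.
- move=> U; rewrite SSE; split=> -[d d1 ->]; exists d^-1; rewrite ?nrmV ?d1 ?invrN ?invr1 //;
    apply/vspaceP => v; rewrite (mem_id_graph iotaK iotaE) (mem_id_graph iotaK' iotaE');
    congr andb; have d0 := nrm_neq0 d1;
    by apply/eqP/eqP => ->; rewrite ?mulKf ?mulVKf.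
(* Solving y2 = d y1^(q^2) for y1 gives y1 = (1/d)^q y2^q, again with a factor of norm -1. *)
- rewrite XE; apply/seteqP; split=> U [d d1 ->]; have d0 := nrm_neq0 d1.
  + exists (fr d^-1); first by rewrite nrm_fr // nrmV d1 invrN invr1.
    apply/vspaceP => v; rewrite (mem_fr2_graph iotaK iotaE) (mem_fr_graph iotaK' iotaE').
    congr andb.
    apply/eqP/eqP => ->; first by rewrite !frE fr3 // mulKf ?fr_eq0.
    by rewrite !frE !fr3 // mulVKf.
  + exists (fr (fr d^-1)); first by rewrite !nrm_fr // nrmV d1 invrN invr1.
    apply/vspaceP => v; rewrite (mem_fr2_graph iotaK iotaE) (mem_fr_graph iotaK' iotaE').
    congr andb.
    apply/eqP/eqP => ->; first by rewrite !frE fr3 // mulKf ?fr_eq0.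
    by rewrite !frE !fr3 // mulVKf.
Qed.

(** * Special twisted cubics *)

Section CubicForms.
Variable K : fieldType.

Definition cform (p : 'I_4 -> K) (s t : K) : K :=
  s ^+ 3 * p 0 + s ^+ 2 * t * p 1 + s * t ^+ 2 * p 2 + t ^+ 3 * p 3.

Lemma sum4 (M : nmodType) (f : 'I_4 -> M) : \sum_j f j = f 0 + f 1 + f 2 + f 3.
Proof.
rewrite !big_ord_recl big_ord0 addr0 !addrA.
by congr (f _ + f _ + f _ + f _); apply: val_inj.
Qed.

Lemma cubic_rowE (s t : K) : ((cubic_row s t 0 0 = s ^+ 3) *
  (cubic_row s t 0 1 = (s ^+ 2 * t)%R) * (cubic_row s t 0 2 = (s * t ^+ 2)%R) *
  (cubic_row s t 0 3 = t ^+ 3))%type.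
Proof. by rewrite !mxE /= ?expr0 ?mulr1 ?mul1r ?expr1. Qed.

Lemma cform_sum p s t : cform p s t = \sum_j cubic_row s t 0 j * p j.
Proof. by rewrite sum4 !cubic_rowE. Qed.

(** The cofactor of (t - s a)(t - s b) is a linear form, written here in the basis t - s a, t - s c.
    When a, b, c are the conjugates of z, the second term is a multiple of N(t - s z). *)
Lemma cform_two_roots p (a b c : K) : a != b -> a != c ->
  cform p 1 a = 0 -> cform p 1 b = 0 ->
  exists x y, forall s t, cform p s t =
    x * (t - s * a) ^+ 2 * (t - s * b) + y * ((t - s * a) * (t - s * b) * (t - s * c)).
Proof.
move=> nab nac ea eb.
pose l1 := p 3; pose l0 := p 2 + p 3 * (a + b).
pose r1 := p 1 - (a * b * l1 - (a + b) * l0); pose r0 := p 0 - a * b * l0.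
have ra : r0 + r1 * a = 0.
  by rewrite -[RHS]ea /cform /r0 /r1 /l0 /l1; ring.
have rb : r0 + r1 * b = 0.
  by rewrite -[RHS]eb /cform /r0 /r1 /l0 /l1; ring.
have r10 : r1 = 0.
  apply/eqP; rewrite -(mulrI_eq0 _ (@lregP _ (a - b) _)) ?subr_eq0 //.
  by apply/eqP; rewrite -[RHS](subrr 0) -{1}ra -rb; ring.
have r00 : r0 = 0 by move: ra; rewrite r10 mul0r addr0.
have p0E : p 0 = a * b * l0 by apply/eqP; rewrite -subr_eq0 -/r0 r00.
have p1E : p 1 = a * b * l1 - (a + b) * l0 by apply/eqP; rewrite -subr_eq0 -/r1 r10.
have p2E : p 2 = l0 - l1 * (a + b) by rewrite /l0 addrK.
pose x := (l0 + l1 * c) / (c - a).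
have xE : x * (c - a) = l0 + l1 * c by rewrite divfK // subr_eq0 eq_sym.
exists x, (l1 - x) => s t; rewrite /cform p0E p1E p2E -/l1.
transitivity ((t - s * a) * (t - s * b) * (l1 * (t - s * c) + s * (l0 + l1 * c))).
  by ring.
by rewrite -xE; ring.
Qed.

Lemma cform_three_roots p (a b c : K) : a != b -> a != c -> b != c ->
  cform p 1 a = 0 -> cform p 1 b = 0 -> cform p 1 c = 0 -> forall s t,
  cform p s t = p 3 * ((t - s * a) * (t - s * b) * (t - s * c)).
Proof.
move=> nab nac nbc ea eb ec; have [x [y E]] := cform_two_roots nab nac ea eb.
have x0 : x = 0.
  have nz : (c - a) ^+ 2 * (c - b) != 0.
    by rewrite mulf_neq0 ?expf_neq0 // subr_eq0 eq_sym.
  have /eqP := E 1 c; rewrite ec !mul1r subrr !mulr0 addr0 eq_sym -mulrA.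
  by rewrite mulf_eq0 (negPf nz) orbF => /eqP.
have yE : y = p 3.
  by have := E 0 1; rewrite /cform x0 !mul0r !subr0 !expr0n /= !mul0r !add0r !expr1n !mul1r !mulr1.
by move=> s t; rewrite E x0 yE !mul0r add0r.
Qed.
Lemma cformD (p q : 'I_4 -> K) s t : cform (fun j => p j + q j) s t = cform p s t + cform q s t.
Proof. by rewrite /cform; ring. Qed.

Lemma cformZ (c : K) (p : 'I_4 -> K) s t : cform (fun j => c * p j) s t = c * cform p s t.
Proof. by rewrite /cform; ring. Qed.

Lemma eq_cform (p q : 'I_4 -> K) a b : p =1 q -> cform p a b = cform q a b.
Proof. by move=> pq; rewrite /cform !pq. Qed.

Lemma cform_scale (p : 'I_4 -> K) s t : s != 0 ->
  cform p s t = s ^+ 3 * cform p 1 (t / s).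
Proof. by move=> s0; rewrite /cform; field. Qed.

Lemma row_free_cubic m (A : 'M[K]_(4, m)) s t : row_free A ->
  cubic_row s t *m A = 0 -> s = 0 /\ t = 0.
Proof.
move=> fA /eqP; rewrite mulmx_free_eq0 // => /eqP/matrixP r0.
have := r0 0 0; have := r0 0 3; rewrite !cubic_rowE !mxE => /eqP + /eqP.
by rewrite !expf_eq0 /= => /eqP -> /eqP ->.
Qed.

Lemma cubic_dsE (R : comNzRingType) (a b : R) : ((cubic_ds a b 0 0 = (3%:R * a ^+ 2)%R) *
  (cubic_ds a b 0 1 = (2%:R * (a * b))%R) * (cubic_ds a b 0 2 = (b ^+ 2)%R) *
  (cubic_ds a b 0 3 = 0))%type.
Proof.
have entry (i : 'I_4) k : nat_of_ord i = k ->
    cubic_ds a b 0 i = a ^+ (3 - k).-1 * b ^+ k *+ (3 - k).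
  by move=> <-; rewrite mxE.
rewrite (entry 0 0%N) // (entry 1 1%N) // (entry 2 2%N) // (entry 3 3%N) //= !mulr_natl.
by rewrite expr0 mulr1 mul1r.
Qed.

Lemma cubic_dtE (R : comNzRingType) (a b : R) : ((cubic_dt a b 0 0 = 0) *
  (cubic_dt a b 0 1 = (a ^+ 2)%R) * (cubic_dt a b 0 2 = (2%:R * (a * b))%R) *
  (cubic_dt a b 0 3 = (3%:R * b ^+ 2)%R))%type.
Proof.
have entry (i : 'I_4) k : nat_of_ord i = k -> cubic_dt a b 0 i = a ^+ (3 - k) * b ^+ k.-1 *+ k.
  by move=> <-; rewrite mxE.
rewrite (entry 0 0%N) // (entry 1 1%N) // (entry 2 2%N) // (entry 3 3%N) //= !mulr_natl.
by rewrite mulr0n mulr1n !expr0 mulr1 mul1r.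
Qed.

End CubicForms.

(** * Conjugate coordinates on the cubic extension *)

Section ExtendedFunctionals.
Variables (F : finFieldType) (L : fieldExtType F) (n : nat).
Hypothesis dimL : \dim {:L} = 3%N.
Local Notation emb := (map_mx (in_alg L)).

(* The L-linear extension of an F-linear g : F^n -> L. *)
Definition ext (g : 'rV[F]_n -> L) (w : 'rV[L]_n) : L^o :=
  \sum_j w 0 j * g (delta_mx 0 j).

Lemma ext_linear g : linear (ext g).
Proof.
move=> a v w; rewrite /ext scaler_sumr -big_split; apply: eq_bigr => j _ /=.
by rewrite !mxE mulrDl -[a *: _]/(a * _) mulrA.
Qed.

HB.instance Definition _ g := GRing.isLinear.Build L 'rV[L]_n L^o *:%R (ext g) (ext_linear g).

Lemma ext_emb (g : {linear 'rV[F]_n -> L}) v : ext g (emb v) = g v.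
Proof.
rewrite [in RHS](row_sum_delta v) linear_sum; apply: eq_bigr => j _.
by rewrite linearZ mxE mulr_algl.
Qed.

Lemma ext_cubic (g : {linear 'rV[F]_n -> L}) (A : 'M[F]_(4, n)) s t :
  ext g (cubic_row s t *m emb A) = cform (fun j => g (row j A)) s t.
Proof.
rewrite mulmx_sum_row linear_sum cform_sum; apply: eq_bigr => j _.
by rewrite linearZ /= -map_row ext_emb.
Qed.

Lemma linear_cubic (g : {linear 'rV[F]_n -> L}) (A : 'M[F]_(4, n)) (s t : F) :
  g (cubic_row s t *m A) = cform (fun j => g (row j A)) s%:A t%:A.
Proof.
rewrite mulmx_sum_row linear_sum cform_sum; apply: eq_bigr => j _.
rewrite linearZ /= -[LHS]mulr_algl; congr (_ * _).
by rewrite -[LHS]/(in_alg L _) !mxE rmorphM !rmorphXn.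
Qed.

Lemma basis_decomposition u (w : 'rV[L]_n) : rational_free u ->
  exists v : 'I_3 -> 'rV[F]_n, w = \sum_k u k 0 *: emb (v k).
Proof.
move=> ufree; have /choice [c cE] : forall j, exists c : 'rV[F]_3, theta u c = w 0 j.
  by move=> j; apply: theta_surj.
exists (fun k => \row_j c j 0 k); apply/rowP => j; rewrite -cE /theta summxE.
by apply: eq_bigr => k _; rewrite !mxE mulr_algr.
Qed.

Lemma ext_sum_emb (g : {linear 'rV[F]_n -> L}) r (v : 'I_3 -> 'rV[F]_n) :
  ext g (\sum_k r k *: emb (v k)) = \sum_k r k * g (v k).
Proof. by rewrite linear_sum; apply: eq_bigr => k _; rewrite linearZ /= ext_emb. Qed.

(** After a suitable power of Frobenius is applied to each equation, the three say that the row of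
    the g(v_k) times the invertible Moore matrix of u is zero. *)
Lemma ext_conj_eq0 u (v : 'I_3 -> 'rV[F]_n) (g : {linear 'rV[F]_n -> L}) w :
  rational_free u -> w = \sum_k u k 0 *: emb (v k) ->
  ext g w = 0 -> ext (@fr F L \o g) w = 0 -> ext (@fr F L \o @fr F L \o g) w = 0 ->
  forall k, g (v k) = 0.
Proof.
move=> ufree wE; rewrite wE.
rewrite !ext_sum_emb.
move=> e0 e1 e2; pose c : 'rV[L]_3 := \row_k g (v k).
have : c *m moore u = 0.
  apply: row3P; rewrite mulmx_moore row3E [RHS]mxE.
  - by rewrite -[RHS]e0; apply: eq_bigr => k _; rewrite mxE mulrC.
  - have := congr1 (@fr F L) e2; rewrite fr0 => e; rewrite -[RHS]e rmorph_sum.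
    by apply: eq_bigr => k _; rewrite mxE /= !frE fr3 // mulrC.
  - have := congr1 (fun x => fr (fr x)) e1; rewrite !fr0 => e; rewrite -[RHS]e.
    rewrite (rmorph_sum (@fr F L)) /= (rmorph_sum (@fr F L)) /=.
    by apply: eq_bigr => k _; rewrite mxE /= !frE fr3 // mulrC.
move=> /eqP; rewrite mulmx_unit_eq0 ?moore_unit // => /eqP c0 k.
by have := congr1 (fun x : 'rV_3 => x 0 k) c0; rewrite !mxE.
Qed.

Lemma mem_extend (U : {vspace 'rV[F]_n}) u : u \in U -> emb u \in extend L U.
Proof.
move=> uU; rewrite (coord_vbasis uU) raddf_sum /= memv_suml // => i _.
rewrite map_mxZ memvZ // memv_span // map_f // mem_nth // size_tuple //.
Qed.

Lemma extend_kernel (U : {vspace 'rV[F]_n}) (f : {linear 'rV[L]_n -> L^o}) :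
  (forall u, u \in U -> f (emb u) = 0) -> forall w, w \in extend L U -> f w = 0.
Proof.
move=> fU w; suff : (extend L U <= lker (linfun f))%VS.
  by move/subvP => /[apply]; rewrite memv_ker lfunE => /eqP.
apply/span_subvP => _ /mapP[u uU ->]; rewrite memv_ker lfunE /= fU //.
exact: vbasis_mem.
Qed.

End ExtendedFunctionals.

Section LiftFunctional.
Variables (F : finFieldType) (L : fieldExtType F) (V : lmodType F).
Variable e : {linear V -> F^o}.

Definition lift_functional (v : V) : L := (e v : F)%:A.

Lemma lift_functional_linear : linear lift_functional.
Proof.
move=> a u v; rewrite /lift_functional linearP /= scalerDl.
by rewrite -[a *: (e u : F^o)]/(a * e u) -scalerA.
Qed.

HB.instance Definition _ := GRing.isLinear.Build F V L *:%R lift_functional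
  lift_functional_linear.

End LiftFunctional.

Section Cubics.
Variables (F : finFieldType) (L : fieldExtType F).
Hypothesis dimL : \dim {:L} = 3%N.
Local Notation emb := (map_mx (in_alg L)).
Variables (e : {linear 'rV[F]_7 -> F^o}) (y1 y2 : {linear 'rV[F]_7 -> L}).
Variable iota : F -> L -> L -> 'rV[F]_7.
Hypothesis iotaK : forall x a b,
  [/\ e (iota x a b) = x, y1 (iota x a b) = a & y2 (iota x a b) = b].
Hypothesis iotaE : forall v, iota (e v) (y1 v) (y2 v) = v.
Variable H : {vspace 'rV[F]_7}.
Hypothesis eH : forall v, (v \in H) = (e v == 0).

Let eL : {linear 'rV[F]_7 -> L} := lift_functional L e.
Local Notation cj1 g := (@fr F L \o g : {linear 'rV[F]_7 -> L}).
Local Notation cj2 g := (@fr F L \o @fr F L \o g : {linear 'rV[F]_7 -> L}).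

Lemma eL_eq0 v : (eL v == 0) = (e v == 0).
Proof. exact: alg_eq0. Qed.

(** The seven functionals separate points of L^7: over a basis of [L], w has rational components,
    and e, y1, y2 vanish on each of them. *)
Lemma ext_separation w : ext eL w = 0 ->
  ext y1 w = 0 -> ext (cj1 y1) w = 0 -> ext (cj2 y1) w = 0 ->
  ext y2 w = 0 -> ext (cj1 y2) w = 0 -> ext (cj2 y2) w = 0 -> w = 0.
Proof.
have [z nz] := fr_nontrivial dimL; have ufree := rational_free_powers dimL nz.
have [v wE] := basis_decomposition dimL w ufree.
move=> e0 a0 a1 a2 b0 b1 b2.
have y1v := ext_conj_eq0 dimL ufree wE a0 a1 a2.
have y2v := ext_conj_eq0 dimL ufree wE b0 b1 b2.
have ev k : e (v k) = 0.
  have /ufree/matrixP/(_ 0 k) : theta (\col_j z ^+ j) (\row_k (e (v k) : F)) = 0.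
    rewrite -[RHS]e0 wE ext_sum_emb.
    by apply: eq_bigr => k' _; rewrite mxE /= mulr_algr.
  by rewrite !mxE.
rewrite wE big1 // => k _.
by rewrite (coord_eq0 iotaE (ev k) (y1v k) (y2v k)) map_mx0 scaler0.
Qed.

Lemma mem_extend_sum (U : {vspace 'rV[F]_7}) (r : 'I_3 -> L) v :
  (forall k, v k \in U) -> \sum_k r k *: emb (v k) \in extend L U.
Proof. by move=> vU; apply: memv_suml => k _; rewrite memvZ // mem_extend. Qed.

(* The line meeting the extended planes of the family in the points whose only
   nonzero coordinates are the second conjugate of y1 and the first of y2. *)
Lemma transversal_of_fr_family : exists g : {vspace 'rV[L]_7},
  transversal_line H (fr_family iota) g /\
  forall w, w \in g -> [/\ ext eL w = 0, ext y1 w = 0, ext (cj1 y1) w = 0,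
     ext y2 w = 0 & ext (cj2 y2) w = 0].
Proof.
have [z nz] := fr_nontrivial dimL; have ufree := rational_free_powers dimL nz.
set u := \col_j z ^+ j in ufree; have mU := moore_unit dimL ufree.
(* Weights that prescribe the three sums of r_k u_k^(q^j); they allow a point with a single nonzero
   conjugate coordinate to be written down. *)
have dual (x : 'rV[L]_3) : exists r : 'I_3 -> L,
    [/\ \sum_k r k * u k 0 = x 0 0, \sum_k r k * fr (u k 0) = x 0 1 &
        \sum_k r k * fr (fr (u k 0)) = x 0 2].
  exists (fun k => (x *m invmx (moore u)) 0 k).
  have := mulmx_moore u (x *m invmx (moore u)); rewrite mulmxKV // => xE.
  by split; rewrite [in RHS]xE !row3E.
have [r [r0 r1 r2]] := dual (row3 0 0 1); have [r' [r'0 r'1 r'2]] := dual (row3 0 1 0).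
rewrite !row3E in r0 r1 r2 r'0 r'1 r'2.
pose DY := \sum_k r k *: emb (iota 0 (u k 0) 0).
pose DZ := \sum_k r' k *: emb (iota 0 0 (u k 0)).
have sum0 (h : 'I_3 -> L) (k : 'I_3 -> L) : (forall i, k i = 0) -> \sum_i h i * k i = 0.
  by move=> k0; rewrite big1 // => i _; rewrite k0 mulr0.
have coDY : [/\ ext eL DY = 0, [/\ ext y1 DY = 0, ext (cj1 y1) DY = 0 & ext (cj2 y1) DY = 1] &
    [/\ ext y2 DY = 0, ext (cj1 y2) DY = 0 & ext (cj2 y2) DY = 0]].
  rewrite /DY !ext_sum_emb; split; [|split|split].
  - by apply: sum0 => k; rewrite /= /lift_functional (e_iota iotaK) scale0r.
  - by rewrite -[RHS]r0; apply: eq_bigr => k _; rewrite (y1_iota iotaK).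
  - by rewrite -[RHS]r1; apply: eq_bigr => k _; rewrite /= (y1_iota iotaK).
  - by rewrite -[RHS]r2; apply: eq_bigr => k _; rewrite /= (y1_iota iotaK).
  - by apply: sum0 => k; rewrite (y2_iota iotaK).
  - by apply: sum0 => k; rewrite /= (y2_iota iotaK) !fr0.
  - by apply: sum0 => k; rewrite /= (y2_iota iotaK) !fr0.
have coDZ : [/\ ext eL DZ = 0, [/\ ext y1 DZ = 0, ext (cj1 y1) DZ = 0 & ext (cj2 y1) DZ = 0] &
    [/\ ext y2 DZ = 0, ext (cj1 y2) DZ = 1 & ext (cj2 y2) DZ = 0]].
  rewrite /DZ !ext_sum_emb; split; [|split|split].
  - by apply: sum0 => k; rewrite /= /lift_functional (e_iota iotaK) scale0r.
  - by apply: sum0 => k; rewrite (y1_iota iotaK).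
  - by apply: sum0 => k; rewrite /= (y1_iota iotaK) !fr0.
  - by apply: sum0 => k; rewrite /= (y1_iota iotaK) !fr0.
  - by rewrite -[RHS]r'0; apply: eq_bigr => k _; rewrite (y2_iota iotaK).
  - by rewrite -[RHS]r'1; apply: eq_bigr => k _; rewrite /= (y2_iota iotaK).
  - by rewrite -[RHS]r'2; apply: eq_bigr => k _; rewrite /= (y2_iota iotaK).
have [DYe [DY0 DY1 DY2] [DY3 DY4 DY5]] := coDY.
have [DZe [DZ0 DZ1 DZ2] [DZ3 DZ4 DZ5]] := coDZ.
have in_g w : w \in (<[DY]> + <[DZ]>)%VS -> [/\ ext eL w = 0, ext y1 w = 0,
    ext (cj1 y1) w = 0, ext y2 w = 0 & ext (cj2 y2) w = 0].
  move=> /memv_addP[_ /vlineP[a ->] [_ /vlineP[b ->] ->]].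
  rewrite !linearP /= ![ext _ (b *: _)]linearZ /=.
  by rewrite DYe DZe DY0 DZ0 DY1 DZ1 DY3 DZ3 DY5 DZ5 !scaler0 !addr0.
have one_neq0 : (1 : L^o) != 0 := oner_neq0 L.
have DYn : DY != 0 by apply: contra_eq_neq DY2 => ->; rewrite linear0 eq_sym.
have DZn : DZ != 0 by apply: contra_eq_neq DZ4 => ->; rewrite linear0 eq_sym.
exists (<[DY]> + <[DZ]>)%VS; split=> //; split.
- apply: dim_add_lines; rewrite ?dim_vline ?DYn ?DZn //.
  move/(vline_eqP _ DYn) => [a a0 E]; have := congr1 (ext (cj2 y1)) E.
  by rewrite linearZ /= DZ2 DY2 scaler0 => /eqP; rewrite (negPf one_neq0).
- rewrite subv_add -!memvE; apply/andP; split; apply: mem_extend_sum => k;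
    by rewrite eH (e_iota iotaK).
- move=> v /in_g []; rewrite !ext_emb => ev y1v _ y2v _.
  by apply: (coord_eq0 iotaE) => //; apply/eqP; rewrite -eL_eq0 ev.
- move=> U [c c1 ->].
  (* The same weights on vectors of the plane: the conjugates of y1 are as for [DY], and the j-th
     conjugate of y2 is c^(q^j) times the sum of r_k u_k^(q^(j+1)), nonzero only for j = 1. *)
  pose w := \sum_k r k *: emb (iota 0 (u k 0) (c * fr (u k 0))).
  have wE : w = DY + fr c *: DZ.
    apply/eqP; rewrite -subr_eq0; apply/eqP.
    apply: ext_separation; rewrite linearB /= [ext _ (_ + _)]linearD /= linearZ /=
      ?(DYe, DZe, DY0, DZ0, DY1, DZ1, DY2, DZ2, DY3, DZ3, DY4, DZ4, DY5, DZ5)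
      ?scaler0 ?addr0 ?subr0 ?add0r /w ext_sum_emb.
    + by apply: sum0 => k; rewrite /= /lift_functional (e_iota iotaK) scale0r.
    + by rewrite -[RHS]r0; apply: eq_bigr => k _; rewrite (y1_iota iotaK).
    + by rewrite -[RHS]r1; apply: eq_bigr => k _; rewrite /= (y1_iota iotaK).
    + apply/eqP; rewrite subr_eq0 -r2; apply/eqP.
      by apply: eq_bigr => k _; rewrite /= (y1_iota iotaK).
    + have E : c * (\sum_k r k * fr (u k 0)) = 0 by rewrite r1 mulr0.
      rewrite -[RHS]E mulr_sumr; apply: eq_bigr => k _.
      by rewrite (y2_iota iotaK) mulrCA.
    + have E : fr c * (\sum_k r k * fr (fr (u k 0))) = fr c by rewrite r2 mulr1.
      apply/eqP; rewrite subr_eq0 -[_ *: 1]/(_ * 1) mulr1 -[X in _ == X]E mulr_sumr; apply/eqP.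
      by apply: eq_bigr => k _; rewrite /= (y2_iota iotaK) frM mulrCA.
    + have E : fr (fr c) * (\sum_k r k * u k 0) = 0 by rewrite r0 mulr0.
      rewrite -[RHS]E mulr_sumr; apply: eq_bigr => k _.
      by rewrite /= (y2_iota iotaK) !frM fr3 // mulrCA.
  have wU : w \in extend L (fr_graph iota c).
    apply: mem_extend_sum => k; rewrite (mem_fr_graph iotaK iotaE).
    by rewrite (e_iota iotaK) (y1_iota iotaK) (y2_iota iotaK) !eqxx.
  have w0 : w != 0.
    apply: contra_eq_neq DY2 => w0; rewrite -[DY](addrK (fr c *: DZ)) -wE w0 sub0r.
    by rewrite linearN linearZ /= DZ2 scaler0 oppr0 eq_sym.
  apply: contraNneq w0 => gU0; rewrite -memv0 -gU0 memv_cap wU andbT wE.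
  by rewrite memv_add ?memvZ ?memv_line.
Qed.

End Cubics.

(** * Normal form of a special twisted cubic *)

Section CubicNormalForm.
Variables (F : finFieldType) (L : fieldExtType F).
Hypothesis dimL : \dim {:L} = 3%N.
Local Notation emb := (map_mx (in_alg L)).
Variables (e : {linear 'rV[F]_7 -> F^o}) (y1 y2 : {linear 'rV[F]_7 -> L}).
Variable iota : F -> L -> L -> 'rV[F]_7.
Hypothesis iotaK : forall x a b,
  [/\ e (iota x a b) = x, y1 (iota x a b) = a & y2 (iota x a b) = b].
Hypothesis iotaE : forall v, iota (e v) (y1 v) (y2 v) = v.
Variable H : {vspace 'rV[F]_7}.
Hypothesis eH : forall v, (v \in H) = (e v == 0).

Let eL : {linear 'rV[F]_7 -> L} := lift_functional L e.

Lemma cform_fr (p : 'I_4 -> L) s t : cform (@fr F L \o p) (fr s) (fr t) = fr (cform p s t).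
Proof. by rewrite /cform /= !frE. Qed.

Lemma cubic_rational_zero (A : 'M[F]_(4, 7)) (s t : F) : row_free A ->
  cform (fun j => eL (row j A)) s%:A t%:A = 0 ->
  cform (fun j => y1 (row j A)) s%:A t%:A = 0 ->
  cform (fun j => y2 (row j A)) s%:A t%:A = 0 -> s = 0 /\ t = 0.
Proof.
move=> fA; rewrite -!linear_cubic => /eqP; rewrite alg_eq0 => /eqP k0 u0 v0.
by apply: (row_free_cubic fA); apply: (coord_eq0 iotaE).
Qed.

Lemma cubic_solid_rows (A : 'M[F]_(4, 7)) j : row j A \in cubic_solid A.
Proof. by apply/memv_span/map_f; rewrite mem_enum. Qed.

Lemma cubic_solid_hyperplane (A : 'M[F]_(4, 7)) U : flats 2 U -> (U <= H)%VS ->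
  ~~ (cubic_solid A <= H)%VS -> (U <= cubic_solid A)%VS -> (cubic_solid A :&: H)%VS = U.
Proof.
move=> dU UH AH UA; apply/esym/eqP; rewrite eqEdim subv_cap UA UH dU /=.
have d4 : (\dim (cubic_solid A) <= 4)%N.
  by rewrite (leq_trans (dim_span _)) // size_map size_enum_ord.
rewrite -ltnS (leq_trans _ d4) //.
rewrite ltn_neqAle dimvS ?capvSl // andbT; apply: contra AH => /eqP E.
by have /eqP <- : (cubic_solid A :&: H == cubic_solid A)%VS;
  rewrite ?capvSr // eqEdim capvSl E leqnn.
Qed.

(** At the point on the transversal e, y1, y1^q, y2 and y2^(q^2) vanish. Moving the conjugation from
    the form to the parameter gives the stated roots. A parameter in [F], or s = 0, would give a
    rational point with all coordinates zero. *)
Lemma cubic_parameter A : special_twisted_cubic L H (fr_family iota) A ->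
  exists z, [/\ fr z != z,
    [/\ cform (fun j => eL (row j A)) 1 z = 0, cform (fun j => y1 (row j A)) 1 z = 0 &
        cform (fun j => y1 (row j A)) 1 (fr (fr z)) = 0],
    cform (fun j => y2 (row j A)) 1 z = 0 & cform (fun j => y2 (row j A)) 1 (fr z) = 0].
Proof.
move=> [fA _ _ tA].
have [g [/tA [s [t [st wg]]] /(_ _ wg)]] := transversal_of_fr_family dimL iotaK iotaE eH.
rewrite !ext_cubic => -[k0 u0 u1 v0 v2].
have s0 : s != 0.
  apply: contraNneq st => s0; rewrite s0 xpair_eqE eqxx /=; apply: contraT => t0.
  have rat (h : 'I_4 -> L) : cform h s t = 0 -> cform h (0 : F)%:A (1 : F)%:A = 0.
    rewrite /cform s0 scale0r scale1r !expr0n /= !mul0r !add0r expr1n mul1r => /eqP.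
    by rewrite mulf_eq0 expf_eq0 (negPf t0) => /eqP.
  have [_ /eqP] := cubic_rational_zero fA (rat _ k0) (rat _ u0) (rat _ v0).
  by rewrite oner_eq0.
pose z := t / s.
have z0 (h : 'I_4 -> L) : cform h s t = 0 -> cform h 1 z = 0.
  rewrite (cform_scale _ _ s0) => /eqP; rewrite mulf_eq0 expf_eq0 (negPf s0) /=.
  by move/eqP.
exists z; split.
- apply/eqP => /fr_fixed [a zE].
  have rat (h : 'I_4 -> L) : cform h s t = 0 -> cform h (1 : F)%:A a%:A = 0.
    by rewrite scale1r -zE; apply: z0.
  have [/eqP] := cubic_rational_zero fA (rat _ k0) (rat _ u0) (rat _ v0).
  by rewrite oner_eq0.
- split; try exact: z0.
  have := congr1 (fun x => fr (fr x)) (z0 _ u1); rewrite !fr0 -!cform_fr !fr1 => E.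
  by rewrite -[RHS]E /cform /= !fr3.
- exact: z0.
- have := congr1 (@fr F L) (z0 _ v2); rewrite fr0 -cform_fr fr1 => E.
  by rewrite -[RHS]E /cform /= !fr3.
Qed.

(** The e-form is rational, so with z its conjugates are roots too and the form is a multiple of the
    norm. The other forms have two roots each, and [cform_two_roots] applies with the third
    conjugate as c. The plane of the cover inside the solid yields the condition on norms. *)
Lemma cubic_normal_form A : special_twisted_cubic L H (fr_family iota) A ->
  exists z (K : F) al al' be be', [/\ fr z != z, K != 0, al != 0, nrm al' = nrm al &
    forall s t : F, let r := t%:A - s%:A * z in let v := cubic_row s t *m A in
    [/\ eL v = K%:A * nrm r, y1 v = al * (r ^+ 2 * fr (fr r)) + be * nrm r &
        y2 v = al' * (r ^+ 2 * fr r) + be' * nrm r]].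
Proof.
move=> sA; have [z [nz [k0 u0 u2] v0 v1]] := cubic_parameter sA.
have [fA AH [U [c c1 UE] UA] _] := sA.
have nz2 := fr2_neq dimL nz.
have nz3 : fr z != fr (fr z) by rewrite (inj_eq (@fr_inj F L)) eq_sym.
have nz' : z != fr z by rewrite eq_sym.
have nz2' : z != fr (fr z) by rewrite eq_sym.
set k := fun j => eL (row j A) in k0.
set u := fun j => y1 (row j A) in u0 u2.
set v := fun j => y2 (row j A) in v0 v1.
have kfr s t : cform k (fr s) (fr t) = fr (cform k s t).
  by rewrite -cform_fr /cform /k /= /lift_functional !fr_alg.
have k1 : cform k 1 (fr z) = 0 by rewrite -(fr1 L) kfr k0 fr0.
have k2 : cform k 1 (fr (fr z)) = 0 by rewrite -(fr1 L) kfr k1 fr0.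
have kE := cform_three_roots nz' nz2' nz3 k0 k1 k2.
have nz23 : fr (fr z) != fr z by rewrite eq_sym.
have [al [be uE]] := cform_two_roots nz2' nz' u0 u2.
have [al' [be' vE]] := cform_two_roots nz' nz2' v0 v1.
pose K := e (row 3 A) : F.
have k3 : k 3 = K%:A by [].
exists z, K, al, al', be, be'.
have K0 : K != 0.
  apply: contraNneq AH => K0; apply/span_subvP => _ /mapP[j _ ->].
  have /quadratic_roots3 q3 := nz'; have [] := q3 (k 0) (k 1) (k 2) _ nz2' nz3.
  - by rewrite -[RHS]k0 /cform k3 K0 scale0r; ring.
  - by rewrite -[RHS]k1 /cform k3 K0 scale0r; ring.
  - by rewrite -[RHS]k2 /cform k3 K0 scale0r; ring.
  move=> k00 k10 k20; rewrite eH -(eL_eq0 L) -/eL -/(k j).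
  have : forall j : 'I_4, k j = 0; last by move=> ->.
  case=> [[|[|[|[|//]]]] ltj].
  - by rewrite -[RHS]k00; congr (k _); apply: val_inj.
  - by rewrite -[RHS]k10; congr (k _); apply: val_inj.
  - by rewrite -[RHS]k20; congr (k _); apply: val_inj.
  - by rewrite (_ : Ordinal ltj = 3) ?k3 ?K0 ?scale0r //; apply: val_inj.
have UH : (U <= H)%VS.
  by apply/subvP=> x; rewrite UE (mem_fr_graph iotaK iotaE) eH => /andP[].
have dU : flats 2 U by rewrite UE /flats /= (dim_graph dimL iotaK iotaE).
have solidE := cubic_solid_hyperplane dU UH AH UA.
have [p pA ep1] : exists2 p, p \in cubic_solid A & e p = 1.
  exists (K^-1 *: row 3 A); first by rewrite memvZ ?cubic_solid_rows.
  by rewrite linearZ; exact: mulVf.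
have so1 (x : F) : x *: (1 : F^o) = x := mulr1 x.
(* Subtracting a multiple of an affine point p of the solid moves each row into the plane y2 = c
   y1^q, which ties the three coefficient forms together. *)
have rel j : v j - k j * y2 p = c * fr (u j - k j * y1 p).
  have : row j A - (e (row j A) : F) *: p \in U.
    rewrite -solidE memv_cap memvB ?cubic_solid_rows ?memvZ //=.
    by rewrite eH linearB linearZ /= ep1 so1 subrr.
  rewrite UE (mem_fr_graph iotaK iotaE) => /andP[_ /eqP].
  rewrite [y2 (_ - _)]linearB [y2 (_ *: _)]linearZ [y1 (_ - _)]linearB [y1 (_ *: _)]linearZ /=.
  by rewrite /k /= /lift_functional !mulr_algl.
have relE s t : cform v s t - cform k s t * y2 p =
    c * (cform (@fr F L \o u) s t - cform k s t * fr (y1 p)).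
  have rel' j : v j = k j * y2 p + c * (fr (u j) - k j * fr (y1 p)).
    rewrite -[LHS](subrK (k j * y2 p)) rel addrC frD frN frM.
    by rewrite /k /= /lift_functional fr_alg.
  by rewrite /cform !rel' /=; ring.
have z20 : fr (fr z) - z != 0 by rewrite subr_eq0.
have z21 : fr (fr z) - fr z != 0 by rewrite subr_eq0.
have z10 : fr z - z != 0 by rewrite subr_eq0.
have v2 : cform v 1 (fr (fr z)) = al' * (fr (fr z) - z) ^+ 2 * (fr (fr z) - fr z).
  by rewrite vE; ring.
have u1 : cform u 1 (fr z) = al * (fr z - z) ^+ 2 * (fr z - fr (fr z)).
  by rewrite uE; ring.
(* Evaluation at z^(q^2), a root of the e-form, leaves only al' and al^q. The two differences of
   conjugates have opposite norms and N(c) = -1, so the signs cancel. *)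
have al'E : al' * (fr (fr z) - z) = c * fr al * (fr (fr z) - fr z).
  have := relE 1 (fr (fr z)); rewrite k2 !mul0r !subr0 v2 -[X in cform _ X](fr1 L).
  rewrite cform_fr u1 !frE fr3 // => E.
  apply: (mulIf z20); apply: (mulIf z21); apply/eqP; rewrite -subr_eq0; apply/eqP.
  by rewrite -[RHS](subrr (c * (fr al * (fr (fr z) - fr z) ^+ 2 * (fr (fr z) - z)))) -{1}E; ring.
have nal : nrm al' = nrm al.
  have N2 : nrm (fr (fr z) - z) = - nrm (fr (fr z) - fr z).
    rewrite -(nrm_fr dimL (fr (fr z) - z)) frD frN fr3 //.
    by rewrite -(nrm_fr dimL (z - fr z)) frD frN -nrmN opprB.
  have := congr1 (@nrm F L) al'E; rewrite !nrmM N2 c1 nrm_fr // !mulNr mul1r mulrN.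
  by move/oppr_inj/mulIf; apply; rewrite nrm_eq0.
(* If al = 0 then al' = 0, and all seven conjugate coordinates of the point of parameter z vanish,
   against the independence of the rows. *)
have al0 : al != 0.
  apply/eqP => al0; have al'0 : al' = 0 by apply/eqP; rewrite -nrm_eq0 nal al0 nrm0.
  have w0 : cubic_row 1 z *m emb A = 0.
    have u1' : cform u 1 (fr z) = 0 by rewrite u1 al0 !mul0r.
    have v2' : cform v 1 (fr (fr z)) = 0 by rewrite v2 al'0 !mul0r.
    apply: (ext_separation dimL iotaE); rewrite ext_cubic //.
    - have := congr1 (@fr F L) u2; rewrite fr0 -cform_fr fr3 // fr1 => E.
      exact: E.
    - have := congr1 (fun x => fr (fr x)) u1'; rewrite !fr0 -!cform_fr fr3 // !fr1.
      by move=> E; exact: E.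
    - have := congr1 (@fr F L) v2'; rewrite fr0 -cform_fr fr3 // fr1 => E.
      exact: E.
    - have := congr1 (fun x => fr (fr x)) v1; rewrite !fr0 -!cform_fr fr3 // !fr1.
      by move=> E; exact: E.
  have [|/eqP] := row_free_cubic _ w0; last by rewrite oner_eq0.
  by rewrite /row_free mxrank_map.
split=> // s t r x; have frr : fr r = t%:A - s%:A * fr z by rewrite /r !frE.
have frfrr : fr (fr r) = t%:A - s%:A * fr (fr z) by rewrite frr !frE.
rewrite /x !linear_cubic -/k -/u -/v kE uE vE k3 /nrm frfrr frr -/r.
split=> //; first by rewrite -!mulrA; congr (_ * _ + _ * _); rewrite ?mulrA // mulrAC.
by rewrite -!mulrA.
Qed.

End CubicNormalForm.

(** * Special conics *)

Section SpecialConics.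
Variables (F : finFieldType) (L : fieldExtType F).
Hypothesis dimL : \dim {:L} = 3%N.
Local Notation emb := (map_mx (in_alg L)).

Lemma frob_rowE n (x : 'rV[L]_n) : frob_row x = map_mx (@fr F L) x.
Proof. by apply/rowP => j; rewrite !mxE fr_def. Qed.

Lemma frob_row_moore u (x : 'rV[L]_3) : let X := x *m moore u in
  frob_row x *m moore u = row3 (fr (X 0 2)) (fr (X 0 0)) (fr (X 0 1)).
Proof.
rewrite /= frob_rowE !mulmx_moore !row3E !sum3 !mxE !frE !fr3 //.
Qed.

Lemma mem_conj_flat (M : 'M[L]_3) U w :
  (w \in conj_flat M U) <-> exists2 v, v \in U & w = frob_row (v *m invmx M) *m M.
Proof.
pose f v := frob_row (v *m invmx M) *m M.
have fD a v v' : f (a *: v + v') = fr a *: f v + f v'.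
  rewrite /f !frob_rowE mulmxDl map_mxD mulmxDl; congr (_ + _).
  by rewrite -scalemxAl map_mxZ -scalemxAl.
have f0 : f 0 = 0 by have := fD (-1) 0 0; rewrite scaler0 addr0 frN fr1 scaleN1r addNr.
split=> [wU|[v vU ->]].
- move: wU; rewrite /conj_flat span_def big_map => wU.
  have : exists2 v, v \in <<vbasis U>>%VS & w = f v.
    elim: (vbasis U : seq _) w wU => [|b B IHB] w.
      rewrite big_nil memv0 => /eqP ->; exists 0; by rewrite ?mem0v.
    rewrite big_cons => /memv_addP[_ /vlineP[a ->] [w' /IHB[v vB ->] ->]].
    exists (fr (fr a) *: b + v); last by rewrite fD fr3.
    by rewrite span_cons memv_add // memvZ // memv_line.
  by rewrite (span_basis (vbasisP U)).
- have fvU : f v \in <<map f (vbasis U)>>%VS; last by [].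
  rewrite -(span_basis (vbasisP U)) span_def in vU.
  elim: (vbasis U : seq _) v vU => [|b B IHB] v.
    by rewrite big_nil memv0 => /eqP ->; rewrite f0 mem0v.
  rewrite big_cons => /memv_addP[_ /vlineP[a ->] [v' /IHB vB ->]].
  by rewrite fD /= span_cons memv_add // memvZ // memv_line.
Qed.

(** Conjugation applies [fr] to the entries and shifts them by one place. Starting from x0 = 0 for
    l_oo, it makes m and n the lines x1 = 0 and x2 = 0. *)
Lemma conj_flat_moore u M (U : {vspace 'rV[L]_3}) (k : 'I_3) : rational_free u -> M \in unitmx ->
  (forall x : 'rV_3, (x *m M \in U) = (x 0 k == 0)) ->
  forall x : 'rV_3, (x *m M \in conj_flat (moore u *m M) U) = (x 0 (k + 1) == 0).
Proof.
move=> ufree MU UE x; have mU := moore_unit dimL ufree.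
have fE (y : 'rV_3) : frob_row (y *m M *m invmx (moore u *m M)) *m (moore u *m M) =
    row3 (fr (y 0 2)) (fr (y 0 0)) (fr (y 0 1)) *m M.
  have -> : y *m M *m invmx (moore u *m M) = y *m invmx (moore u).
    rewrite -{1}(mulmxKV mU y) -[_ *m moore u *m M]mulmxA mulmxK //.
    by rewrite unitmx_mul mU.
  by rewrite mulmxA frob_row_moore mulmxKV.
have e0 : (0 : 'I_3) + 1 = 1 by apply: val_inj.
have e1 : (1 : 'I_3) + 1 = 2 by apply: val_inj.
have e2 : (2 : 'I_3) + 1 = 0 by apply: val_inj.
apply/idP/eqP => [/mem_conj_flat[v]|xk].
- rewrite -(mulmxKV MU v) UE fE => /eqP vk /(can_inj (mulmxK MU)) ->.
  by case: (ord3 k) vk => -> vk; rewrite ?e0 ?e1 ?e2 row3E vk fr0.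
- apply/mem_conj_flat.
  pose y := row3 (fr (fr (x 0 1))) (fr (fr (x 0 2))) (fr (fr (x 0 0))).
  exists (y *m M); last by rewrite fE !row3E !fr3 // -row3_eta.
  by rewrite UE; case: (ord3 k) xk => ->; rewrite ?e0 ?e1 ?e2 row3E !fr_eq0 => ->.
Qed.

Lemma qform_polar (R : comNzRingType) n (A : 'M[R]_n) v w :
  qform A (v + w) = qform A v + qform A w + (v *m (A + A^T) *m w^T) 0 0.
Proof.
have -> : (v *m (A + A^T) *m w^T) 0 0 = (v *m A *m w^T) 0 0 + (w *m A *m v^T) 0 0.
  rewrite mulmxDr mulmxDl mxE; congr (_ + _).
  by rewrite -[RHS]/(((w *m A *m v^T) 0 0)) -[in RHS](trmxK (w *m A *m v^T)) [in RHS]mxE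
    !trmx_mul trmxK mulmxA.
by rewrite /qform linearD /= mulmxDl mulmxDl !mulmxDr !mxE; ring.
Qed.

Lemma qform_emb (Q : 'M[F]_3) v : qform (emb Q) (emb v) = (qform Q v)%:A.
Proof. by rewrite /qform map_trmx -!map_mxM mxE. Qed.

(** The extension of t -> Tr(b t^q t^(q^2)) from the points of the subplane to L^3. It has no square
    terms, so it vanishes at the coordinate points. *)
Definition trace_form (b : L) (X : 'rV[L]_3) : L :=
  b * (X 0 1 * X 0 2) + fr b * (X 0 2 * X 0 0) + fr (fr b) * (X 0 0 * X 0 1).

Lemma trace_form_matrix u b : exists Q : 'M[F]_3, forall x,
  qform (emb Q) x = trace_form b (x *m moore u).
Proof.
have /choice [q qE] : forall p : 'I_3 * 'I_3, exists a : F,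
    trc (b * (fr (u p.1 0) * fr (fr (u p.2 0)))) = a%:A by move=> p; apply: trc_in_F.
exists (\matrix_(j, k) q (j, k)) => x.
rewrite /qform mxE sum3 !mxE !sum3 !mxE /= -!qE /trc !frE !fr3 //=.
by rewrite /trace_form mulmx_moore !row3E !sum3; ring.
Qed.

Lemma trace_form_frow (b t : L) : trace_form b (frow t) = trc (b * (fr t * fr (fr t))).
Proof. by rewrite /trace_form !row3E /trc !frE !fr3 //; ring. Qed.

Lemma trace_form_inv (b t : L) : t != 0 ->
  trc (b * (fr t * fr (fr t))) = nrm t * trc (b / t).
Proof.
move=> t0; rewrite /trc /nrm !frE !fr3 //.
have t1 : fr t != 0 by rewrite fr_eq0.
have t2 : fr (fr t) != 0 by rewrite fr_eq0.
by field; apply/and3P; split; [exact: t2|exact: t1|].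
Qed.

(** A polar form vanishing at t is a relation between x, x^q and x^(q^2), so its coefficients are 0.
    The vanishing at t itself then reduces to b t^q t^(q^2) = 0. Nothing is divided by 2, so
    characteristic 2 is included. *)
Lemma trace_form_nonsingular (b t : L) : b != 0 -> t != 0 ->
  trace_form b (frow t) = 0 ->
  (forall x, trace_form b (frow (t + x)) = trace_form b (frow t) + trace_form b (frow x)) ->
  False.
Proof.
move=> b0 t0 bt polar.
have [|e0 e1 e2] := @fr_independent _ _ dimL (fr b * fr (fr t) + fr (fr b) * fr t)
    (fr (fr b) * t + b * fr (fr t)) (b * fr t + fr b * t).
  move=> x; have := polar x; rewrite /trace_form !row3E !frD => E.
  by move/eqP: E; rewrite -subr_eq0 => /eqP <-; ring.
have : b * (fr t * fr (fr t)) = 0.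
  rewrite -[RHS]bt /trace_form !row3E.
  have -> : fr (fr b) * (t * fr t) = - (fr b * (fr (fr t) * t)).
    by apply/eqP; rewrite -addr_eq0; apply/eqP; rewrite -[RHS](mulr0 t) -e0; ring.
  by ring.
by move/eqP; rewrite !mulf_eq0 !fr_eq0 (negPf b0) (negPf t0).
Qed.

Lemma meet_coordinate_lines M (U W : {vspace 'rV[L]_3}) (i j : 'I_3) (x : 'rV[L]_3) :
  M \in unitmx ->
  (forall y : 'rV_3, (y *m M \in U) = (y 0 i == 0)) ->
  (forall y : 'rV_3, (y *m M \in W) = (y 0 j == 0)) ->
  (forall y : 'rV_3, (y 0 i == 0) && (y 0 j == 0) <-> exists c, y = c *: x) ->
  (U :&: W)%VS = <[x *m M]>%VS.
Proof.
move=> MU UE WE xE; apply/vspaceP => w; rewrite -(mulmxKV MU w) memv_cap UE WE.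
apply/idP/vlineP => [/xE[c ->]|[c]]; first by exists c; rewrite scalemxAl.
by rewrite scalemxAl => /(can_inj (mulmxK MU)) E; apply/xE; exists c.
Qed.

Lemma special_conic_fr (linf : {vspace 'rV[L]_3}) M (b : L) : M \in unitmx ->
  line_at_infinity linf M -> b != 0 ->
  special_conic linf (fr_subplane M)
    [set P | exists t, [/\ t != 0, trc (b / t) = 0 & P = <[frow t *m M]>%VS]].
Proof.
move=> MU lM b0; have [z nz] := fr_nontrivial dimL.
have ufree := rational_free_powers dimL nz; set u := \col_j z ^+ j in ufree.
have mU := moore_unit dimL ufree; have [Q QE] := trace_form_matrix u b.
have QF v : (qform Q v)%:A = trace_form b (frow (theta u v)).
  by rewrite -qform_emb QE emb_moore.
have Q0 v : theta u v != 0 -> qform Q v = 0 <-> trc (b / theta u v) = 0.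
  move=> t0; have := QF v; rewrite trace_form_frow trace_form_inv // => E.
  split=> [q0|t0']; last by apply/eqP; rewrite -(alg_eq0 L) E t0' mulr0.
  by move/eqP: E; rewrite q0 scale0r eq_sym mulf_eq0 nrm_eq0 (negPf t0) => /eqP.
exists (moore u *m M), Q; split.
- by rewrite unitmx_mul mU.
- by rewrite subplane_of_moore.
- move=> v v0 qv; apply/eqP => pv.
  have t0 : theta u v != 0 by apply: contraNneq v0 => /ufree ->.
  apply: (@trace_form_nonsingular b (theta u v) b0 t0) => [|x].
    by rewrite -QF qv scale0r.
  have [w <-] := theta_surj dimL ufree x.
  by rewrite -linearD -!QF qform_polar pv mul0mx mxE addr0 scalerDl.
- apply/seteqP; split=> P.
  + move=> [t [t0 tb ->]]; have [v vt] := theta_surj dimL ufree t.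
    exists v; split; last by rewrite mulmxA emb_moore vt.
      by apply: contraNneq t0 => v0; rewrite -vt v0 linear0.
    by apply/Q0; rewrite vt.
  + move=> [v [v0 qv ->]]; have t0 : theta u v != 0 by apply: contraNneq v0 => /ufree ->.
    by exists (theta u v); split; [|apply/Q0|rewrite mulmxA emb_moore].
have mM := conj_flat_moore ufree MU lM; rewrite add0r in mM.
have nM := conj_flat_moore ufree MU mM.
have e2 : (1 : 'I_3) + 1 = 2 by apply: val_inj.
rewrite e2 in nM.
have ec (U : {vspace 'rV[L]_3}) x : x != 0 -> trace_form b x = 0 ->
    U = <[x *m M]>%VS -> extended_conic_of (moore u *m M) Q U.
  move=> x0 bx ->; exists (x *m invmx (moore u)); split.
  - by rewrite mulmx_unit_eq0 // unitmx_inv.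
  - by rewrite QE mulmxKV.
  - by rewrite mulmxA mulmxKV.
have r0 i j k : row3 i j k != 0 :> 'rV[L]_3 = ((i, j, k) != (0, 0, 0)).
  congr (~~ _); apply/eqP/eqP => [/matrixP E|[-> -> ->]].
    by have := E 0 0; have := E 0 1; have := E 0 2; rewrite !mxE /= => -> -> ->.
  by apply: row3P; rewrite !mxE.
have n1 : (1 == 0 :> L) = false := oner_eq0 L.
(* E_1, E_2, E_3 in this order, as vertices of the triangle of coordinate lines l_oo, m, n. *)
split; [apply: (ec _ (row3 0 0 1))|apply: (ec _ (row3 0 1 0))|apply: (ec _ (row3 1 0 0))];
  rewrite ?r0 ?xpair_eqE ?n1 ?andbF //;
  try by rewrite /trace_form !row3E; ring.
- apply: (meet_coordinate_lines MU lM mM) => y; split=> [/andP[/eqP y0 /eqP y1]|[c ->]].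
    by exists (y 0 2); rewrite row3Z !mulr0 mulr1 [LHS]row3_eta y0 y1.
  by rewrite !mxE /= !mulr0 eqxx.
- apply: (meet_coordinate_lines MU lM nM) => y; split=> [/andP[/eqP y0 /eqP y1]|[c ->]].
    by exists (y 0 1); rewrite row3Z !mulr0 mulr1 [LHS]row3_eta y0 y1.
  by rewrite !mxE /= !mulr0 eqxx.
- apply: (meet_coordinate_lines MU mM nM) => y; split=> [/andP[/eqP y0 /eqP y1]|[c ->]].
    by exists (y 0 0); rewrite row3Z !mulr0 mulr1 [LHS]row3_eta y0 y1.
  by rewrite !mxE /= !mulr0 eqxx.
Qed.

End SpecialConics.

(** * Uniqueness of the subplane *)

Section Frames.
Variables (F : finFieldType) (L : fieldExtType F).
Hypothesis dimL : \dim {:L} = 3%N.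
Local Notation emb := (map_mx (in_alg L)).

Lemma subplane_of_change (V : 'M[F]_3) (c : L) (M : 'M[L]_3) : V \in unitmx -> c != 0 ->
  subplane_of (c *: (emb V *m M)) = subplane_of M.
Proof.
move=> VU c0; have embM (x : 'rV[F]_3) : emb x *m (c *: (emb V *m M)) = c *: (emb (x *m V) *m M).
  by rewrite -scalemxAr mulmxA map_mxM.
apply/seteqP; split=> P [x x0 ->].
- exists (x *m V); last by rewrite embM vlineZ.
  by apply: contraNneq x0 => xV; rewrite -(mulmxK VU x) xV mul0mx.
- exists (x *m invmx V); last by rewrite embM vlineZ // mulmxKV.
  by apply: contraNneq x0 => xV; rewrite -(mulmxKV VU x) xV mul0mx.
Qed.

Lemma mx3_unit (K : fieldType) (r0 r1 r2 : 'rV[K]_3) :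
  (forall a b c, a *: r0 + b *: r1 + c *: r2 = 0 -> [/\ a = 0, b = 0 & c = 0]) <->
  mx3 r0 r1 r2 \in unitmx.
Proof.
split=> [indep|U a b c E].
- rewrite -row_free_unit; apply: inj_row_free => x; rewrite mulmx_mx3.
  by move/indep => [x0 x1 x2]; apply: row3P; rewrite ?x0 ?x1 ?x2 mxE.
- have : row3 a b c *m mx3 r0 r1 r2 = 0 by rewrite mulmx_mx3 !row3E.
  move/(congr1 (fun x => x *m invmx (mx3 r0 r1 r2))); rewrite mulmxK // mul0mx => /matrixP E0.
  by have := E0 0 0; have := E0 0 1; have := E0 0 2; rewrite !row3E !mxE.
Qed.

(** Rational representatives of the four points are known only up to factors in [L]. The relation
    for w3 ties the first three factors to the fourth, so the vectors c_i w_i are rational up to one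
    common factor, which does not change the subplane. *)
Lemma subplane_frame pi (w0 w1 w2 w3 : 'rV[L]_3) (c0 c1 c2 : L) : subplane pi ->
  mx3 w0 w1 w2 \in unitmx -> w3 = c0 *: w0 + c1 *: w1 + c2 *: w2 ->
  c0 != 0 -> c1 != 0 -> c2 != 0 ->
  pi <[w0]>%VS -> pi <[w1]>%VS -> pi <[w2]>%VS -> pi <[w3]>%VS ->
  pi = subplane_of (mx3 (c0 *: w0) (c1 *: w1) (c2 *: w2)).
Proof.
move=> [M MU ->] /mx3_unit indep w3E c0n c1n c2n.
have repr w : w != 0 -> subplane_of M <[w]>%VS ->
    exists (l : L) (v : 'rV[F]_3), l != 0 /\ w = l *: (emb v *m M).
  move=> w0' [v _ /(vline_eqP _ w0')[l l0 ->]]; by exists l, v.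
have n1 : 1 <> 0 :> L by apply/eqP/oner_neq0.
have w0n : w0 != 0.
  by apply/eqP => E; have [] := indep 1 0 0; rewrite ?E ?scaler0 ?scale0r ?addr0.
have w1n : w1 != 0.
  by apply/eqP => E; have [] := indep 0 1 0; rewrite ?E ?scaler0 ?scale0r ?addr0.
have w2n : w2 != 0.
  by apply/eqP => E; have [] := indep 0 0 1; rewrite ?E ?scaler0 ?scale0r ?addr0.
have w3n : w3 != 0.
  by rewrite w3E; apply: contraNneq c0n => /indep[-> _ _].
move=> /(repr _ w0n)[l0 [v0 [l0n w0E]]] /(repr _ w1n)[l1 [v1 [l1n w1E]]].
move=> /(repr _ w2n)[l2 [v2 [l2n w2E]]] /(repr _ w3n)[l3 [v3 [l3n w3E']]].
have emb_w (l : L) (v : 'rV[F]_3) (w : 'rV[L]_3) : l != 0 -> w = l *: (emb v *m M) -> forall a : F,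
    emb (a *: v) *m M = (a%:A / l) *: w.
  by move=> ln -> a; rewrite map_mxZ -scalemxAl scalerA divfK.
have VU : mx3 v0 v1 v2 \in unitmx.
  apply/mx3_unit => a b c E; have := congr1 (fun x => emb x *m M) E.
  rewrite map_mx0 mul0mx !map_mxD !mulmxDl (emb_w _ _ _ l0n w0E) (emb_w _ _ _ l1n w1E)
    (emb_w _ _ _ l2n w2E) => /indep[/eqP + /eqP + /eqP].
  rewrite !mulf_eq0 !invr_eq0 (negPf l0n) (negPf l1n) (negPf l2n) !orbF !alg_eq0.
  by move=> /eqP -> /eqP -> /eqP ->.
pose d := v3 *m invmx (mx3 v0 v1 v2).
have v3E : v3 = d 0 0 *: v0 + d 0 1 *: v1 + d 0 2 *: v2 by rewrite -mulmx_mx3 mulmxKV.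
have E : (l3 * (d 0 0)%:A / l0 - c0) *: w0 + (l3 * (d 0 1)%:A / l1 - c1) *: w1 +
    (l3 * (d 0 2)%:A / l2 - c2) *: w2 = 0.
  rewrite !scalerBl -(subrr w3) {1}w3E' v3E !map_mxD !mulmxDl (emb_w _ _ _ l0n w0E)
    (emb_w _ _ _ l1n w1E) (emb_w _ _ _ l2n w2E) w3E !scalerDr !scalerA !mulrA.
  by rewrite !opprD [RHS]addrACA [X in _ = X + _]addrACA.
have [/eqP + /eqP + /eqP] := indep _ _ _ E; rewrite !subr_eq0 => /eqP d0 /eqP d1 /eqP d2.
pose V := mx3 (d 0 0 *: v0) (d 0 1 *: v1) (d 0 2 *: v2).
have dn (l c : L) (a : F) : l3 * a%:A / l = c -> c != 0 -> a != 0.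
  by move=> <-; apply: contraNneq => ->; rewrite scale0r mulr0 mul0r.
have VU' : V \in unitmx.
  apply/mx3_unit => a b c; rewrite !scalerA.
  have /mx3_unit indepv := VU; move/indepv => [/eqP + /eqP + /eqP].
  rewrite !mulf_eq0 (negPf (dn _ _ _ d0 c0n)) (negPf (dn _ _ _ d1 c1n)) (negPf (dn _ _ _ d2 c2n)).
  by rewrite !orbF => /eqP -> /eqP -> /eqP ->.
rewrite -(subplane_of_change M VU' l3n); congr subplane_of.
apply/row_matrixP => i; rewrite linearZ /= row_mul -map_row !rowK.
by case: (ord3 i) => -> /=; rewrite ?(emb_w _ _ _ l0n w0E) ?(emb_w _ _ _ l1n w1E)
  ?(emb_w _ _ _ l2n w2E) scalerA mulrA ?d0 ?d1 ?d2.
Qed.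

(* No three of the points 1/r lie on a line of the subplane, since r'/r generates L. *)
Lemma inverse_free (r r' : L) (x y : F) : fr r * r' != r * fr r' -> x != 0 -> y != 0 ->
  forall a b c : F, a *: r^-1 + b *: r'^-1 + c *: (x *: r + y *: r')^-1 = 0 ->
  [/\ a = 0, b = 0 & c = 0].
Proof.
move=> rr' x0 y0 a b c.
have rn : r != 0 by apply: contraNneq rr' => ->; rewrite fr0 !mul0r.
have r'n : r' != 0 by apply: contraNneq rr' => ->; rewrite fr0 !mulr0.
have tn : fr (r / r') != r / r'.
  by rewrite frM frV eqr_div ?fr_eq0.
set r2 := x *: r + y *: r'.
have r2n : r2 != 0.
  apply: contraNneq tn => r20.
  have -> : r / r' = (- (y / x))%:A.
    apply: (mulIf r'n); rewrite divfK // mulr_algl; apply: (scalerI x0).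
    rewrite scalerA mulrN mulrCA divff // mulr1 scaleNr; apply/eqP.
    by rewrite -addr_eq0 -r20.
  by rewrite fr_alg.
rewrite -[a *: _]mulr_algl -[b *: _]mulr_algl -[c *: _]mulr_algl => E.
(* Multiplying the relation by r r2 / r' turns it into a quadratic equation over [F] for r / r',
   which lies outside [F]. *)
have [] := quadratic_free dimL (z := r / r') (a := a * y) (b := a * x + b * y + c) (c := b * x) tn.
  have algM (p k : F) : (p * k)%:A = p%:A * k%:A :> L by rewrite mulr_algl scalerA.
  have r2E : r2 = x%:A * r + y%:A * r' by rewrite /r2 !mulr_algl.
  rewrite !scalerDl !algM.
  transitivity (a%:A * (r2 / r') + b%:A * (r / r') * (r2 / r') + c%:A * (r / r')).
    by rewrite r2E; field.
  transitivity ((a%:A * r^-1 + b%:A * r'^-1 + c%:A * r2^-1) * (r * r2 / r')).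
    by field; rewrite r2n rn r'n.
  by rewrite E mul0r.
move=> /eqP + e1 /eqP; rewrite !mulf_eq0 (negPf x0) (negPf y0) !orbF => /eqP a0 /eqP b0.
by move: e1; rewrite a0 b0 !mul0r !add0r.
Qed.

Lemma fr_subplane_unique (M : 'M[L]_3) (z : L) (pi : set {vspace 'rV[L]_3}) :
  (3 <= #|F|)%N -> M \in unitmx -> fr z != z -> subplane pi ->
  (forall s t : F, (s, t) != (0, 0) -> pi <[frow (t%:A - s%:A * z)^-1 *m M]>%VS) ->
  pi = fr_subplane M.
Proof.
move=> F3 MU nz subpi Npi; have [l l0 l1] := exists_neq01 F3.
(* The points with parameters (1, 0), (0, 1), (1, 1) and (1, l). Any three are independent, so they
   form a frame, and it lies in both subplanes. *)
pose t0 := (- z)^-1; pose t1 : L := 1^-1; pose t2 := (1 - z)^-1; pose t3 := (l%:A - z)^-1.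
have r2E : 1 - z = (1 : F) *: - z + (1 : F) *: 1 by rewrite !scale1r addrC.
have r3E : l%:A - z = (1 : F) *: - z + l *: 1 by rewrite scale1r addrC.
have r3E' : l%:A - z = (1 - l) *: - z + l *: (1 - z).
  by rewrite scalerBl scale1r scalerBr scalerN opprK [RHS]addrC addrACA addNr addr0.
have r3E'' : l%:A - z = (l - 1) *: 1 + (1 : F) *: (1 - z).
  by rewrite scalerBl !scale1r addrA subrK.
have lm1 : 1 - l != 0 by rewrite subr_eq0 eq_sym.
have l1m : l - 1 != 0 by rewrite subr_eq0.
have n1 : (1 : F) != 0 := oner_neq0 F.
have i01 : fr (- z) * 1 != - z * fr 1.
  by rewrite frN fr1 !mulr1 (inj_eq oppr_inj).
have i02 : fr (- z) * (1 - z) != - z * fr (1 - z).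
  rewrite -subr_eq0 frN frD frN fr1.
  have -> : - fr z * (1 - z) - - z * (1 - fr z) = z - fr z by ring.
  by rewrite subr_eq0 eq_sym.
have i12 : fr 1 * (1 - z) != 1 * fr (1 - z).
  by rewrite fr1 !mul1r frD frN fr1 (inj_eq (addrI _)) (inj_eq oppr_inj) eq_sym.
have free012 := inverse_free i01 n1 n1; rewrite -r2E -/t0 -/t1 -/t2 in free012.
have free013 := inverse_free i01 n1 l0; rewrite -r3E -/t0 -/t1 -/t3 in free013.
have free023 := inverse_free i02 lm1 l0; rewrite -r3E' -/t0 -/t2 -/t3 in free023.
have free123 := inverse_free i12 l1m n1; rewrite -r3E'' -/t1 -/t2 -/t3 in free123.
pose u : 'cV[L]_3 := \col_j [:: t0; t1; t2]`_j.
have thetaE v : theta u v = v 0 0 *: t0 + v 0 1 *: t1 + v 0 2 *: t2.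
  by rewrite /theta sum3 !mxE.
have ufree : rational_free u.
  by move=> v; rewrite thetaE => /free012[v0 v1 v2]; apply: row3P; rewrite ?v0 ?v1 ?v2 mxE.
have [a aE] := theta_surj dimL ufree t3; rewrite thetaE in aE.
have neg1 : (-1 : F) = 0 -> False by move/eqP; rewrite oppr_eq0 oner_eq0.
have a0 : a 0 0 != 0.
  apply/eqP => a0; have [|_ _] := free123 (a 0 1) (a 0 2) (-1); last exact: neg1.
  by rewrite -aE a0 scale0r add0r scaleN1r subrr.
have a1 : a 0 1 != 0.
  apply/eqP => a1; have [|_ _] := free023 (a 0 0) (a 0 2) (-1); last exact: neg1.
  by rewrite -aE a1 scale0r addr0 scaleN1r subrr.
have a2 : a 0 2 != 0.
  apply/eqP => a2; have [|_ _] := free013 (a 0 0) (a 0 1) (-1); last exact: neg1.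
  by rewrite -aE a2 scale0r addr0 scaleN1r subrr.
have frowD x y : frow (x + y) = frow x + frow y :> 'rV[L]_3.
  by rewrite /frow row3D !frD.
have wU : mx3 (frow t0 *m M) (frow t1 *m M) (frow t2 *m M) \in unitmx.
  have -> : mx3 (frow t0 *m M) (frow t1 *m M) (frow t2 *m M) = moore u *m M.
    apply/row_matrixP => i; rewrite row_mul rowK.
    by case: (ord3 i) => -> /=; congr (_ *m M); apply/rowP => j; rewrite !mxE.
  by rewrite unitmx_mul MU moore_unit.
have w3E : frow t3 *m M = (a 0 0)%:A *: (frow t0 *m M) + (a 0 1)%:A *: (frow t1 *m M) +
    (a 0 2)%:A *: (frow t2 *m M).
  by rewrite -aE !frowD !frowZ !mulmxDl -!scalemxAl.
have P0 : pi <[frow t0 *m M]>%VS.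
  have := Npi 1 0; rewrite scale0r scale1r mul1r sub0r; apply.
  by rewrite xpair_eqE oner_eq0.
have P1 : pi <[frow t1 *m M]>%VS.
  have := Npi 0 1; rewrite scale0r scale1r mul0r subr0; apply.
  by rewrite xpair_eqE oner_eq0 andbF.
have P2 : pi <[frow t2 *m M]>%VS.
  by have := Npi 1 1; rewrite scale1r mul1r; apply; rewrite xpair_eqE oner_eq0.
have P3 : pi <[frow t3 *m M]>%VS.
  by have := Npi 1 l; rewrite scale1r mul1r; apply; rewrite xpair_eqE oner_eq0.
have A0 : (a 0 0)%:A != 0 :> L by rewrite alg_eq0.
have A1 : (a 0 1)%:A != 0 :> L by rewrite alg_eq0.
have A2 : (a 0 2)%:A != 0 :> L by rewrite alg_eq0.
rewrite (subplane_frame subpi wU w3E A0 A1 A2 P0 P1 P2 P3).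
have zn : z != 0 by apply: contraNneq nz => ->; rewrite fr0.
have fr_in t : t != 0 -> fr_subplane M <[frow t *m M]>%VS by move=> t0'; exists t.
have zF (c : F) : c%:A - z != 0.
  by rewrite subr_eq0; apply: contraNneq nz => <-; rewrite fr_alg.
symmetry; apply: (subplane_frame (fr_subplane_subplane dimL MU) wU w3E A0 A1 A2);
  apply: fr_in; rewrite invr_eq0 ?oppr_eq0 ?oner_eq0 //.
by rewrite -(scale1r (1 : L)).
Qed.

End Frames.

(** * Tangent cover *)

Section TripleProducts.
Variable K : fieldType.

Definition tri (p0 q0 p1 q1 p2 q2 : K) (j : 'I_4) : K :=
  [:: p0 * p1 * p2; p0 * p1 * q2 + p0 * q1 * p2 + q0 * p1 * p2;
      p0 * q1 * q2 + q0 * p1 * q2 + q0 * q1 * p2; q0 * q1 * q2]`_j.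

Lemma cform_tri p0 q0 p1 q1 p2 q2 s t : cform (tri p0 q0 p1 q1 p2 q2) s t =
  (s * p0 + t * q0) * (s * p1 + t * q1) * (s * p2 + t * q2).
Proof. by rewrite /cform /tri /=; ring. Qed.

(* For pairwise independent linear forms l0, l1, l2, the cubic forms l1^2 l2, l1 l2^2,
   l0 l1^2 and l0 l2^2 span all cubic forms. *)
Lemma tri_span (r : 'I_4 -> K) x0 y0 x1 y1 x2 y2 :
  x0 * y1 - x1 * y0 != 0 -> x1 * y2 - x2 * y1 != 0 -> x2 * y0 - x0 * y2 != 0 ->
  \sum_j r j * tri x1 y1 x1 y1 x2 y2 j = 0 ->
  \sum_j r j * tri x1 y1 x2 y2 x2 y2 j = 0 ->
  \sum_j r j * tri x0 y0 x1 y1 x1 y1 j = 0 ->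
  \sum_j r j * tri x0 y0 x2 y2 x2 y2 j = 0 -> forall j, r j = 0.
Proof.
rewrite !sum4 /tri /= => d01 d12 d20 e112 e122 e011 e022.
set D01 := x0 * y1 - x1 * y0 in d01; set D := x1 * y2 - x2 * y1 in d12.
set D20 := x2 * y0 - x0 * y2 in d20.
pose R p0 q0 p1 q1 p2 q2 := r 0 * (p0 * p1 * p2) +
  r 1 * (p0 * p1 * q2 + p0 * q1 * p2 + q0 * p1 * p2) +
  r 2 * (p0 * q1 * q2 + q0 * p1 * q2 + q0 * q1 * p2) + r 3 * (q0 * q1 * q2).
rewrite -/(R x1 y1 x1 y1 x2 y2) in e112; rewrite -/(R x1 y1 x2 y2 x2 y2) in e122.
rewrite -/(R x0 y0 x1 y1 x1 y1) in e011; rewrite -/(R x0 y0 x2 y2 x2 y2) in e022.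
(* The forms satisfy D l0 + D20 l1 + D01 l2 = 0. Multiplied by l2^2, and below by l1^2, this adds
   the cubes of l2 and l1 to the span; D^3 times each monomial is then a combination of products of
   l1 and l2. *)
have e222 : R x2 y2 x2 y2 x2 y2 = 0.
  apply: (mulfI d01); rewrite mulr0.
  transitivity (- (D * R x0 y0 x2 y2 x2 y2 + D20 * R x1 y1 x2 y2 x2 y2)).
    by rewrite /R /D01 /D /D20; ring.
  by rewrite e022 e122; ring.
have e111 : R x1 y1 x1 y1 x1 y1 = 0.
  apply: (mulfI d20); rewrite mulr0.
  transitivity (- (D * R x0 y0 x1 y1 x1 y1 + D01 * R x1 y1 x1 y1 x2 y2)).
    by rewrite /R /D01 /D /D20; ring.
  by rewrite e011 e112; ring.
have D3 : D ^+ 3 != 0 by rewrite expf_neq0.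
have main a b c d k : D ^+ 3 * k = a * R x1 y1 x1 y1 x1 y1 + b * R x1 y1 x1 y1 x2 y2 +
    c * R x1 y1 x2 y2 x2 y2 + d * R x2 y2 x2 y2 x2 y2 -> k = 0.
  by rewrite e111 e112 e122 e222 !mulr0 !addr0 => /eqP; rewrite mulf_eq0 (negPf D3) => /eqP.
have r0 : r 0 = 0.
  apply: (main (y2 ^+ 3) (- 3%:R * y2 ^+ 2 * y1) (3%:R * y2 * y1 ^+ 2) (- y1 ^+ 3)).
  by rewrite /R /D; ring.
have r1 : r 1 = 0.
  apply: (main (- x2 * y2 ^+ 2) (x1 * y2 ^+ 2 + 2%:R * x2 * y1 * y2)
    (- 2%:R * x1 * y1 * y2 - x2 * y1 ^+ 2) (x1 * y1 ^+ 2)).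
  by rewrite /R /D; ring.
have r2 : r 2 = 0.
  apply: (main (x2 ^+ 2 * y2) (- (x2 ^+ 2 * y1 + 2%:R * x1 * x2 * y2))
    (x1 ^+ 2 * y2 + 2%:R * x1 * x2 * y1) (- x1 ^+ 2 * y1)).
  by rewrite /R /D; ring.
have r3 : r 3 = 0.
  apply: (main (- x2 ^+ 3) (3%:R * x2 ^+ 2 * x1) (- 3%:R * x2 * x1 ^+ 2) (x1 ^+ 3)).
  by rewrite /R /D; ring.
case=> [[|[|[|[|//]]]] ltj].
- by rewrite -[RHS]r0; congr (r _); apply: val_inj.
- by rewrite -[RHS]r1; congr (r _); apply: val_inj.
- by rewrite -[RHS]r2; congr (r _); apply: val_inj.
- by rewrite -[RHS]r3; congr (r _); apply: val_inj.
Qed.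

End TripleProducts.

(** * The subplane containing the cubic, and its tangent planes *)

Section SubplaneInCoordinates.
Variables (F : finFieldType) (L : fieldExtType F).
Hypothesis dimL : \dim {:L} = 3%N.
Local Notation emb := (map_mx (in_alg L)).
Variables (H : {vspace 'rV[F]_7}) (Sp : set {vspace 'rV[F]_7}).
Variables (linf : {vspace 'rV[L]_3}) (beta : {vspace 'rV[F]_7} -> {vspace 'rV[L]_3}).
Hypothesis planesSp : planes_in H Sp.
Hypothesis covSp : covered Sp = [set P | flats 0 P /\ (P <= H)%VS].
Hypothesis betaP : bruck_bose H Sp linf beta.
Variables (M : 'M[L]_3) (s : {rmorphism L -> L}) (e : {linear 'rV[F]_7 -> F^o}).
Variables (y1 y2 : {linear 'rV[F]_7 -> L}) (iota : F -> L -> L -> 'rV[F]_7).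
Hypotheses (MU : M \in unitmx) (lM : line_at_infinity linf M) (sbij : bijective s).
Hypothesis iotaK : forall x a b,
  [/\ e (iota x a b) = x, y1 (iota x a b) = a & y2 (iota x a b) = b].
Hypothesis iotaE : forall v, iota (e v) (y1 v) (y2 v) = v.
Hypothesis eH : forall v, (v \in H) = (e v == 0).
Hypothesis baff : forall v, v \notin H ->
  beta <[v]> = <[row3 (s (e v : F)%:A) (s (y1 v)) (s (y2 v)) *m M]>%VS.
Hypothesis binf : forall U, Sp U -> forall u, u \in U -> u != 0 ->
  beta U = <[row3 0 (s (y1 u)) (s (y2 u)) *m M]>%VS.

Let eL : {linear 'rV[F]_7 -> L} := lift_functional L e.

Lemma spread_line a b : (a != 0) || (b != 0) ->
  exists U, Sp U /\ forall v, v \in U -> e v = 0 /\ a * y2 v = b * y1 v.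
Proof.
move=> ab; pose u := iota 0 a b; have [eu yu1 yu2] := iotaK 0 a b.
have u0 : u != 0.
  apply: contraTneq ab => u0; have a0 : a = 0 by rewrite -yu1 -/u u0 linear0.
  by have b0 : b = 0 by [rewrite -yu2 -/u u0 linear0]; rewrite a0 b0 eqxx.
have uH : u \in H by rewrite eH eu.
have [U SU uU] := spread_cover covSp uH u0.
exists U; split=> // v vU.
have ev : e v = 0.
  by apply/eqP; rewrite -eH; have [_ /subvP UH] := planesSp SU; apply: UH.
split=> //; have [->|v0] := eqVneq v 0; first by rewrite !linear0 !mulr0.
have sinj := bij_inj sbij.
have r0 : row3 0 (s (y1 v)) (s (y2 v)) *m M != 0.
  rewrite mulmx_unit_eq0 //; apply: contraNneq v0 => /matrixP E; apply/eqP.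
  have := E 0 1; have := E 0 2; rewrite !mxE /= => /eqP + /eqP.
  by rewrite !fmorph_eq0 => /eqP E2 /eqP E1; apply: (coord_eq0 iotaE).
have := binf SU uU u0; rewrite (binf SU vU v0) => /(vline_eqP _ r0)[k k0].
rewrite scalemxAl => /(can_inj (mulmxK MU)); rewrite row3Z => /row3_inj[_ E1 E2].
rewrite yu1 in E1; rewrite yu2 in E2.
by apply: sinj; rewrite !rmorphM E1 E2 /=; ring.
Qed.

Variables (K : F) (al al' be be' : L) (nF : L -> F).
Hypotheses (K0 : K != 0) (al0 : al != 0) (nal : nrm al' = nrm al).
Hypothesis nFE : forall t, (nF t)%:A = nrm t.

Lemma al'0 : al' != 0.
Proof. by rewrite -nrm_eq0 nal nrm_eq0. Qed.

Definition shape_mx : 'M[L]_3 :=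
  mx3 (row3 K%:A be be') (row3 0 al 0) (row3 0 0 al').

Definition shape_subplane_mx : 'M[L]_3 := map_mx s shape_mx *m M.

(* N(t)^2 times the cubic of cubic_normal_form at r = 1 / t. *)
Definition affine_param (t : L) : 'rV[F]_7 :=
  iota (K * nF t) (al * (fr t ^+ 2 * fr (fr t)) + be * nrm t)
    (al' * (fr t * fr (fr t) ^+ 2) + be' * nrm t).

Lemma mulmx_shape (a b c : L) : row3 a b c *m shape_mx =
  row3 (K%:A * a) (be * a + al * b) (be' * a + al' * c).
Proof.
rewrite mulmx_mx3 !row3E !row3Z !row3D.
by congr row3; ring.
Qed.

Lemma shape_unit : shape_mx \in unitmx.
Proof.
rewrite -row_free_unit; apply: inj_row_free => x; rewrite (row3_eta x) mulmx_shape.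
have KL : K%:A != 0 :> L by rewrite alg_eq0.
have -> : (0 : 'rV[L]_3) = row3 0 0 0 by apply: row3P; rewrite !mxE.
move/row3_inj => [/eqP + E1 E2]; rewrite mulf_eq0 (negPf KL) => /eqP x0.
move: E1 E2; rewrite x0 !mulr0 !add0r => /eqP + /eqP.
by rewrite !mulf_eq0 (negPf al0) (negPf al'0) => /eqP -> /eqP ->.
Qed.

Lemma shape_subplane_unit : shape_subplane_mx \in unitmx.
Proof. by rewrite unitmx_mul MU map_unitmx shape_unit. Qed.

Lemma map_row3 (a b c : L) : map_mx s (row3 a b c) = row3 (s a) (s b) (s c).
Proof. by apply: row3P; rewrite !mxE. Qed.

Lemma shape_line_at_infinity : line_at_infinity linf shape_subplane_mx.
Proof.
have [t st ts] := sbij.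
move=> x; rewrite mulmxA lM (row3_eta x) -[x 0 0]ts -[x 0 1]ts -[x 0 2]ts -map_row3 -map_mxM.
rewrite mulmx_shape map_row3 !row3E rmorphM mulf_eq0 fmorph_eq0 alg_eq0 (negPf K0) /=.
by rewrite mxE row3E.
Qed.

Lemma map_frow t : map_mx s (frow t) = frow (s t).
Proof. by rewrite map_row3 !rmorph_fr. Qed.

(** The scalar lies in [L], which is harmless in PG(2, q^3). In PG(6, q) the e-coordinate must lie
    in [F], and the degree-three form of [affine_param] ensures this. *)
Lemma affine_param_coords t : t != 0 ->
  row3 (eL (affine_param t)) (y1 (affine_param t)) (y2 (affine_param t)) =
  (nrm t / t) *: (frow t *m shape_mx).
Proof.
move=> t0; have KE : (K * nF t)%:A = K%:A * nrm t by rewrite -nFE mulr_algl scalerA.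
rewrite mulmx_shape row3Z /= /lift_functional (e_iota iotaK) (y1_iota iotaK).
rewrite (y2_iota iotaK) KE.
have nt : nrm t / t = fr t * fr (fr t) by rewrite /nrm; field.
by rewrite nt /nrm; congr row3; ring.
Qed.

Lemma affine_param_notin t : t != 0 -> affine_param t \notin H.
Proof.
by move=> t0; rewrite eH (e_iota iotaK) mulf_eq0 (negPf K0) -(alg_eq0 L) nFE nrm_eq0.
Qed.

Lemma beta_affine_param t : t != 0 ->
  beta <[affine_param t]> = <[frow (s t) *m shape_subplane_mx]>%VS.
Proof.
move=> t0; rewrite baff ?affine_param_notin // -map_row3 affine_param_coords //.
rewrite map_mxZ map_mxM map_frow -scalemxAl -mulmxA vlineZ // fmorph_eq0.
by rewrite mulf_neq0 ?invr_eq0 ?nrm_eq0.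
Qed.

Lemma affine_param_surj P : affine_point H P ->
  fr_subplane shape_subplane_mx (beta P) ->
  exists2 t, t != 0 & P = <[affine_param t]>%VS.
Proof.
have [t st ts] := sbij.
move=> aP [r r0 PE]; exists (t r); first by rewrite -(fmorph_eq0 s) ts.
apply: (beta_inj betaP); first by left.
- by apply: affine_bb; rewrite affine_param_notin // -(fmorph_eq0 s) ts.
- by rewrite PE beta_affine_param ?ts // -(fmorph_eq0 s) ts.
Qed.

Lemma shape_splash P : splash linf (fr_subplane shape_subplane_mx) P <->
  exists a b, [/\ a != 0, nrm b = - nrm a & P = <[row3 0 a b *m M]>%VS].
Proof.
rewrite (splash_fr_subplane dimL P shape_subplane_unit shape_line_at_infinity).
have sal : s al != 0 by rewrite fmorph_eq0.
have sal' : s al' != 0 by rewrite fmorph_eq0 al'0.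
have [t st ts] := sbij.
have E (a b : L) : row3 0 a b *m shape_subplane_mx = row3 0 (s al * a) (s al' * b) *m M.
  rewrite mulmxA; congr (_ *m M); rewrite -[a in LHS]ts -[b in LHS]ts.
  rewrite -[0 in LHS](rmorph0 s) -map_row3 -map_mxM mulmx_shape.
  by rewrite !mulr0 !add0r map_row3 rmorph0 !rmorphM /= !ts.
have nsal : nrm (s al') = nrm (s al) by rewrite !rmorph_nrm nal.
split=> -[a [b [a0 bN ->]]].
- exists (s al * a), (s al' * b); rewrite mulf_neq0 //; split=> //.
    by rewrite !nrmM nsal bN mulrN.
  by rewrite E.
- exists (a / s al), (b / s al'); rewrite mulf_neq0 ?invr_eq0 //; split=> //.
    by rewrite !nrmM !nrmV nsal bN mulNr.
  by rewrite E ![_ * (_ / _)]mulrC !divfK.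
Qed.

Definition frc (j : 'I_3) (x : L) : L := frow x 0 j.

Lemma frc_linear j : linear (frc j).
Proof.
by move=> a x y; rewrite /frc; case: (ord3 j) => ->; rewrite !row3E ?frE.
Qed.

HB.instance Definition _ j := GRing.isLinear.Build F L L *:%R (frc j) (frc_linear j).

Lemma frcE x : ((frc 0 x = x) * (frc 1 x = fr x) * (frc 2 x = fr (fr x)))%type.
Proof. by rewrite /frc !row3E. Qed.

Lemma frcM j x y : frc j (x * y) = frc j x * frc j y.
Proof. by case: (ord3 j) => ->; rewrite !frcE ?frE. Qed.

Lemma frc1 j : frc j 1 = 1.
Proof. by case: (ord3 j) => ->; rewrite !frcE ?frE. Qed.

Lemma frc_inj_index z i j : fr z != z -> frc i z = frc j z -> i = j.
Proof.
move=> nz; have nz2 := fr2_neq dimL nz.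
have nz3 : (fr z == fr (fr z)) = false by rewrite (inj_eq (@fr_inj F L)) eq_sym (negPf nz).
have nz1' : (z == fr z) = false by rewrite eq_sym (negPf nz).
have nz2' : (z == fr (fr z)) = false by rewrite eq_sym (negPf nz2).
case: (ord3 i) => ->; case: (ord3 j) => ->; rewrite !frcE // => /eqP;
  by rewrite ?nz3 ?nz1' ?nz2' ?(negPf nz) ?(negPf nz2) // eq_sym nz3.
Qed.

Local Notation Y j := (ext (frc j \o y1 : {linear 'rV[F]_7 -> L})).
Local Notation Z j := (ext (frc j \o y2 : {linear 'rV[F]_7 -> L})).

Lemma eq_ext (g h : 'rV[F]_7 -> L) w : g =1 h -> ext g w = ext h w.
Proof. by move=> gh; apply: eq_bigr => j _; rewrite gh. Qed.

Lemma coords_separation w : ext eL w = 0 -> (forall j, Y j w = 0) -> (forall j, Z j w = 0) ->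
  w = 0.
Proof.
move=> Ew Yw Zw; apply: (ext_separation dimL iotaE Ew).
- by rewrite -(Yw 0); apply: eq_ext => v; rewrite /= frcE.
- by rewrite -(Yw 1); apply: eq_ext => v; rewrite /= frcE.
- by rewrite -(Yw 2); apply: eq_ext => v; rewrite /= frcE.
- by rewrite -(Zw 0); apply: eq_ext => v; rewrite /= frcE.
- by rewrite -(Zw 1); apply: eq_ext => v; rewrite /= frcE.
- by rewrite -(Zw 2); apply: eq_ext => v; rewrite /= frcE.
Qed.

Lemma extended_spread_line (U : {vspace 'rV[F]_7}) a b :
  (forall v, v \in U -> e v = 0 /\ a * y2 v = b * y1 v) ->
  forall w, w \in extend L U -> forall j, frc j a * Z j w = frc j b * Y j w.
Proof.
move=> Uab w wU j; apply/eqP; rewrite -subr_eq0; apply/eqP.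
pose f : {linear 'rV[L]_7 -> L^o} :=
  ((frc j a : L) \*: (Z j : {linear 'rV[L]_7 -> L^o}) \-
   (frc j b : L) \*: (Y j : {linear 'rV[L]_7 -> L^o})).
apply: (extend_kernel (f := f) _ wU) => u /Uab[_ E].
rewrite /f /= !ext_emb /= -[_ *: _]/(frc j a * _) -[X in _ - X]/(frc j b * _).
by rewrite -!frcM E subrr.
Qed.

(** The line meets the extended spread planes with y1 : y2 equal to 1:0, 0:1, 1:1 and 1:z. The first
    two points span it; the other two show that z^(q^j) has the same value for all j at which the
    first point has a nonzero coordinate. Conjugates of z being distinct, one index i remains. *)
Lemma transversal_of_spread g : transversal_line H Sp g ->
  exists i, forall w, ext eL w = 0 -> (forall j, j != i -> Y j w = 0 /\ Z j w = 0) -> w \in g.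
Proof.
move=> [dg gH _ gS]; have [z nz] := fr_nontrivial dimL.
have Eg w : w \in g -> ext eL w = 0.
  move=> wg; apply: (extend_kernel (f := ext eL) _ (subvP gH _ wg)) => u.
  by rewrite eH => /eqP eu; rewrite /= ext_emb /= /lift_functional eu scale0r.
have meet a b : (a != 0) || (b != 0) -> exists w, [/\ w != 0, w \in g &
    forall j, frc j a * Z j w = frc j b * Y j w].
  move=> /spread_line[U [SU Uab]]; have gU := gS U SU.
  exists (vpick (g :&: extend L U)); rewrite vpick0 gU.
  have := memv_pick (g :&: extend L U); rewrite memv_cap => /andP[-> pU]; split=> //.
  exact: extended_spread_line Uab _ pU.
have n1 : (1 : L) != 0 := oner_neq0 L.
have [|w0 [w00 w0g w0E]] := meet 1 0; first by rewrite n1.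
have [|wi [wi0 wig wiE]] := meet 0 1; first by rewrite n1 orbT.
have [|w1 [w10 w1g w1E]] := meet 1 1; first by rewrite n1.
have [|wz [wz0 wzg wzE]] := meet 1 z; first by rewrite n1.
have frc0 j : frc j 0 = 0 by rewrite linear0.
have Z0 j : Z j w0 = 0 by have := w0E j; rewrite frc1 frc0 mul1r mul0r.
have Y0 j : Y j wi = 0 by have := wiE j; rewrite frc1 frc0 mul1r mul0r.
have ZY1 j : Z j w1 = Y j w1 by have := w1E j; rewrite frc1 !mul1r.
have ZYz j : Z j wz = frc j z * Y j wz by have := wzE j; rewrite frc1 mul1r.
have gE : g = (<[w0]> + <[wi]>)%VS.
  apply/esym/eqP; rewrite eqEdim subv_add -!memvE w0g wig dg dim_add_lines ?dim_vline ?w00 ?wi0 //.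
  move/(vline_eqP _ w00) => [c c0 E]; case/eqP: w00.
  apply: coords_separation => // [|j]; first exact: Eg.
  by rewrite E linearZ /= Y0 scaler0.
have dec w : w \in g -> exists x y : L, forall j, Y j w = x * Y j w0 /\ Z j w = y * Z j wi.
  rewrite gE => /memv_addP[_ /vlineP[x ->] [_ /vlineP[y ->] ->]]; exists x, y => j.
  by rewrite !linearD /= !linearZ /= Z0 Y0 !scaler0 addr0 add0r.
have [x [y xyE]] := dec _ w1g; have [x' [y' xyE']] := dec _ wzg.
have [i Yi] : exists i, Y i w0 != 0.
  apply: contrapT => /forallNP no; case/eqP: w00.
  by apply: coords_separation; [exact: Eg|move=> j; apply/eqP/negPn/negP|].
have x0 : x != 0.
  apply: contraNneq w10 => x0; apply/eqP/coords_separation; first exact: Eg.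
    by move=> j; rewrite (proj1 (xyE j)) x0 mul0r.
  by move=> j; rewrite ZY1 (proj1 (xyE j)) x0 mul0r.
have x'0 : x' != 0.
  apply: contraNneq wz0 => x0'; apply/eqP/coords_separation; first exact: Eg.
    by move=> j; rewrite (proj1 (xyE' j)) x0' mul0r.
  by move=> j; rewrite ZYz (proj1 (xyE' j)) x0' mul0r mulr0.
have k1 j : y * Z j wi = x * Y j w0.
  by rewrite -(proj2 (xyE j)) ZY1 (proj1 (xyE j)).
have kz j : y' * Z j wi = frc j z * (x' * Y j w0).
  by rewrite -(proj2 (xyE' j)) ZYz (proj1 (xyE' j)).
have y0 : y != 0.
  apply: contraNneq Yi => y0; have := k1 i; rewrite y0 mul0r => /esym/eqP.
  by rewrite mulf_eq0 (negPf x0).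
have kz' j : Y j w0 != 0 -> frc j z = y' * x / (x' * y).
  move=> Yj; apply: (mulIf Yj); apply: (mulfI (mulf_neq0 x'0 y0)).
  transitivity (y * (frc j z * (x' * Y j w0))); first by ring.
  rewrite -kz; transitivity (y' * (y * Z j wi)); first by ring.
  by rewrite k1; field; rewrite y0 x'0.
have Yj0 j : j != i -> Y j w0 = 0 :> L.
  by move=> ji; apply: contraNeq ji => Yj; apply/eqP/(frc_inj_index nz); rewrite !kz'.
have Zj0 j : j != i -> Z j wi = 0 :> L.
  by move=> ji; apply: (mulfI y0); rewrite k1 Yj0 // !mulr0.
have Zi : Z i wi != 0.
  apply: contraNneq Yi => Zi; have := k1 i; rewrite Zi mulr0 => /esym/eqP.
  by rewrite mulf_eq0 (negPf x0).
have so (c : L) (d : L^o) : c *: d = c * d := erefl.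
have so0 (c : L) (d : L^o) : d = 0 -> c * d = 0 by move=> ->; exact: mulr0.
exists i => w Ew wE.
have -> : w = (Y i w / Y i w0) *: w0 + (Z i w / Z i wi) *: wi.
  apply/eqP; rewrite -subr_eq0; apply/eqP; apply: coords_separation => [|j|j];
    rewrite linearB /= linearD /= !linearZ /=.
  - by rewrite Ew !Eg // !scaler0 addr0 subr0.
  - rewrite Y0 scaler0 addr0 so.
    have [->|ji] := eqVneq j i; first by rewrite divfK // subrr.
    by rewrite (so0 _ _ (Yj0 j ji)) subr0; case: (wE j ji).
  - rewrite Z0 scaler0 add0r so.
    have [->|ji] := eqVneq j i; first by rewrite divfK // subrr.
    by rewrite (so0 _ _ (Zj0 j ji)) subr0; case: (wE j ji).
by rewrite memvD ?memvZ.
Qed.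

Lemma eL_coord_inj u v : eL u = eL v -> y1 u = y1 v -> y2 u = y2 v -> u = v.
Proof.
move=> eE; apply: (coord_inj iotaE); apply/eqP; rewrite -subr_eq0 -(alg_eq0 L).
by rewrite scalerBl subr_eq0; apply/eqP.
Qed.

Lemma linear_cubic_ds (g : {linear 'rV[F]_7 -> L}) (A : 'M[F]_(4, 7)) (a b : F) :
  g (cubic_ds a b *m A) = 3%:R * a%:A ^+ 2 * g (row 0 A) +
    2%:R * a%:A * b%:A * g (row 1 A) + b%:A ^+ 2 * g (row 2 A).
Proof.
rewrite mulmx_sum_row linear_sum sum4 !linearZ /= !cubic_dsE -![_ *: g _]mulr_algl.
by rewrite -![_%:A]/(in_alg L _); ring.
Qed.

Lemma linear_cubic_dt (g : {linear 'rV[F]_7 -> L}) (A : 'M[F]_(4, 7)) (a b : F) :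
  g (cubic_dt a b *m A) = a%:A ^+ 2 * g (row 1 A) +
    2%:R * a%:A * b%:A * g (row 2 A) + 3%:R * b%:A ^+ 2 * g (row 3 A).
Proof.
rewrite mulmx_sum_row linear_sum sum4 !linearZ /= !cubic_dtE -![_ *: g _]mulr_algl.
by rewrite -![_%:A]/(in_alg L _); ring.
Qed.

(** In the chart e = 1 the subplane is, up to translation and a factor in [F], the set of pairs (al
    t^q / t, al' t^(q^2) / t). This is its formal differential at t in the direction t u, Frobenius
    being [F]-linear. *)
Definition tangent_direction (t u : L) : 'rV[F]_7 :=
  iota 0 (al * (fr t / t) * (fr u - u)) (al' * (fr (fr t) / t) * (fr (fr u) - u)).

Lemma tangent_direction_linear t : linear (tangent_direction t).
Proof.
move=> k u w; rewrite /tangent_direction -(iota_linear iotaK iotaE) mulr0 addr0.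
have scE (z : L) : k *: z = in_alg L k * z by rewrite /= mulr_algl.
by congr iota; rewrite !frE !scE; ring.
Qed.

HB.instance Definition _ t := GRing.isLinear.Build F L 'rV[F]_7 *:%R (tangent_direction t)
  (tangent_direction_linear t).

Definition tangent_plane (t : L) : {vspace 'rV[F]_7} :=
  (<[affine_param t]> + limg (linfun (tangent_direction t)))%VS.

Lemma tangent_direction_mem t u : tangent_direction t u \in limg (linfun (tangent_direction t)).
Proof. by rewrite -[tangent_direction t u]lfunE memv_img ?memvf. Qed.

Lemma dim_tangent_direction t : t != 0 ->
  \dim (limg (linfun (tangent_direction t))) = 2%N.
Proof.
move=> t0; have kE : lker (linfun (tangent_direction t)) = 1%VS.
  apply/vspaceP => u; rewrite memv_ker lfunE /=; apply/eqP/vlineP => [|[k ->]].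
    move/(congr1 y1); rewrite (y1_iota iotaK) linear0 => /eqP.
    rewrite !mulf_eq0 (negPf al0) invr_eq0 fr_eq0 (negPf t0) /= subr_eq0.
    by move=> /eqP /fr_fixed.
  by rewrite /tangent_direction !fr_alg subrr !mulr0 (iota0 iotaE).
by have := limg_ker_dim (linfun (tangent_direction t)) fullv;
  rewrite capfv kE dimv1 dimL add1n => -[].
Qed.

Lemma tangent_plane_meet t : t != 0 ->
  (tangent_plane t :&: H)%VS = limg (linfun (tangent_direction t)).
Proof.
move=> t0; have dH' u : tangent_direction t u \in H by rewrite eH (e_iota iotaK).
apply/vspaceP => v; rewrite memv_cap; apply/andP/idP => [[]|vG]; last first.
  have [u _ vE] := memv_imgP vG; rewrite {2}vE lfunE dH'; split=> //.
  exact: (subvP (addvSr _ _)).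
move=> /memv_addP[_ /vlineP[c ->] [w wG ->]] vH.
have wH : w \in H by have [u _ ->] := memv_imgP wG; rewrite lfunE dH'.
have cH : c *: affine_param t \in H by rewrite -[_ *: _](addrK w) memvB.
have [->|c0] := eqVneq c 0; first by rewrite scale0r add0r.
by case/negP: (affine_param_notin t0); rewrite -(scalerK c0 (affine_param t)) memvZ.
Qed.

Lemma dim_tangent_plane t : t != 0 -> \dim (tangent_plane t) = 3%N.
Proof.
move=> t0; have Phi0 : affine_param t != 0.
  by apply: contraNneq (affine_param_notin t0) => ->; rewrite mem0v.
rewrite /tangent_plane dimv_disjoint_sum ?dim_tangent_direction ?dim_vline ?Phi0 //.
apply/eqP; rewrite -subv0; apply/subvP=> v; rewrite memv_cap => /andP[/vlineP[c ->] cG].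
have : c *: affine_param t \in H.
  by move: cG; rewrite -tangent_plane_meet // memv_cap => /andP[].
move=> cH; have [->|c0] := eqVneq c 0; first by rewrite scale0r mem0v.
by case/negP: (affine_param_notin t0); rewrite -(scalerK c0 (affine_param t)) memvZ.
Qed.

(** The second conjugate of u^q - u is u - u^(q^2), so y2 / y1^(q^2) does not depend on u; the sign
    and N(al') = N(al) give it norm -1. *)
Lemma tangent_plane_cover t : t != 0 ->
  exists2 U, fr2_family iota U & (tangent_plane t :&: H <= U)%VS.
Proof.
move=> t0; rewrite tangent_plane_meet //.
have ft : fr t != 0 by rewrite fr_eq0.
have fft : fr (fr t) != 0 by rewrite fr_eq0.
have f2al : fr (fr al) != 0 by rewrite !fr_eq0.
pose c := - (al' * (fr (fr t) / t) ^+ 2) / fr (fr al).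
have c1 : nrm c = -1.
  rewrite /c nrmM nrmV nrmN nrmM expr2 !nrmM nrmV !nrm_fr // nal divff ?nrm_eq0 //.
  by rewrite !mulr1 mulNr divff // nrm_eq0.
exists (fr2_graph iota c); first by exists c.
apply/subvP => _ /memv_imgP[u _ ->]; rewrite lfunE (mem_fr2_graph iotaK iotaE).
rewrite (e_iota iotaK) (y1_iota iotaK) (y2_iota iotaK) eqxx /=; apply/eqP.
rewrite !frE !fr3 // /c; field.
by apply/and3P; split; [exact: fft|exact: f2al|].
Qed.

(* The derivative of the parametrisation at t in the direction h is, up to a multiple of
   the point itself, the direction tangent_direction t (h / t). *)
Lemma tangent_plane_derivative t h w : t != 0 ->
  eL w = K%:A * trc (h * fr t * fr (fr t)) ->
  y1 w = al * (2%:R * fr t * fr h * fr (fr t) + fr t ^+ 2 * fr (fr h)) +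
    be * trc (h * fr t * fr (fr t)) ->
  y2 w = al' * (fr h * fr (fr t) ^+ 2 + 2%:R * fr t * fr (fr t) * fr (fr h)) +
    be' * trc (h * fr t * fr (fr t)) ->
  w \in tangent_plane t.
Proof.
move=> t0 ew y1w y2w; have [k kE] := trc_in_F dimL (h / t).
have ft : fr t != 0 by rewrite fr_eq0.
have fft : fr (fr t) != 0 by rewrite fr_eq0.
have trE : trc (h * fr t * fr (fr t)) = k%:A * nrm t.
  by rewrite -kE /trc /nrm !frE !fr3 //; field;
     do ?[apply/andP; split]; first [exact: t0|exact: ft|exact: fft].
have KE : (K * nF t)%:A = K%:A * nrm t by rewrite -nFE mulr_algl scalerA.
have -> : w = k *: affine_param t + tangent_direction t (nF t *: (h / t)).
  apply: eL_coord_inj; rewrite linearD linearZ /= -[k *: _]mulr_algl.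
  - by rewrite ew trE /lift_functional !(e_iota iotaK) scale0r addr0 KE mulrCA.
  - rewrite y1w trE !(y1_iota iotaK) -[nF t *: _]mulr_algl nFE -kE /trc /nrm !frE !fr3 //.
    by field; do ?[apply/andP; split]; first [exact: t0|exact: ft|exact: fft].
  - rewrite y2w trE !(y2_iota iotaK) -[nF t *: _]mulr_algl nFE -kE /trc /nrm !frE !fr3 //.
    by field; do ?[apply/andP; split]; first [exact: t0|exact: ft|exact: fft].
by rewrite memv_add ?memvZ ?memv_line ?tangent_direction_mem.
Qed.

Section TangentCubic.
Variables x y : L.
Hypothesis xy_free : forall a b : F, a *: x + b *: y = 0 -> a = 0 /\ b = 0.
Variable n : 'I_4 -> F.
Hypothesis nE : forall j, (n j)%:A = tri x y (fr x) (fr y) (fr (fr x)) (fr (fr y)) j.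

(** The restriction of [affine_param] to the [F]-span of x and y. With l0, l1, l2 the conjugates of
    the linear form with coefficients x and y, the coordinates combine l0 l1 l2, l1^2 l2 and l1
    l2^2, whose coefficients [tri] lists. *)
Definition tangent_cubic : 'M[F]_(4, 7) := \matrix_(j < 4)
  iota (K * n j)
    (al * tri (fr x) (fr y) (fr x) (fr y) (fr (fr x)) (fr (fr y)) j + be * (n j)%:A)
    (al' * tri (fr x) (fr y) (fr (fr x)) (fr (fr y)) (fr (fr x)) (fr (fr y)) j + be' * (n j)%:A).

Local Notation A := tangent_cubic.

Lemma tangent_cubic_eL j : eL (row j A) =
  K%:A * tri x y (fr x) (fr y) (fr (fr x)) (fr (fr y)) j.
Proof. by rewrite rowK /= /lift_functional (e_iota iotaK) -nE mulr_algl scalerA. Qed.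

Lemma tangent_cubic_y1 j : y1 (row j A) =
  al * tri (fr x) (fr y) (fr x) (fr y) (fr (fr x)) (fr (fr y)) j +
  be * tri x y (fr x) (fr y) (fr (fr x)) (fr (fr y)) j.
Proof. by rewrite rowK (y1_iota iotaK) nE. Qed.

Lemma tangent_cubic_y2 j : y2 (row j A) =
  al' * tri (fr x) (fr y) (fr (fr x)) (fr (fr y)) (fr (fr x)) (fr (fr y)) j +
  be' * tri x y (fr x) (fr y) (fr (fr x)) (fr (fr y)) j.
Proof. by rewrite rowK (y2_iota iotaK) nE. Qed.

Lemma tangent_cubic_param (a b : F) : cubic_row a b *m A = affine_param (a *: x + b *: y).
Proof.
set t := a *: x + b *: y.
have tE : t = a%:A * x + b%:A * y by rewrite !mulr_algl.
have ft : fr t = a%:A * fr x + b%:A * fr y by rewrite tE !frE.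
have fft : fr (fr t) = a%:A * fr (fr x) + b%:A * fr (fr y) by rewrite ft !frE.
have KE : (K * nF t)%:A = K%:A * nrm t by rewrite -nFE mulr_algl scalerA.
apply: eL_coord_inj; rewrite linear_cubic.
- rewrite (eq_cform _ _ tangent_cubic_eL) cformZ cform_tri /= /lift_functional.
  by rewrite (e_iota iotaK) KE /nrm fft ft tE.
- rewrite (eq_cform _ _ tangent_cubic_y1) cformD !cformZ !cform_tri (y1_iota iotaK).
  by rewrite /nrm fft ft tE; ring.
- rewrite (eq_cform _ _ tangent_cubic_y2) cformD !cformZ !cform_tri (y2_iota iotaK).
  by rewrite /nrm fft ft tE; ring.
Qed.

Lemma minor_neq0 : x * fr y - fr x * y != 0.
Proof.
have n10 : (1 : F) <> 0 by apply/eqP/oner_neq0.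
have y0 : y != 0.
  by apply/eqP => y0; have [] := @xy_free 0 1; rewrite ?y0 ?scaler0 ?scale0r ?addr0.
rewrite subr_eq0; apply/eqP => E.
have [c cE] : exists c : F, x / y = c%:A.
  by apply: fr_fixed; rewrite frM frV; apply/eqP; rewrite eqr_div ?fr_eq0 // E mulrC.
have [] // := @xy_free 1 (- c).
by rewrite scale1r scaleNr -[c *: y]mulr_algl -cE divfK // subrr.
Qed.

(** A relation between the rows has coefficients in [F], so Frobenius carries it from l1^2 l2 and l1
    l2^2 to l0 l2^2 and l0 l1^2, and [tri_span] applies. *)
Lemma tangent_cubic_free : row_free A.
Proof.
apply: inj_row_free => r rA.
have rg (g : {linear 'rV[F]_7 -> L}) : \sum_j (r 0 j)%:A * g (row j A) = 0.
  rewrite -[RHS](linear0 g) -[in RHS]rA mulmx_sum_row linear_sum; apply: eq_bigr => j _.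
  by rewrite linearZ mulr_algl.
have sumD (p q : 'I_4 -> L) c d : \sum_j (r 0 j)%:A * (c * p j + d * q j) =
    c * (\sum_j (r 0 j)%:A * p j) + d * (\sum_j (r 0 j)%:A * q j).
  by rewrite !mulr_sumr -big_split; apply: eq_bigr => j _ /=; ring.
have frsum (p : 'I_4 -> L) : \sum_j (r 0 j)%:A * p j = 0 -> \sum_j (r 0 j)%:A * fr (p j) = 0.
  move=> /(congr1 (@fr F L)); rewrite fr0 rmorph_sum /= => E; rewrite -[RHS]E.
  by apply: eq_bigr => j _; rewrite !frE.
have e012 : \sum_j (r 0 j)%:A * tri x y (fr x) (fr y) (fr (fr x)) (fr (fr y)) j = 0.
  have KL : K%:A != 0 :> L by rewrite alg_eq0.
  apply: (mulfI KL).
  rewrite mulr0 -[RHS](rg eL) mulr_sumr; apply: eq_bigr => j _.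
  by rewrite tangent_cubic_eL mulrCA.
have e112 : \sum_j (r 0 j)%:A * tri (fr x) (fr y) (fr x) (fr y) (fr (fr x)) (fr (fr y)) j = 0.
  apply: (mulfI al0); rewrite mulr0 -[RHS](rg y1).
  under [RHS]eq_bigr do rewrite tangent_cubic_y1.
  by rewrite sumD e012 mulr0 addr0.
have e122 : \sum_j (r 0 j)%:A *
    tri (fr x) (fr y) (fr (fr x)) (fr (fr y)) (fr (fr x)) (fr (fr y)) j = 0.
  apply: (mulfI al'0); rewrite mulr0 -[RHS](rg y2).
  under [RHS]eq_bigr do rewrite tangent_cubic_y2.
  by rewrite sumD e012 mulr0 addr0.
have e022 : \sum_j (r 0 j)%:A * tri x y (fr (fr x)) (fr (fr y)) (fr (fr x)) (fr (fr y)) j = 0.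
  rewrite -[RHS](frsum _ e112); apply: eq_bigr => j _; congr (_ * _).
  by case: j => [[|[|[|[|//]]]] ?]; rewrite /tri /= !frE !fr3 //; ring.
have e011 : \sum_j (r 0 j)%:A * tri x y (fr x) (fr y) (fr x) (fr y) j = 0.
  rewrite -[RHS](frsum _ (frsum _ e122)); apply: eq_bigr => j _; congr (_ * _).
  by case: j => [[|[|[|[|//]]]] ?]; rewrite /tri /= !frE !fr3 //; ring.
have d01 := minor_neq0.
have d12 : fr x * fr (fr y) - fr (fr x) * fr y != 0.
  by have := d01; rewrite -fr_eq0 !frE.
have d20 : fr (fr x) * y - x * fr (fr y) != 0.
  by have := d12; rewrite -fr_eq0 !frE !fr3.
have r0 := tri_span d01 d12 d20 e112 e122 e011 e022.
by apply/rowP => j; rewrite mxE; apply/eqP; rewrite -(alg_eq0 L) r0.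
Qed.

Hypothesis dH : flats 5 H.
Hypothesis spread_graph : forall c, nrm c = -1 -> Sp (id_graph iota c).
Variable a : L.
Hypotheses (a0 : a != 0) (trx : trc (a * x) = 0) (try_ : trc (a * y) = 0).

Lemma tangent_cubic_relation (v : 'rV[F]_7) : v \in cubic_solid A -> e v = 0 ->
  al' * fr a * y1 v + al * fr (fr a) * y2 v = 0.
Proof.
(* The trace condition reads a l0 + a^q l1 + a^(q^2) l2 = 0. Multiplied by l1 l2 it relates e, y1
   and y2; at infinity the terms in e drop out and the equation of a spread plane is left. *)
pose f (u : 'rV[F]_7) : L := al' * fr a * (K%:A * y1 u - be * eL u) +
  al * fr (fr a) * (K%:A * y2 u - be' * eL u) + al * al' * a * eL u.
have flin : linear f.
  have scE (k : F) (z : L) : k *: z = in_alg L k * z by rewrite /= mulr_algl.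
  by move=> k u w; rewrite /f !linearP /= !(scE k); ring.
pose f' : {linear 'rV[F]_7 -> L} := HB.pack f (GRing.isLinear.Build F 'rV[F]_7 L *:%R f flin).
move=> vA ev; have : (cubic_solid A <= lker (linfun f'))%VS.
  apply/span_subvP => _ /mapP[j _ ->]; rewrite memv_ker lfunE /= /f.
  rewrite tangent_cubic_eL tangent_cubic_y1 tangent_cubic_y2.
  have t0 : tri (fr x) (fr y) (fr (fr x)) (fr (fr y)) (trc (a * x)) (trc (a * y)) j = 0.
    rewrite trx try_; case: j => [[|[|[|[|//]]]] ?]; rewrite /tri /=; ring.
  apply/eqP; rewrite -[RHS](mulr0 (K%:A * al * al')) -t0.
  by case: j {t0} => [[|[|[|[|//]]]] ?]; rewrite /tri /trc /= !frE; ring.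
move/subvP/(_ v vA); rewrite memv_ker lfunE /= /f /eL /= /lift_functional ev scale0r.
rewrite !mulr0 !subr0 addr0 => /eqP E.
apply: (mulfI (_ : K%:A != 0 :> L)); first by rewrite alg_eq0.
by rewrite mulr0 -[RHS]E; ring.
Qed.

Lemma tangent_cubic_not_at_infinity : ~~ (cubic_solid A <= H)%VS.
Proof.
have x0 : x != 0.
  apply/eqP => x0; have [|/eqP] := @xy_free 1 0; rewrite ?x0 ?scaler0 ?scale0r ?addr0 //.
  by rewrite oner_eq0.
apply/negP => /subvP/(_ _ (cubic_solid_rows A 0)).
rewrite eH -(eL_eq0 L) -/eL tangent_cubic_eL -[tri _ _ _ _ _ _ 0]/(nrm x).
by rewrite mulf_eq0 alg_eq0 (negPf K0) nrm_eq0 (negPf x0).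
Qed.

Lemma tangent_cubic_plane : exists2 U, Sp U & (U <= cubic_solid A)%VS.
Proof.
pose c := - (al' * fr a) / (al * fr (fr a)).
have al'n := al'0; have fa : fr a != 0 by rewrite fr_eq0.
have ffa : fr (fr a) != 0 by rewrite fr_eq0.
have c1 : nrm c = -1.
  by rewrite /c nrmM nrmV nrmN !nrmM nal !nrm_fr // mulNr divff // mulf_neq0 // nrm_eq0.
exists (id_graph iota c); first exact: spread_graph.
have sub : (cubic_solid A :&: H <= id_graph iota c)%VS.
  apply/subvP=> v; rewrite memv_cap eH (mem_id_graph iotaK iotaE) => /andP[vA /eqP ev].
  have := tangent_cubic_relation vA ev => E; rewrite ev eqxx /=; apply/eqP.
  have n2 : al * fr (fr a) != 0 by rewrite mulf_neq0.
  apply: (mulfI n2); rewrite mulrA [_ * c]mulrC /c divfK //.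
  by apply/eqP; rewrite -subr_eq0 mulNr opprK addrC E.
have d4 : (4 <= \dim (cubic_solid A))%N.
  pose phi : 'Hom('rV[F]_4, 'rV[F]_7) := linfun (mulmxr A).
  have dl : \dim (limg phi) = 4%N.
    rewrite limg_dim_eq; first by rewrite dimvf /dim /= mul1n.
    apply/eqP; rewrite -subv0; apply/subvP => r; rewrite memv_cap memv_ker lfunE /=.
    by rewrite mulmx_free_eq0 ?tangent_cubic_free // memv0 => /andP[].
  apply: (leq_trans (eq_leq (esym dl))).
  apply: dimvS; apply/subvP => _ /memv_imgP[r _ ->]; rewrite lfunE /= mulmx_sum_row.
  by apply: memv_suml => j _; rewrite memvZ // cubic_solid_rows.
have d3 : (3 <= \dim (cubic_solid A :&: H))%N.
  have := dimv_sum_cap (cubic_solid A) H.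
  have : (\dim (cubic_solid A + H) <= 7)%N.
    by rewrite (leq_trans (dimvS (subvf _))) // dimvf /dim /= mul1n.
  rewrite dH => d7 E; rewrite -(leq_add2l 7).
  have d10 : (4 + 6 <= \dim (cubic_solid A) + 6)%N by rewrite leq_add2r.
  by apply: leq_trans d10 _; rewrite -E leq_add2r.
have /eqP <- : (cubic_solid A :&: H == id_graph iota c)%VS.
  by rewrite eqEdim sub (dim_graph dimL iotaK iotaE).
exact: capvSl.
Qed.

Lemma tangent_cubic_special : special_twisted_cubic L H Sp A.
Proof.
split; [exact: tangent_cubic_free|exact: tangent_cubic_not_at_infinity|
  exact: tangent_cubic_plane|].
move=> g /transversal_of_spread[i gi].
have y0 : y != 0.
  apply/eqP => y0; have [|_ /eqP] := @xy_free 0 1; rewrite ?y0 ?scaler0 ?scale0r ?addr0 //.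
  by rewrite oner_eq0.
(* The root of l_i. There e = 0, and for j other than i the j-th conjugates of y1 and y2 contain the
   factor l_i. *)
exists (frc i y), (- frc i x); split.
  by rewrite xpair_eqE negb_and; case: (ord3 i) => ->; rewrite !frcE ?fr_eq0 y0.
apply: gi.
  rewrite ext_cubic (eq_cform _ _ tangent_cubic_eL) cformZ cform_tri.
  by case: (ord3 i) => ->; rewrite !frcE; ring.
have Yc j s' t' : ext (frc j \o y1 : {linear 'rV[F]_7 -> L}) (cubic_row s' t' *m emb A) =
    frc j al * cform (frc j \o tri (fr x) (fr y) (fr x) (fr y) (fr (fr x)) (fr (fr y))) s' t' +
    frc j be * cform (frc j \o tri x y (fr x) (fr y) (fr (fr x)) (fr (fr y))) s' t'.
  rewrite ext_cubic -!cformZ -cformD; apply: eq_cform => k.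
  by rewrite /= tangent_cubic_y1 linearD /= !frcM.
have Zc j s' t' : ext (frc j \o y2 : {linear 'rV[F]_7 -> L}) (cubic_row s' t' *m emb A) =
    frc j al' * cform (frc j \o
      tri (fr x) (fr y) (fr (fr x)) (fr (fr y)) (fr (fr x)) (fr (fr y))) s' t' +
    frc j be' * cform (frc j \o tri x y (fr x) (fr y) (fr (fr x)) (fr (fr y))) s' t'.
  rewrite ext_cubic -!cformZ -cformD; apply: eq_cform => k.
  by rewrite /= tangent_cubic_y2 linearD /= !frcM.
have ftri j p0 q0 p1 q1 p2 q2 s' t' : cform (frc j \o tri p0 q0 p1 q1 p2 q2) s' t' =
    (s' * frc j p0 + t' * frc j q0) * (s' * frc j p1 + t' * frc j q1) *
    (s' * frc j p2 + t' * frc j q2).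
  rewrite -cform_tri; apply: eq_cform => k; rewrite /=.
  by case: k => [[|[|[|[|//]]]] ?]; rewrite /tri /= ?linearD /= !frcM.
move=> j ji; rewrite Yc Zc !ftri; case: (ord3 i) ji => ->; case: (ord3 j) => -> //= _;
  by rewrite !frcE ?fr3 //; split; ring.
Qed.

(** The two partial derivatives at (p, k) are the derivatives of [affine_param] at t = p x + k y in
    the directions x and y. *)
Lemma cubic_tangent_plane (p k : F) : p *: x + k *: y != 0 ->
  (cubic_tangent A p k <= tangent_plane (p *: x + k *: y))%VS.
Proof.
set t := p *: x + k *: y => t0.
have tE : t = p%:A * x + k%:A * y by rewrite !mulr_algl.
have ft : fr t = p%:A * fr x + k%:A * fr y by rewrite tE !frE.
have fft : fr (fr t) = p%:A * fr (fr x) + k%:A * fr (fr y) by rewrite ft !frE.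
rewrite /cubic_tangent !subv_add -!memvE tangent_cubic_param.
rewrite (subvP (addvSl _ _)) ?memv_line //=; clearbody t; apply/andP; split.
- apply: (tangent_plane_derivative (h := x) t0);
    rewrite linear_cubic_ds ?tangent_cubic_eL ?tangent_cubic_y1 ?tangent_cubic_y2 /tri /=
      /trc !frE !fr3 // fft ft ?tE; ring.
- apply: (tangent_plane_derivative (h := y) t0);
    rewrite linear_cubic_dt ?tangent_cubic_eL ?tangent_cubic_y1 ?tangent_cubic_y2 /tri /=
      /trc !frE !fr3 // fft ft ?tE; ring.
Qed.

End TangentCubic.

Lemma tri_in_F (x y : L) j : exists c : F,
  tri x y (fr x) (fr y) (fr (fr x)) (fr (fr y)) j = c%:A.
Proof.
by apply: fr_fixed; case: j => [[|[|[|[|//]]]] ?]; rewrite /tri /= !frE !fr3 //; ring.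
Qed.

Lemma rmorph_trc t : s (trc t) = trc (s t).
Proof. by rewrite /trc !rmorphD /= !rmorph_fr. Qed.

Lemma affine_param_on_line a t : t != 0 ->
  (beta <[affine_param t]> <= fr_line (s a) shape_subplane_mx)%VS <-> trc (a * t) = 0.
Proof.
move=> t0; rewrite beta_affine_param // -memvE mem_fr_line ?shape_subplane_unit //.
rewrite tform_frow -rmorphM -rmorph_trc fmorph_eq0; split=> [/eqP|->] //.
Qed.

Lemma affine_param_affine t : t != 0 -> affine_point H <[affine_param t]>%VS.
Proof.
move=> t0; have vH := affine_param_notin t0; split; last by rewrite -memvE.
by rewrite /flats /= dim_vline; case: eqP vH => // ->; rewrite mem0v.
Qed.

(** Lines through the point of parameter t correspond to a with Tr(a t) = 0. Each carries a
    [tangent_cubic], and all tangents lie in one plane because [tangent_plane t] does not involve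
    a. *)
Lemma shape_tangent_cover : flats 5 H ->
  (forall c, nrm c = -1 -> Sp (id_graph iota c)) ->
  is_cover #|F| H (splash_planes Sp linf beta (fr_subplane shape_subplane_mx))
    (fr2_family iota) ->
  tangent_cover H Sp linf beta (fr_subplane shape_subplane_mx) (fr2_family iota).
Proof.
move=> dH spread_graph coverT; split=> // P aP piP.
have [t t0 PE] := affine_param_surj aP piP.
exists (tangent_plane t); split.
- exact: dim_tangent_plane.
- move=> l /(subplane_line_fr dimL _ shape_subplane_unit)[a' a'0 lE] Pl.
  have [s' ss' s's] := sbij; pose a := s' a'; have sa : s a = a' by rewrite /a s's.
  have a0 : a != 0 by rewrite -(fmorph_eq0 s) sa.
  have [x [y [xy_free xyE]]] := trace_kernel_basis dimL a0.
  have /choice [n nE] := tri_in_F x y.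
  have {}nE j : (n j)%:A = tri x y (fr x) (fr y) (fr (fr x)) (fr (fr y)) j by [].
  have trx : trc (a * x) = 0 by apply/xyE; exists 1, 0; rewrite scale1r scale0r addr0.
  have try_ : trc (a * y) = 0 by apply/xyE; exists 0, 1; rewrite scale1r scale0r add0r.
  have /xyE[p [k tE]] : trc (a * t) = 0.
    by apply/(affine_param_on_line _ t0); rewrite sa -lE -PE.
  have nz (b c : F) : b *: x + c *: y != 0 -> (b, c) != (0, 0).
    by apply: contraNneq => -[-> ->]; rewrite !scale0r addr0.
  exists (tangent_cubic x y n), p, k; split.
  + exact: (tangent_cubic_special xy_free nE dH spread_graph a0 trx try_).
  + apply/seteqP; split=> Q.
    * move=> [b [c [bc ->]]]; rewrite (tangent_cubic_param nE).
      have r0 : b *: x + c *: y != 0.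
        by apply: contraNneq bc => /xy_free[-> ->].
      split; first exact: affine_param_affine.
        by exists (s (b *: x + c *: y)); rewrite ?fmorph_eq0 // beta_affine_param.
      by rewrite lE -sa; apply/affine_param_on_line => //; apply/xyE; exists b, c.
    * move=> [aQ piQ Ql]; have [r r0 QE] := affine_param_surj aQ piQ.
      have /xyE[b [c rE]] : trc (a * r) = 0.
        by apply/(affine_param_on_line _ r0); rewrite sa -lE -QE.
      exists b, c; split; first by apply: nz; rewrite -rE.
      by rewrite (tangent_cubic_param nE) -rE.
  + by apply: nz; rewrite -tE.
  + by rewrite (tangent_cubic_param nE) -tE.
  + by rewrite tE; apply: (cubic_tangent_plane nE); rewrite -tE.
- by rewrite tangent_plane_meet //; apply: dim_tangent_direction.
- exact: tangent_plane_cover.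
Qed.

End SubplaneInCoordinates.

Section ConicParameters.
Variables (F : finFieldType) (L : fieldExtType F).
Hypothesis dimL : \dim {:L} = 3%N.

(** The factor z^(q^2) - z^q is orthogonal to 1 and z under the trace form, and on z^2 it gives, up
    to sign, the Vandermonde product of the conjugates. So the kernel is the span of 1 and z. *)
Lemma trace_conj_difference (z r : L) : fr z != z ->
  trc ((fr (fr z) - fr z) * r) = 0 <-> exists p k : F, r = k%:A - p%:A * z.
Proof.
move=> nz; have nz2 := fr2_neq dimL nz.
set b := fr (fr z) - fr z.
have bE (c0 c1 c2 : F) : trc (b * (c0%:A + c1%:A * z + c2%:A * z ^+ 2)) =
    c2%:A * ((fr (fr z) - fr z) * (z - fr (fr z)) * (z - fr z)).
  by rewrite /trc /b !frE !fr3 //; ring.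
split=> [br|[p [k ->]]]; last first.
  by rewrite (_ : _ - _ = k%:A + (- p)%:A * z + (0 : F)%:A * z ^+ 2) ?bE scale0r ?scaleNr;
    ring.
have ufree := rational_free_powers dimL nz.
have [w wE] := theta_surj dimL ufree r.
have rE : r = (w 0 0)%:A + (w 0 1)%:A * z + (w 0 2)%:A * z ^+ 2.
  by rewrite -wE /theta sum3 !mxE expr0 expr1 !mulr_algl.
exists (- w 0 1), (w 0 0).
have w2 : (w 0 2)%:A = 0 :> L.
  move: br; rewrite rE bE => /eqP; rewrite !mulf_eq0 !subr_eq0 (inj_eq (@fr_inj F L)).
  by rewrite (negPf nz) ![z == _]eq_sym (negPf nz) (negPf nz2) !orbF => /eqP.
by rewrite {1}rE w2 mul0r addr0 scaleNr mulNr opprK.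
Qed.

End ConicParameters.

Theorem theorem3p6 (F : finFieldType) (L : fieldExtType F)
    (H : {vspace 'rV[F]_7}) (Sp : set {vspace 'rV[F]_7})
    (linf : {vspace 'rV[L]_3}) (beta : {vspace 'rV[F]_7} -> {vspace 'rV[L]_3})
    (SS X : set {vspace 'rV[F]_7}) (A : 'M[F]_(4, 7)) :
  (3 <= #|F|)%N -> \dim {:L} = 3%N ->
  flats 5 H -> regular_spread #|F| H Sp ->
  flats 1 linf -> bruck_bose H Sp linf beta ->
  exterior_splash Sp linf beta SS ->
  is_cover #|F| H SS X ->
  special_twisted_cubic L H X A ->
  let N := beta @` cubic_points A in
  exists pi : set {vspace 'rV[L]_3},
    [/\ unique (fun pi' => exterior_subplane linf pi' /\ N `<=` pi') pi,
        splash_planes Sp linf beta pi = SS,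
        conic_cover H Sp linf beta pi X &
        special_conic linf pi N].
Proof.
move=> F3 dimL dH [_ planesSp disjSp covSp _] dlinf betaP splashSS coverX.
have [M [s [e [y1 [y2 [iota [coo SSE XE]]]]]]] :=
  adapted_coordinates F3 dimL dH dlinf planesSp disjSp covSp betaP splashSS coverX.
rewrite XE => sA N; rewrite XE in coverX.
have [[MU lM] sbij [iotaK iotaE] eH [baff binf]] := coo.
have [z [K [al [al' [be [be' [nz K0 al0 nal Aparam]]]]]]] :=
  cubic_normal_form dimL iotaK iotaE eH sA.
have /choice [nF nFE'] := nrm_in_F dimL.
have nFE t : (nF t)%:A = nrm t by rewrite nFE'.
pose Msh := shape_subplane_mx M s K al al' be be'.
have MshU : Msh \in unitmx := shape_subplane_unit s MU be be' K0 al0 nal.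
have Mshinf : line_at_infinity linf Msh :=
  shape_line_at_infinity lM sbij al al' be be' K0.
pose phi := affine_param iota K al al' be be' nF.
(* The substitution t = 1 / r. The factor between the two vectors is N(r)^2, an element of [F], so
   the points agree in PG(6, q). *)
have point (p k : F) : (p, k) != (0, 0) -> let r := k%:A - p%:A * z in
    r != 0 /\ <[cubic_row p k *m A]>%VS = <[phi r^-1]>%VS.
  move=> pk r; have r0 : r != 0.
    rewrite subr_eq0; apply: contraNneq pk => E; have [p0|p0] := eqVneq p 0.
      by move/eqP: E; rewrite p0 scale0r mul0r alg_eq0 => /eqP ->.
    case/eqP: nz; have -> : z = (k / p)%:A; last by rewrite fr_alg.
    apply: (mulfI (_ : p%:A != 0)); first by rewrite alg_eq0.
    by rewrite -E mulr_algl scalerA mulrC divfK.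
  split=> //; have [ev y1v y2v] := Aparam p k.
  rewrite -/r in ev y1v y2v; clearbody r.
  have nr0 : nF r != 0 by rewrite -(alg_eq0 L) nFE nrm_eq0.
  rewrite -(vlineZ (phi r^-1) (mulf_neq0 nr0 nr0)); congr (<[_]>%VS).
  have fr0' : fr r != 0 by rewrite fr_eq0.
  have ffr0 : fr (fr r) != 0 by rewrite fr_eq0.
  have nn (x : L) : (nF r * nF r) *: x = nrm r ^+ 2 * x.
    by rewrite -scalerA -mulr_algl nFE -[_ *: x]mulr_algl nFE mulrA expr2.
  apply: (eL_coord_inj iotaE); rewrite linearZ /= nn.
  - rewrite [LHS]ev /lift_functional (e_iota iotaK).
    have -> : (K * nF r^-1)%:A = K%:A * nrm r^-1 by rewrite -nFE mulr_algl scalerA.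
    by rewrite nrmV; field; rewrite nrm_eq0.
  - rewrite y1v (y1_iota iotaK) nrmV !frE /nrm; field.
    by do ?[apply/andP; split]; first [exact: r0|exact: fr0'|exact: ffr0].
  - rewrite y2v (y2_iota iotaK) nrmV !frE /nrm; field.
    by do ?[apply/andP; split]; first [exact: r0|exact: fr0'|exact: ffr0].
have beta_phi t : t != 0 -> beta <[phi t]>%VS = <[frow (s t) *m Msh]>%VS.
  by move=> t0; apply: (beta_affine_param iotaK eH baff al al' be be' K0 nFE).
have NE : N = [set P | exists t, [/\ t != 0, trc (s (fr (fr z) - fr z) / t) = 0 &
    P = <[frow t *m Msh]>%VS]].
  have [s' ss' s's] := sbij.
  apply/seteqP; split=> P.
  - move=> [_ [p [k [pk ->]]] <-]; have [r0 ->] := point p k pk.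
    set r := k%:A - p%:A * z in r0 *; have r'0 : r^-1 != 0 by rewrite invr_eq0.
    exists (s r^-1); split; [by rewrite fmorph_eq0|..|exact: beta_phi].
    rewrite fmorphV invrK -rmorphM -rmorph_trc; apply/eqP; rewrite fmorph_eq0; apply/eqP.
    by apply/(trace_conj_difference dimL _ nz); exists p, k.
  - move=> [t [t0 bt ->]]; pose r := (s' t)^-1.
    have tE : t = s r^-1 by rewrite invrK s's.
    have : trc ((fr (fr z) - fr z) * r) = 0.
      apply/eqP; rewrite -(fmorph_eq0 s) rmorph_trc rmorphM /r fmorphV /= s's.
      exact/eqP.
    move/(trace_conj_difference dimL _ nz) => [p [k rE]].
    have pk : (p, k) != (0, 0).
      apply: contraNneq t0 => -[p0 k0]; rewrite tE rE p0 k0 !scale0r mul0r subr0 invr0.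
      by rewrite rmorph0.
    have [r0 vE] := point p k pk; rewrite -rE in r0 vE.
    exists <[cubic_row p k *m A]>%VS; first by exists p, k.
    have r'0 : r^-1 != 0 by rewrite invr_eq0.
    by rewrite vE beta_phi // -tE.
have SSpi : splash_planes Sp linf beta (fr_subplane Msh) = SS.
  have splE := splash_coordinates dimL planesSp covSp coo
    (shape_splash dimL MU lM sbij be be' K0 al0 nal).
  by apply/seteqP; split=> U; [move/splE/SSE|move/SSE/splE].
have SS_Sp U : SS U -> Sp U by rewrite -SSpi => -[].
exists (fr_subplane Msh); split=> //.
- split; first split.
  + exact: fr_subplane_exterior.
  + by rewrite NE => P [t [t0 _ ->]]; exists t.
  move=> pi' [[subpi' _] Npi']; symmetry.
  have [s' ss' s's] := sbij.
  (* The automorphism [s] permutes [F], so each rational parameter after moving by [s] comes from a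
     parameter of the cubic. *)
  have sF (c : F) : exists d : F, s d%:A = c%:A.
    have [d dE] : exists d : F, s' c%:A = d%:A.
      by apply: fr_fixed; apply: (can_inj ss'); rewrite rmorph_fr s's fr_alg.
    by exists d; rewrite -dE s's.
  apply: (fr_subplane_unique dimL (z := s z) F3 MshU) => //.
    by rewrite -rmorph_fr (inj_eq (can_inj ss')).
  move=> p k pk; have [p' pE] := sF p; have [k' kE] := sF k.
  have pk' : (p', k') != (0, 0).
    apply: contraNneq pk => -[p0 k0]; move: pE kE.
    rewrite p0 k0 !scale0r rmorph0 => /esym/eqP + /esym/eqP.
    by rewrite !alg_eq0 => /eqP -> /eqP ->.
  have [r0 vE] := point p' k' pk'.
  apply: Npi'; exists <[cubic_row p' k' *m A]>%VS; first by exists p', k'.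
  by rewrite vE beta_phi ?invr_eq0 // fmorphV rmorphB rmorphM /= pE kE.
- have coverT := fr2_family_cover dimL iotaK iotaE eH SSE coverX erefl.
  split; first by rewrite SSpi.
  exists (fr2_family iota); last by apply: (fr_fr2_family_neq dimL iotaK iotaE).
  apply: (shape_tangent_cover dimL planesSp covSp betaP MU sbij iotaK iotaE eH baff binf
    K0 al0 nal nFE dH) => [c c1|]; last by rewrite -/Msh SSpi.
  by apply: SS_Sp; apply/SSE; exists c.
- rewrite NE; apply: special_conic_fr => //; rewrite fmorph_eq0 subr_eq0.
  by rewrite (inj_eq (@fr_inj F L)).
Qed.
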